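(* Let $T\in(0,+\infty)$ and let $U\in L^\infty([0,T];L^2(\mathbb{R}^d;\mathbb{R}^d))$ be a weak solution on $\mathbb{R}^d\times(0,T)$ of the incompressible Euler equations. Assume that either (i) $U\in L^\infty([0,T];L^{2+\sigma}(\mathbb{R}^d;\mathbb{R}^d))$ for some $\sigma>0$ and $\nabla^sU\in L^1([0,T];L^{\exp}(\mathbb{R}^d;\mathbb{R}^{d\times d}))$, or (ii) $U\in L^\infty([0,T];L^2(\mathbb{R}^d;\mathbb{R}^d))$ and $\nabla^sU\in L^1([0,T];L^\infty(\mathbb{R}^d;\mathbb{R}^{d\times d}))$. Then $U$ preserves the energy, i.e. $\int_{\mathbb{R}^d}|U(x,\tau)|^2\,dx=\int_{\mathbb{R}^d}|U(x,0)|^2\,dx$ for all $\tau\in[0,T]$.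
   Context: The incompressible Euler equations on $\mathbb{R}^d\times(0,T)$ are $\partial_tu+\operatorname{div}(u\otimes u)+\nabla p=0$, $\operatorname{div}u=0$, $u(\cdot,0)=u_0$. Weak solution: given $u_0\in L^2(\mathbb{R}^d;\mathbb{R}^d)$ with $\operatorname{div}u_0=0$ (in the sense of distributions), a function $u\in L^\infty([0,T];L^2(\mathbb{R}^d;\mathbb{R}^d))$ is a weak solution of the Euler equations with initial datum $u_0$ if for a.e. $\tau\in(0,T)$ $$\int_0^\tau\int_{\mathbb{R}^d}(u\cdot\partial_t\varphi+u\otimes u:\nabla\varphi)\,dx\,dt=\int_{\mathbb{R}^d}u(x,\tau)\cdot\varphi(x,\tau)\,dx-\int_{\mathbb{R}^d}u_0(x)\cdot\varphi(x,0)\,dx,\qquad \int_{\mathbb{R}^d}u(x,\tau)\cdot\nabla q(x)\,dx=0,$$ for all $\varphi\in\mathrm{Lip}(\mathbb{R}^d\times(0,T);\mathbb{R}^d)\cap\mathrm{Lip}((0,T);L^2(\mathbb{R}^d;\mathbb{R}^d)\cap W^{1,\infty}(\mathbb{R}^d;\mathbb{R}^d))$ with $\operatorname{div}\varphi=0$ and all $q\in W^{1,2}(\mathbb{R}^d)$. Any weak solution is always identified with its representative in $C([0,T];w\text{-}L^2(\mathbb{R}^d;\mathbb{R}^d))$ (continuous in time for the weak topology of $L^2$), so that $u(\cdot,0)=u_0$. ''Weak solution'' without mention of the datum means weak solution with some divergence-free initial datum in $L^2$. $\nabla^sU=\frac12(\nabla U+(\nabla U)^{T})$ is the symmetric part of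 the distributional spatial gradient. $L^{\exp}(\mathbb{R}^d)$ is the Orlicz space of measurable functions $f$ such that $\int_{\mathbb{R}^d}\psi(|f|/\beta)\,dx<+\infty$ for some $\beta>0$, where $\psi(s)=e^s-1$, with the Luxemburg norm $\|f\|_{L^{\exp}}=\inf\{\beta>0:\int_{\mathbb{R}^d}\psi(|f|/\beta)\,dx\le1\}$; for matrix-valued functions $|f|$ is the Euclidean (Frobenius) norm. *)

(* Defs.v *)
From HB Require Import structures.
From mathcomp Require Import all_boot all_order all_algebra.
From mathcomp Require Import all_classical all_reals all_analysis.

Set Implicit Arguments.
Unset Strict Implicit.
Unset Printing Implicit Defensive.

Import Order.TTheory GRing.Theory Num.Theory.
Import numFieldNormedType.Exports.

Local Open Scope classical_set_scope.
Local Open Scope ring_scope.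

Fact matrix_display : measure_display. Proof. exact: default_measure_display. Qed.

(* The sigma-algebra generated by the entries; it is the Borel sigma-algebra of
   'M[R]_(m, n), since the topology is the (second countable) product one. *)
Section measurable_matrix.
Context {R : realType} {m n : nat}.

Definition matrix_measurable : set (set 'M[R]_(m, n)) :=
  <<s \bigcup_(ij in [set: 'I_m * 'I_n])
        preimage_set_system setT (fun A : 'M[R]_(m, n) => A ij.1 ij.2)
          measurable >>.

Let mm0 : matrix_measurable set0.
Proof. exact: sigma_algebra0. Qed.

Let mmC A : matrix_measurable A -> matrix_measurable (~` A).
Proof. exact: sigma_algebraC. Qed.

Let mmU (F : (set 'M[R]_(m, n))^nat) :
  (forall i, matrix_measurable (F i)) -> matrix_measurable (\bigcup_i F i).
Proof. exact: sigma_algebra_bigcup. Qed.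

HB.instance Definition _ := @isMeasurable.Build matrix_display
  'M[R]_(m, n) matrix_measurable mm0 mmC mmU.

Lemma measurable_entry (i : 'I_m) (j : 'I_n) :
  measurable_fun setT (fun A : 'M[R]_(m, n) => A i j).
Proof.
move=> _ Y mY; rewrite setTI; apply: sub_sigma_algebra.
by exists (i, j) => //; exists Y => //; rewrite setTI.
Qed.

Lemma measurable_fun_entries d (X : measurableType d) (f : X -> 'M[R]_(m, n)) :
  (forall i j, measurable_fun setT (fun x => f x i j)) -> measurable_fun setT f.
Proof.
move=> mf _ Y; rewrite setTI; move: Y.
apply: (@smallest_sub _ (sigma_algebra setT) _
  [set Y | measurable (f @^-1` Y)]).
  split => /=.
  - by rewrite preimage_set0.
  - by move=> A mA; rewrite setTD preimage_setC; exact: measurableC.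
  - by move=> F mF; rewrite preimage_bigcup; exact: bigcup_measurable.
move=> _ [[i j] _ [B mB <-]] /=; rewrite setTI.
by have := mf i j measurableT B mB; rewrite setTI.
Qed.

End measurable_matrix.

Section lebesgue_measure_rV.
Context {R : realType}.

Definition consrV n (z : measurableTypeR R * 'rV[R]_n) : 'rV[R]_n.+1 := row_mx (z.1 : R)%:M z.2.

Lemma measurable_consrV n : measurable_fun setT (@consrV n).
Proof.
apply: measurable_fun_entries => i j; rewrite /consrV.
have -> : (fun x : measurableTypeR R * 'rV[R]_n => row_mx (x.1 : R)%:M x.2 i j) =
  (fun x => match fintype.split (j : 'I_(1 + n)) with
            | inl k => ((x.1 : R)%:M : 'rV_1) i k | inr k => x.2 i k end).
  by apply/funext => x; rewrite mxE.
case: (fintype.split _) => k.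
  under eq_fun do rewrite mxE !ord1 eqxx mulr1n.
  exact: measurable_fst.
exact: measurableT_comp (measurable_entry i k) measurable_snd.
Qed.

Definition unconsrV n (v : 'rV[R]_n.+1) : measurableTypeR R * 'rV[R]_n :=
  (v 0 0, \row_j v 0 (lift 0 j)).

Lemma consrVK n : cancel (@consrV n) (@unconsrV n).
Proof.
move=> [x v]; rewrite /consrV /unconsrV /=; congr (_, _).
  have -> : (0 : 'I_n.+1) = lshift n (0 : 'I_1) by apply: val_inj.
  by apply: etrans (row_mxEl _ _ _ _) _; rewrite mxE eqxx mulr1n.
apply/rowP => j; rewrite mxE.
have -> : lift (0 : 'I_n.+1) j = rshift 1 j by apply: val_inj.
exact: row_mxEr.
Qed.

Lemma measurable_unconsrV n : measurable_fun setT (@unconsrV n).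
Proof.
apply/measurable_fun_pairP; split; first exact: measurable_entry.
apply: measurable_fun_entries => i j /=.
rewrite (_ : (fun _ => _) = (fun v : 'rV[R]_n.+1 => v 0 (lift 0 j))).
  exact: measurable_entry.
by apply/funext => v; rewrite /= mxE.
Qed.

Section pushforward_consrV.
Context n (nu : {sigma_finite_measure set 'rV[R]_n -> \bar R}).

Definition consrV_measure :=
  pushforward (@lebesgue_measure R \x nu)%E (@consrV n).

Let mu0 : consrV_measure set0 = 0%E.
Proof. by rewrite /consrV_measure /pushforward preimage_set0 measure0. Qed.

Let mu_ge0 A : (0 <= consrV_measure A)%E.
Proof. by rewrite /consrV_measure /pushforward measure_ge0. Qed.

Let mu_sigma_additive : semi_sigma_additive consrV_measure.
Proof.
move=> F mF tF mUF; rewrite /consrV_measure /pushforward preimage_bigcup.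
apply: measure_semi_sigma_additive.
- by move=> k; rewrite -[X in measurable X]setTI; exact: measurable_consrV.
- apply/trivIsetP => /= i j _ _ ij; rewrite -preimage_setI.
  by move/trivIsetP : tF => /(_ _ _ _ _ ij) ->//; rewrite preimage_set0.
- by rewrite -preimage_bigcup -[X in measurable X]setTI; exact: measurable_consrV.
Qed.

HB.instance Definition _ := isMeasure.Build _ _ _ consrV_measure
  mu0 mu_ge0 mu_sigma_additive.

Let sf : sigma_finite setT consrV_measure.
Proof.
have /sigma_finiteP[F [TF ndF Foo]] := sigma_finiteT (@lebesgue_measure R).
have /sigma_finiteP[G [TG ndG Goo]] := sigma_finiteT nu.
exists (fun k => @unconsrV n @^-1` (F k `*` G k)).
  apply/seteqP; split => // v _.
  have [i _ Fi] : (\bigcup_i F i) (unconsrV v).1 by rewrite -TF.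
  have [j _ Gj] : (\bigcup_i G i) (unconsrV v).2 by rewrite -TG.
  exists (maxn i j) => //; split.
    by move: Fi; exact/subsetPset/ndF/leq_maxl.
  by move: Gj; exact/subsetPset/ndG/leq_maxr.
move=> k; have [mF Fk] := Foo k; have [mG Gk] := Goo k; split.
  rewrite -[X in measurable X]setTI.
  by apply: measurable_unconsrV => //; exact: measurableX.
rewrite /consrV_measure /pushforward.
rewrite (_ : _ @^-1` _ = F k `*` G k).
  by rewrite product_measure1E// lte_mul_pinfty// ge0_fin_numE.
by rewrite -comp_preimage (_ : _ \o _ = id)//; apply/funext => z; exact: consrVK.
Qed.

HB.instance Definition _ := @Measure_isSigmaFinite.Build _ _ _
  consrV_measure sf.
End pushforward_consrV.

(* Lebesgue measure on R^n: the n-fold product of the one-dimensional one,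
   transported to row vectors. *)
Fixpoint leb (n : nat) : {sigma_finite_measure set 'rV[R]_n -> \bar R} :=
  if n is k.+1 then consrV_measure (leb k)
  else dirac (0 : 'rV[R]_0).

End lebesgue_measure_rV.

Section vectors.
Context {R : realType}.

Definition mxdot m n (A B : 'M[R]_(m, n)) : R := \sum_i \sum_j A i j * B i j.

(* The library norm of a matrix is the sup norm of its entries. *)
Definition enorm m n (A : 'M[R]_(m, n)) : R := Num.sqrt (mxdot A A).

Definition tensor n (u v : 'rV[R]_n) : 'M[R]_n := u^T *m v.

End vectors.

Section calculus.
Context {R : realType} {d : nat}.
Local Notation E := 'rV[R]_d.

Definition partial (i : 'I_d) (f : E -> R) (x : E) : R :=
  'D_(delta_mx 0 i : E) f x.

Fixpoint Ck (k : nat) (f : E -> R) : Prop :=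
  if k is l.+1 then
    [/\ continuous f, forall x (i : 'I_d), derivable f x (delta_mx 0 i : E)
      & forall i, Ck l (partial i f)]
  else continuous f.

Definition test_function (psi : E -> R) : Prop :=
  (forall k, Ck k psi) /\ compact (closure [set x | psi x != 0]).

End calculus.

Section function_spaces.
Context {R : realType} {d : nat}.
Local Notation E := 'rV[R]_d.

Section fields.
Context {m n : nat}.
Implicit Type f : E -> 'M[R]_(m, n).

Definition Lp_norm (p : \bar R) f : \bar R :=
  Lnorm (leb d) p (fun x => (enorm (f x))%:E).

Definition Lp (p : \bar R) : set (E -> 'M[R]_(m, n)) :=
  [set f | measurable_fun setT f /\ (Lp_norm p f < +oo)%E].

Definition loc_integrable f : Prop :=
  measurable_fun setT f /\
  forall K : set E, compact K ->
    (\int[leb d]_(x in K) (enorm (f x))%:E < +oo)%E.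

Definition Orlicz_psi (s : R) : R := expR s - 1.

Definition Orlicz_int (beta : R) f : \bar R :=
  (\int[leb d]_x (Orlicz_psi (enorm (f x) / beta))%:E)%E.

Definition Lexp : set (E -> 'M[R]_(m, n)) :=
  [set f | measurable_fun setT f /\
    exists2 beta, 0 < beta & (Orlicz_int beta f < +oo)%E].

Definition Lexp_norm f : \bar R :=
  ereal_inf [set beta%:E | beta in
    [set beta | 0 < beta /\ (Orlicz_int beta f <= 1)%E]].

(* f \in L^p([0, T]; Y), for a space Y of fields on R^d with norm [normY]; f is
   a jointly measurable function of (t, x). *)
Definition Lp_time (p : \bar R) (T : R) (Y : set (E -> 'M[R]_(m, n)))
    (normY : (E -> 'M[R]_(m, n)) -> \bar R) (f : R -> E -> 'M[R]_(m, n)) :=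
  [/\ measurable_fun (`[0, T]%classic `*` [set: E])
        (fun z : measurableTypeR R * E => f z.1 z.2),
      {ae (@lebesgue_measure R), forall t : R, t \in `[0, T] -> Y (f t)}
    & (Lnorm (@lebesgue_measure R) p
        ((fun t : R => normY (f t)) \_ `[0%R, T]) < +oo)%E].

End fields.

Definition pairing (f g : E -> R) : R := \int[leb d]_x (f x * g x).

(* The distribution \partial_j f, for f locally integrable. *)
Definition dist_partial (j : 'I_d) (f : E -> R) (psi : E -> R) : R :=
  - pairing f (partial j psi).

Definition is_weak_gradient (f : E -> R) (g : E -> E) : Prop :=
  [/\ loc_integrable (fun x => (f x)%:M : 'M[R]_1), loc_integrable g
    & forall psi (j : 'I_d), test_function psi ->
        pairing (fun x => g x 0 j) psi = dist_partial j f psi].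

(* (\nabla f)_ij = \partial_j f_i *)
Definition is_weak_jacobian m (f : E -> 'rV[R]_m) (G : E -> 'M[R]_(m, d)) :=
  forall i, is_weak_gradient (fun x => f x 0 i) (fun x => row i (G x)).

Definition dist_sym_gradient (u : E -> E) (i j : 'I_d) (psi : E -> R) : R :=
  2^-1 * (dist_partial j (fun x => u x 0 i) psi +
          dist_partial i (fun x => u x 0 j) psi).

Definition is_sym_gradient (u : E -> E) (S : E -> 'M[R]_d) : Prop :=
  [/\ loc_integrable u, loc_integrable S
    & forall psi i j, test_function psi ->
        pairing (fun x => S x i j) psi = dist_sym_gradient u i j psi].

Definition div_free (u : E -> E) : Prop :=
  forall psi, test_function psi ->
    \sum_i dist_partial i (fun x => u x 0 i) psi = 0.

Definition sym_gradient_in_L1 (T : R) (Y : set (E -> 'M[R]_d))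
    (normY : (E -> 'M[R]_d) -> \bar R) (u : R -> E -> E) : Prop :=
  exists S : R -> E -> 'M[R]_d,
    Lp_time 1%:E T Y normY S /\
    {ae (@lebesgue_measure R), forall t : R, t \in `[0, T] ->
      is_sym_gradient (u t) (S t)}.

End function_spaces.

Section euler.
Context {R : realType} {d : nat}.
Local Notation E := 'rV[R]_d.
Local Notation L2 := (Lp 2%:E).

(* q \in W^{1,2}(R^d), with weak gradient g *)
Definition W12 (q : E -> R) (g : E -> E) : Prop :=
  [/\ L2 (fun x => (q x)%:M : 'M[R]_1), L2 g & is_weak_gradient q g].

(* phi is in Lip(R^d x (0,T)) and in Lip((0,T); L^2 \cap W^{1,oo}), with spatial
   gradient Dphi, and is divergence free.  Being Lipschitz, it is identified
   with its unique continuous extension to the closed time interval. *)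
Definition test_field (T : R) (phi : R -> E -> E) (Dphi : R -> E -> 'M[R]_d) :=
  [/\ [lipschitz (fun z : R * E => phi z.1 z.2) z
        | z in `[0, T]%classic `*` [set: E]],
      forall t : R, t \in `[0, T] ->
        [/\ L2 (phi t), Lp +oo%E (phi t), Lp +oo%E (Dphi t)
          & is_weak_jacobian (phi t) (Dphi t)],
      exists L : R, forall s t : R, s \in `[0, T] -> t \in `[0, T] ->
        [/\ (Lp_norm 2%:E (phi t \- phi s)%R <= (L * `|t - s|)%:E)%E,
            (Lp_norm +oo (phi t \- phi s)%R <= (L * `|t - s|)%:E)%E
          & (Lp_norm +oo (Dphi t \- Dphi s)%R <= (L * `|t - s|)%:E)%E]
    & forall t : R, t \in `[0, T] -> div_free (phi t)].

(* The time derivative of phi is the classical one, which exists almost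
   everywhere by Rademacher's theorem. *)
Definition euler_weak_form (u0 : E -> E) (u : R -> E -> E) (tau : R)
    (phi : R -> E -> E) (Dphi : R -> E -> 'M[R]_d) : Prop :=
  \int[lebesgue_measure]_(t in `[0, tau]) \int[leb d]_x
      (mxdot (u t x) (derive1 (phi ^~ x) t) +
       mxdot (tensor (u t x) (u t x)) (Dphi t x))
  = \int[leb d]_x mxdot (u tau x) (phi tau x)
    - \int[leb d]_x mxdot (u0 x) (phi 0 x).

Definition weak_solution_with_datum (T : R) (u0 : E -> E) (u : R -> E -> E) :=
  Lp_time +oo%E T L2 (Lp_norm 2%:E) u /\
  {ae (@lebesgue_measure R), forall tau : R, tau \in `]0, T[ ->
    (forall phi Dphi, test_field T phi Dphi ->
       euler_weak_form u0 u tau phi Dphi) /\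
    (forall q g, W12 q g -> \int[leb d]_x mxdot (u tau x) (g x) = 0)}.

(* u \in C([0, T]; w-L^2) with u(., 0) = u0 *)
Definition weakly_continuous_from (T : R) (u0 : E -> E) (u : R -> E -> E) :=
  [/\ forall t : R, t \in `[0, T] -> L2 (u t),
      forall g : E -> E, L2 g ->
        {within `[0, T], continuous
          (fun t : R => \int[leb d]_x mxdot (u t x) (g x))}
    & {ae leb d, forall x, u 0 x = u0 x}].

(* A weak solution, identified with its weakly continuous representative. *)
Definition weak_solution (T : R) (u : R -> E -> E) : Prop :=
  exists u0 : E -> E,
    [/\ L2 u0, div_free u0, weak_solution_with_datum T u0 u
      & weakly_continuous_from T u0 u].

Definition energy (u : R -> E -> E) (t : R) : \bar R :=
  (\int[leb d]_x (enorm (u t x) ^+ 2)%:E)%E.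

End euler.

(* Main.v *)
(* Let [k] be an even mollifier and test the weak formulation at times [s < t] with the
   stationary fields [k * U(s)] and [k * U(t)], which are Lipschitz and divergence free.  As [k]
   is even, adding the two identities gives the increment of the mollified energy
   [E_k = \int U . (k * U)]; summing over finer and finer partitions of [0, tau], the weak
   continuity of [U] yields [E_k(tau) - E_k(0) = 2 \int_0^tau flux_k(q) dq], where
   [flux_k = \int (U \otimes U) : \nabla v] and [v = k * U].  Since [\int (v \otimes v) : \nabla v = 0],
   [flux_k] is the integral of the commutator [U \otimes U - v \otimes v] against [k * S], with
   [S = \nabla^s U].  The commutator tends to zero in [L^p], where [p = 1 + sigma/2] in case (i)
   and [p = 1] in case (ii).  A Young inequality [a b <= C a^p + 2 (e^b - 1)] pairs [L^p] with
   [L^exp]: applied with [a] the commutator divided by a small [s], it shows that [flux_k]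
   vanishes at almost every time; applied with [s = 1], that it is dominated by a multiple of the
   integrable function [|| S(q) ||].  Dominated convergence in time concludes. *)

(* The exponent [p = 1 + sigma / 2] is forced: the commutator is quadratic in [U], so a bound on [U]
   in [L^(2p)], with [2p = 2 + sigma], places it in [L^p]. The obstacle in case (i) is that smooth
   compactly supported functions are not dense in [L^exp], so [k * S] need not approach [S] in norm.
   All smallness must come from the commutator; of [k * S] only a modular bound is used, inherited
   from [S] because mollification preserves the integral of a nonnegative function. The scale [s] in
   Young's inequality separates the two: the modular term is linear in [s] and uniform in the
   kernel, so [s] is fixed before the radius shrinks. Both cases enter through one such inequality,
   named [gauge], whose modular part is zero in case (ii). In time, the norm of [S(q)] is not known
   to be measurable, so dominated convergence must accept an arbitrary majorant. The weak
   formulation and the norm bound hold at almost every time only; weak continuity spreads them to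
   all of [[0, T]], as the partitions evaluate [U] at prescribed times. *)
From mathcomp Require Import all_boot all_order all_algebra.
From mathcomp Require Import all_classical all_reals all_analysis measurable_realfun.
From mathcomp Require Import ess_sup_inf.
From mathcomp Require Import ring lra.
Require Import Defs.
Set Implicit Arguments.
Unset Strict Implicit.
Unset Printing Implicit Defensive.
Import Order.TTheory GRing.Theory Num.Theory.
Import numFieldNormedType.Exports.
Local Open Scope classical_set_scope.
Local Open Scope ring_scope.

(** * Lebesgue measure on row vectors *)

Section lebesgue_translation.
Context {R : realType}.

Lemma measurable_shiftR (a : R) :
  measurable_fun setT ((fun x => x + a) : measurableTypeR R -> measurableTypeR R).
Proof. exact: measurable_funD. Qed.

Lemma lebesgue_measure_shift (a : R) (A : set (measurableTypeR R)) :
  measurable A -> lebesgue_measure ((fun x => x + a) @^-1` A) = lebesgue_measure A.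
Proof.
move=> mA; apply/esym.
apply: (@lebesgue_measure_unique R
  (measure_function_pushforward__canonical__measure_function_Measure
     lebesgue_measure (measurable_shiftR a))) => //.
move=> X [[x y] _ <-] /=; rewrite /pushforward.
rewrite (_ : _ @^-1` _ = `]x - a, y - a]%classic); last first.
  by apply/seteqP; split => z /=; rewrite !in_itv/= ltrBlDr lerBrDr.
rewrite !lebesgue_measure_itv/= !lte_fin ltrD2r; case: ifPn => // _.
by rewrite -!EFinD opprB addrA subrK.
Qed.

End lebesgue_translation.

Section integral_invariant.
Context d (X : measurableType d) (R : realType) (mu : {measure set X -> \bar R}).
Variable phi : X -> X.
Hypothesis mphi : measurable_fun setT phi.
Hypothesis inv : forall A, measurable A -> mu (phi @^-1` A) = mu A.
Local Open Scope ereal_scope.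

Lemma ge0_integral_invariant (f : X -> \bar R) : measurable_fun setT f ->
  (forall x, 0 <= f x) -> \int[mu]_x f (phi x) = \int[mu]_x f x.
Proof.
move=> mf f0; have := ge0_integral_pushforward mphi mu measurableT mf (fun x _ => f0 x).
rewrite preimage_setT => <-; apply: eq_measure_integral => A mA _.
exact: inv.
Qed.

Lemma integral_invariant (f : X -> \bar R) : measurable_fun setT f ->
  \int[mu]_x f (phi x) = \int[mu]_x f x.
Proof.
move=> mf; rewrite integralE [RHS]integralE; congr (_ - _).
  rewrite -(ge0_integral_invariant (measurable_funepos mf) (funepos_ge0 f)).
  by apply: eq_integral => x _; rewrite !funeposE.
rewrite -(ge0_integral_invariant (measurable_funeneg mf) (funeneg_ge0 f)).
by apply: eq_integral => x _; rewrite !funenegE.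
Qed.

Lemma integrable_invariant (f : X -> \bar R) : mu.-integrable setT f ->
  mu.-integrable setT (f \o phi).
Proof.
move=> /integrableP[mf foo]; apply/integrableP; split.
  exact: measurableT_comp.
rewrite (@ge0_integral_invariant (abse \o f))//; first exact: measurableT_comp.
by move=> x /=; exact: abse_ge0.
Qed.

End integral_invariant.

Section leb_translation.
Context {R : realType}.

Lemma consrV0 n (z : measurableTypeR R * 'rV[R]_n) : consrV z 0 0 = z.1.
Proof. by have := congr1 fst (consrVK z). Qed.

Lemma consrVS n (z : measurableTypeR R * 'rV[R]_n) j :
  consrV z 0 (lift 0 j) = z.2 0 j.
Proof. by have /rowP/(_ j) := congr1 snd (consrVK z); rewrite /= mxE. Qed.

Lemma rV_lift_eq n (u v : 'rV[R]_n.+1) :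
  u 0 0 = v 0 0 -> (forall j, u 0 (lift 0 j) = v 0 (lift 0 j)) -> u = v.
Proof.
by move=> uv0 uvS; apply/rowP => j; case: (unliftP ord0 j) => [k|] ->.
Qed.

Lemma measurable_add n (a : 'rV[R]_n) :
  measurable_fun setT (fun x : 'rV[R]_n => x + a).
Proof.
apply: measurable_fun_entries => i j; under eq_fun do rewrite mxE.
by apply: measurable_funD => //; exact: measurable_entry.
Qed.

(** Induction on the dimension through [consrV]: in every slice the induction hypothesis absorbs the
    shift [a'] of the remaining coordinates, and one-dimensional invariance absorbs the shift of the
    slicing variable. *)
Lemma leb_shift n (a : 'rV[R]_n) (A : set 'rV[R]_n) : measurable A ->
  leb n ((fun x => x + a) @^-1` A) = leb n A.
Proof.
elim: n a A => [|n IH] a A mA.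
  rewrite (_ : _ @^-1` A = A)//; apply/seteqP.
  by split => x /=; rewrite (_ : x + a = x)// !thinmx0.
rewrite /= /consrV_measure /pushforward /=.
pose a' : 'rV[R]_n := \row_j a 0 (lift 0 j).
have E z : consrV z + a = consrV (((z.1 : R) + a 0 0 : R), z.2 + a') :> 'rV[R]_n.+1.
  by apply: rV_lift_eq => [|j]; rewrite mxE ?consrV0 ?consrVS//= !mxE.
rewrite /product_measure1/=.
set B := consrV (n:=n) @^-1` A.
have mB : measurable B.
  by rewrite /B -[X in measurable X]setTI; exact: measurable_consrV.
transitivity (\int[@lebesgue_measure R]_x (leb n (xsection B ((x : R) + a 0 0)%R)))%E.
  apply: eq_integral => x _ /=.
  rewrite -[RHS](IH a'); last exact: measurable_xsection.
  congr (leb n _); apply/seteqP; split => y.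
    by rewrite /xsection /= !inE /B/= E.
  by rewrite /xsection /= !inE /B/= E.
apply: (ge0_integral_invariant (measurable_shiftR (a 0 0)) _ (f := leb n \o xsection B)) => //.
  exact: lebesgue_measure_shift.
exact: measurable_fun_xsection.
Qed.

Lemma integral_shift n (a : 'rV[R]_n) (f : 'rV[R]_n -> \bar R) :
  measurable_fun setT f ->
  (\int[leb n]_x f (x + a)%R = \int[leb n]_x f x)%E.
Proof. exact: (integral_invariant (measurable_add a) (leb_shift a)). Qed.

Lemma integrable_shift n (a : 'rV[R]_n) (f : 'rV[R]_n -> \bar R) :
  (leb n).-integrable setT f -> (leb n).-integrable setT (fun x => f (x + a)).
Proof. exact: (integrable_invariant (measurable_add a) (leb_shift a)). Qed.

Lemma mx_norm_leP m n (x : 'M[R]_(m, n)) (M : R) : 0 <= M ->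
  reflect (forall i j, `|x i j| <= M) (`|x| <= M).
Proof.
move=> M0; rewrite [X in X <= _]mx_normrE; apply: (iffP (bigmax_leP _ _ _ _)).
  by move=> [_ h] i j; exact: (h (i, j)).
by move=> h; split => // -[i j] _; exact: h.
Qed.

Lemma norm_entry m n (x : 'M[R]_(m, n)) i j : `|x i j| <= `|x|.
Proof. by have /(mx_norm_leP _ (normr_ge0 x)) := lexx `|x|. Qed.

Lemma measurable_norm n : measurable_fun setT (fun x : 'rV[R]_n => `|x|).
Proof.
rewrite (_ : Num.Def.normr = fun x : 'rV[R]_n => \big[Num.max/0]_ij `|x ij.1 ij.2|).
  elim: (index_enum _) => [|ij s IH].
    by under eq_fun do rewrite big_nil; exact: measurable_cst.
  under eq_fun do rewrite big_cons; apply: measurable_maxr => //.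
  by apply: measurableT_comp => //; exact: measurable_entry.
by apply/funext => x; rewrite -mx_normrE.
Qed.

Lemma measurable_box n (M : R) : measurable [set x : 'rV[R]_n | `|x| <= M].
Proof.
rewrite -[X in measurable X]setTI.
have := @measurable_norm n measurableT _ (measurable_itv `]-oo, M]).
by rewrite (_ : _ @^-1` _ = [set x | `|x| <= M])//.
Qed.

Lemma consrV_box n (M : R) : 0 <= M -> @consrV R n @^-1` [set x | `|x| <= M] =
  [set` `[-M, M]] `*` [set x : 'rV[R]_n | `|x| <= M].
Proof.
move=> M0; apply/seteqP; split => [[x y]|[x y]] /=.
  move/mx_norm_leP => /(_ M0) h; split.
    by rewrite in_itv/= -ler_norml; have := h 0 0; rewrite consrV0.
  apply/mx_norm_leP => // i j; rewrite (ord1 i).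
  by have := h 0 (lift 0 j); rewrite consrVS.
rewrite in_itv/= -ler_norml => -[xM /mx_norm_leP-/(_ M0) yM].
apply/mx_norm_leP => // i j; rewrite (ord1 i); case: (unliftP ord0 j) => [k|] ->.
  by rewrite consrVS.
by rewrite consrV0.
Qed.

Lemma leb_box_lty n (M : R) : (leb n [set x : 'rV[R]_n | (`|x| <= M)%R] < +oo)%E.
Proof.
have [M0|M0] := ltP M 0.
  rewrite (_ : [set _ | _] = set0) ?measure0//; apply/seteqP; split => x //=.
  by move=> /(le_trans (normr_ge0 _)); rewrite leNgt M0.
elim: n => [|n IH].
  by rewrite /= /dirac indicE; case: (_ \in _); rewrite ltry.
rewrite /= /consrV_measure /pushforward /=.
rewrite consrV_box//.
rewrite product_measure1E//; last exact: measurable_box.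
have E := @lebesgue_measure_itv R `[-M, M].
by rewrite lte_mul_pinfty//= E/=; case: ifP.
Qed.
End leb_translation.

(** * Integration on row vectors: monotonicity, measurability, domination, Fubini *)

Section nonmeasurable_majorant.
Context d (X : measurableType d) (R : realType) (mu : {measure set X -> \bar R}).
Local Open Scope ereal_scope.
(** The integral of a nonnegative function is a supremum over the simple functions below it, so a
    larger function has a larger integral, measurable or not. This allows bounds by norms whose
    dependence on time is not known to be measurable. *)
Lemma ge0_le_integral_any (D : set X) (f g : X -> \bar R) :
  (forall x, D x -> 0 <= f x) -> (forall x, D x -> f x <= g x) ->
  \int[mu]_(x in D) f x <= \int[mu]_(x in D) g x.
Proof.
move=> f0 fg; have g0 x : D x -> 0 <= g x by move=> Dx; exact: le_trans (f0 x Dx) (fg x Dx).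
rewrite !ge0_integralE//; apply: le_ereal_sup => _ [h /= hf <-].
exists h => // x; apply: le_trans (hf x) _.
by rewrite /patch; case: ifPn => // /set_mem; exact: fg.
Qed.
End nonmeasurable_majorant.

Section continuous_measurable.
Context {R : realType} {n : nat}.
Local Notation E := 'rV[R]_n.

Lemma measurable_cball (a : E) (r : R) : measurable [set x : E | `|x - a| <= r].
Proof.
have := measurable_add (- a) measurableT (@measurable_box R n r).
by rewrite setTI.
Qed.

(** The sigma-algebra is generated by the entries, so an open set has to be rebuilt from countably
    many pieces: the closed cubes with rational centre and radius that it contains. *)
Lemma open_measurable_rV (U : set E) : open U -> measurable U.
Proof.
move=> oU.
pose B (q : 'rV[rat]_n * rat) := [set x : E | `|x - map_mx ratr q.1| <= ratr q.2].
have -> : U = \bigcup_(q in [set q | B q `<=` U]) B q.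
  apply/seteqP; split => [x Ux|x [q /= qU] /qU//].
  have := open_nbhs_nbhs (conj oU Ux).
  move=> /nbhs_ballP[e /= e0 eU].
  (* A rational radius below [e / 2]: the cube of that radius around a rational centre within [r] of
     [x] contains [x] and stays in the ball of radius [e]. *)
  have [r /andP[r0 re]] := rat_in_itvoo (divr_gt0 e0 (ltr0Sn R 1)).
  have qi (i : 'I_n) : exists q : rat, `|x 0 i - ratr q| < ratr r.
    have [q] := @rat_in_itvoo R (x 0 i - ratr r) (x 0 i + ratr r)
      ltac:(by rewrite ltrBlDr -addrA ltrDl addr_gt0).
    by rewrite in_itv/= -ltr_distl distrC => h; exists q.
  have /choice [q hq] := qi.
  exists (\row_i q i, r); last first.
    rewrite /B/=; apply/mx_norm_leP; first exact: ltW.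
    by move=> i j; rewrite (ord1 i) !mxE ltW.
  move=> y /=; rewrite /B/= => yB; apply: eU; rewrite mx_norm_ball /ball_/=.
  have xB : `|x - map_mx ratr (\row_i q i)| <= ratr r.
    apply/mx_norm_leP; first exact: ltW.
    by move=> i j; rewrite (ord1 i) !mxE ltW.
  rewrite (_ : x - y = (x - map_mx ratr (\row_i q i)) - (y - map_mx ratr (\row_i q i))).
    apply: le_lt_trans (ler_normB _ _) _; apply: le_lt_trans (lerD xB yB) _.
    by rewrite (splitr e) ltrD.
  by rewrite opprB addrA subrK.
rewrite bigcup_mkcond; apply: countable_bigcupT_measurable; first exact: countableP.
by move=> q; case: ifPn => // _; exact: measurable_cball.
Qed.

Lemma continuous_measurable_rV (f : E -> R) : continuous f -> measurable_fun setT f.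
Proof.
move=> cf; apply: (measurability _ (RGenOpens.measurableE R)).
move=> _ [_ [a [b ->]] <-]; rewrite setTI; apply: open_measurable_rV.
by move/continuousP : cf; apply; exact: interval_open.
Qed.

End continuous_measurable.

Section real_integrals.
Context d (X : measurableType d) (R : realType) (mu : {measure set X -> \bar R}).
Implicit Types f g : X -> R.
Local Notation I f := (mu.-integrable setT (EFin \o f)).

Lemma integrable_measurable f : I f -> measurable_fun setT f.
Proof. by move=> /measurable_int/measurable_EFinP. Qed.

Lemma integrable_le f g : measurable_fun setT f -> (forall x, `|f x| <= g x) ->
  I g -> I f.
Proof.
move=> mf fg ig; apply: (le_integrable measurableT _ _ ig).
  exact/measurable_EFinP.
by move=> x _ /=; rewrite lee_fin (le_trans (fg x))// ler_norm.
Qed.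

Lemma integrableDr f g : I f -> I g -> I (fun x => f x + g x).
Proof. by move=> If Ig; apply: eq_integrable (integrableD measurableT If Ig). Qed.

Lemma integrableBr f g : I f -> I g -> I (fun x => f x - g x).
Proof. by move=> If Ig; apply: eq_integrable (integrableB measurableT If Ig). Qed.

Lemma integrable_cstM (c : R) f : I f -> I (fun x => c * f x).
Proof. by move=> If; apply: eq_integrable (integrableZl measurableT c If). Qed.

Lemma integrableNr f : I f -> I (fun x => - f x).
Proof. by move=> If; apply: eq_integrable (integrableN If). Qed.

Lemma integrable_normr f : I f -> I (fun x => `|f x|).
Proof. by move=> If; apply: eq_integrable (integrable_abse If). Qed.

Lemma integrable_sumr (J : Type) (s : seq J) (F : J -> X -> R) :
  (forall j, I (F j)) -> I (fun x => \sum_(j <- s) F j x).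
Proof.
move=> IF; elim: s => [|j s IH].
  by under eq_fun do rewrite big_nil; exact: integrable0.
by under eq_fun do rewrite big_cons; exact: integrableDr.
Qed.

Lemma Rintegral_sumr (J : Type) (s : seq J) (F : J -> X -> R) :
  (forall j, I (F j)) ->
  \int[mu]_x (\sum_(j <- s) F j x) = \sum_(j <- s) \int[mu]_x F j x.
Proof.
move=> IF; elim: s => [|j s IH].
  under eq_Rintegral do rewrite big_nil.
  by rewrite big_nil /Rintegral integral0.
under eq_Rintegral do rewrite big_cons.
by rewrite RintegralD// ?big_cons ?IH//; exact: integrable_sumr.
Qed.

Lemma integrable_bounded_mul f g (C : R) : I f -> measurable_fun setT g ->
  (forall x, `|g x| <= C) -> I (fun x => f x * g x).
Proof.
move=> If mg gC; apply: (@integrable_le _ (fun x => C * `|f x|)).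
- by apply: measurable_funM => //; exact: integrable_measurable.
- by move=> x; rewrite normrM mulrC ler_wpM2r.
- exact/integrable_cstM/integrable_normr.
Qed.

Lemma integrable_ge0 f : measurable_fun setT f -> (forall x, 0 <= f x) ->
  (\int[mu]_x (f x)%:E < +oo)%E -> I f.
Proof.
move=> mf f0 foo; apply/integrableP; split; first exact/measurable_EFinP.
by under eq_integral do rewrite /= ger0_norm//.
Qed.

Lemma EFin_Rintegral f : I f -> (\int[mu]_x f x)%:E = (\int[mu]_x (f x)%:E)%E.
Proof. by move=> If; rewrite /Rintegral fineK//; exact: integrable_fin_num. Qed.

Lemma Rintegral_norm_le f g : I f -> I g -> (forall x, `|f x| <= g x) ->
  `|\int[mu]_x f x| <= \int[mu]_x g x.
Proof.
move=> If Ig fg; apply: le_trans (le_normr_Rintegral measurableT If) _.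
by apply: le_Rintegral => //; exact: integrable_normr.
Qed.

Lemma cvg_Rintegral_dominated (F : nat -> X -> R) f g :
  (forall n, measurable_fun setT (F n)) -> (forall x, F ^~ x @ \oo --> f x) ->
  I g -> (forall n x, `|F n x| <= g x) ->
  I f /\ \int[mu]_x F n x @[n --> \oo] --> \int[mu]_x f x.
Proof.
move=> mF Ff Ig Fg.
have mf : measurable_fun setT f by apply: measurable_fun_cvg mF _ => x _; exact: Ff.
have FEf : {ae mu, forall x, setT x -> (EFin \o F n) x @[n --> \oo] --> (EFin \o f) x}.
  apply: aeW => x _; apply: cvg_EFin; first exact: nearW.
  exact: Ff.
have [] := @dominated_convergence _ _ _ mu _ measurableT
  (fun n => EFin \o F n) (EFin \o f) (EFin \o g)
  (fun n => (measurable_EFinP _ _).2 (mF n)) ((measurable_EFinP _ _).2 mf) FEf Ig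
  (aeW _ (fun x n _ => Fg n x)).
move=> If _ h; split => //; apply: fine_cvg.
by rewrite EFin_Rintegral.
Qed.

End real_integrals.

Section real_fubini.
Context d1 d2 (X : measurableType d1) (Y : measurableType d2) (R : realType).
Variables (m1 : {sigma_finite_measure set X -> \bar R})
          (m2 : {sigma_finite_measure set Y -> \bar R}).

Lemma Rintegral_fubini (f : X -> Y -> R) :
  (m1 \x m2)%E.-integrable setT (fun z => (f z.1 z.2)%:E) ->
  (forall x, m2.-integrable setT (fun y => (f x y)%:E)) ->
  (forall y, m1.-integrable setT (fun x => (f x y)%:E)) ->
  \int[m1]_x \int[m2]_y f x y = \int[m2]_y \int[m1]_x f x y.
Proof.
move=> If I1 I2.
transitivity (fine (\int[m1]_x \int[m2]_y (f x y)%:E)%E).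
  by congr fine; apply: eq_integral => x _; exact: EFin_Rintegral (I1 x).
transitivity (fine (\int[m2]_y \int[m1]_x (f x y)%:E)%E); last first.
  by congr fine; apply: eq_integral => y _; apply/esym; exact: EFin_Rintegral (I2 y).
by congr fine; exact: (@Fubini _ _ _ _ _ m1 m2 (fun z => (f z.1 z.2)%:E)).
Qed.

End real_fubini.

(** * Mollifiers *)

Section flat_function.
Context {R : realType}.

(** The factor [t^-1 ^+ m] makes the family stable under differentiation: the derivative of [flat m]
    is a combination of [flat m.+1] and [flat m.+2]. Smoothness of [flat 0], the usual exp(-1/t)
    profile, then follows by induction on the order. *)
Definition flat (m : nat) (t : R) : R :=
  if 0 < t then t^-1 ^+ m * expR (- t^-1) else 0.

Lemma flat_ge0 m t : 0 <= flat m t.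
Proof.
rewrite /flat; case: ifPn => // t0.
by rewrite mulr_ge0 ?expR_ge0// exprn_ge0// invr_ge0 ltW.
Qed.

(** The Taylor term of order [m.+2] of exp(1/t) gives the factorial. Quadratic decay at 0 is what
    makes the derivative exist and vanish there. *)
Lemma flat_bound m t : flat m t <= m.+2`!%:R * t ^+ 2.
Proof.
rewrite /flat; case: ifPn => t0; last by rewrite mulr_ge0// sqr_ge0.
have s0 : 0 < t^-1 by rewrite invr_gt0.
have := expR_ge1Dxn m.+1 (ltW s0).
rewrite expRN ler_pdivrMr ?expR_gt0// => h.
have : t^-1 ^+ m.+2 / m.+2`!%:R <= expR t^-1 by apply: le_trans h; rewrite lerDr.
rewrite ler_pdivrMr ?ltr0n ?fact_gt0// => {}h.
have -> : t^-1 ^+ m = t^-1 ^+ m.+2 * t ^+ 2.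
  by rewrite -[m.+2]addn2 exprD -mulrA -exprMn mulVf ?gt_eqF// expr1n mulr1.
by rewrite [leRHS]mulrAC ler_wpM2r ?sqr_ge0// mulrC.
Qed.

Lemma is_derive_flat_pos m (t : R) : 0 < t ->
  is_derive t 1 (fun t : R => t^-1 ^+ m * expR (- t^-1))
   (- m%:R * (t^-1 ^+ m.+1 * expR (- t^-1)) + t^-1 ^+ m.+2 * expR (- t^-1)).
Proof.
move=> t0; have tn0 : t != 0 by rewrite gt_eqF.
have dV : is_derive t 1 (fun s : R => s^-1) (- t ^- 2).
  apply: is_derive_eq; first exact: (is_deriveV (f := id)).
  by rewrite [_ *: _]mulr1.
have dX : is_derive t 1 (fun s : R => s^-1 ^+ m) (m%:R * t^-1 ^+ m.-1 * - t ^- 2).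
  have := @is_deriveX _ _ (fun s : R => s^-1) m t 1 _ dV.
  by rewrite exprfctE.
have dE : is_derive t 1 (fun s : R => expR (- s^-1)) (expR (- t^-1) * t ^- 2).
  have dN : is_derive t 1 (fun s : R => - s^-1) (t ^- 2).
    by apply: is_derive_eq; rewrite opprK.
  exact: (@is_derive1_comp _ expR (fun s : R => - s^-1)).
refine (is_derive_eq (is_deriveM dX dE) _).
have scaleE (a b : R) : a *: b = a * b by [].
rewrite !scaleE -!exprVn; move: (expR _) => e; move: (t^-1) => s.
case: m {dX} => [|m].
  by rewrite /=; ring.
by rewrite /= !exprS; ring.
Qed.

Lemma is_derive_cvg (V : normedModType R) (f : V -> R) (x v : V) (df : R) :
  h^-1 *: (f (h *: v + x) - f x) @[h --> 0^'] --> df -> is_derive x v f df.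
Proof.
move=> h; apply: DeriveDef; first by apply/cvg_ex; exists df.
exact: cvg_lim h.
Qed.

Lemma cvg_is_derive (V : normedModType R) (f : V -> R) (x v : V) (df : R) :
  is_derive x v f df -> h^-1 *: (f (h *: v + x) - f x) @[h --> 0^'] --> df.
Proof. by move=> [d <-]; exact: d. Qed.

Lemma is_derive_flat m (t : R) :
  is_derive t 1 (flat m) (- m%:R * flat m.+1 t + flat m.+2 t).
Proof.
have [t0|t0|t0] := ltgtP t 0.
- apply: (@near_eq_is_derive _ _ _ (cst 0)) => //; last first.
    by rewrite /flat (lt_gtF t0) mulr0 addr0; exact: is_derive_cst.
  near=> s; rewrite /flat; case: ifPn => // s0.
  by exfalso; move: s0; apply/negP; rewrite -leNgt ltW//; near: s; exact: lt_nbhsl.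
- apply: (@near_eq_is_derive _ _ _ (fun t : R => t^-1 ^+ m * expR (- t^-1))) => //; last first.
    by rewrite /flat t0; exact: is_derive_flat_pos.
  near=> s; rewrite /flat ifT//; near: s; exact: lt_nbhsr.
rewrite t0; have flat0 k : flat k 0 = 0 by rewrite /flat ltxx.
rewrite !flat0 mulr0 addr0; apply: is_derive_cvg; rewrite flat0.
apply/cvgr0Pnorm_le => e e0; near=> h.
rewrite subr0 addr0 [_%:A]mulr1 [_ *: _]/(_ * _) normrM normfV.
rewrite ler_pdivrMl ?normr_gt0; last by near: h; exact: nbhs_dnbhs_neq.
rewrite ger0_norm ?flat_ge0//; apply: le_trans (flat_bound _ _) _.
rewrite -(real_normK (num_real h)) expr2 mulrCA; apply: ler_wpM2l => //.
rewrite -ler_pdivlMl ?ltr0n ?fact_gt0//; near: h; apply: dnbhs0_le.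
by rewrite mulr_gt0// invr_gt0 ltr0n fact_gt0.
Unshelve. all: by end_near. Qed.

End flat_function.

Section smoothness.
Context {R : realType} {d : nat}.
Local Notation E := 'rV[R]_d.
Implicit Types f g : E -> R.

Lemma CkW k f : Ck k.+1 f -> Ck k f.
Proof.
elim: k f => [|k IH] f; first by case.
by move=> [cf df Cf]; split => // i; apply: IH; exact: Cf.
Qed.

Lemma Ck_continuous k f : Ck k f -> continuous f.
Proof. by case: k => [|k]// []. Qed.

Lemma Ck_cst k (c : R) : Ck k (cst c : E -> R).
Proof.
elim: k c => [|k IH] c; first exact: cst_continuous.
split => [|x i|i]; [exact: cst_continuous|exact: derivable_cst|].
rewrite (_ : partial i _ = cst 0)//; apply/funext => x.
by rewrite /partial derive_cst.
Qed.

Lemma Ck_add k f g : Ck k f -> Ck k g -> Ck k (fun x => f x + g x).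
Proof.
elim: k f g => [|k IH] f g; first by move=> /= cf cg x; exact: cvgD (cf x) (cg x).
move=> [cf df Cf] [cg dg Cg]; split => [x|x i|i].
- exact: cvgD (cf x) (cg x).
- exact: derivableD.
rewrite (_ : partial i _ = fun x => partial i f x + partial i g x); first exact: IH (Cf i) (Cg i).
by apply/funext => x; rewrite /partial deriveD.
Qed.

Lemma Ck_mul k f g : Ck k f -> Ck k g -> Ck k (fun x => f x * g x).
Proof.
elim: k f g => [|k IH] f g; first by move=> /= cf cg x; exact: cvgM (cf x) (cg x).
move=> Cf' Cg'; have [cf df Cf] := Cf'; have [cg dg Cg] := Cg'; split => [x|x i|i].
- exact: cvgM (cf x) (cg x).
- exact: derivableM.
rewrite (_ : partial i _ = fun x => f x * partial i g x + g x * partial i f x).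
  exact: Ck_add (IH _ _ (CkW Cf') (Cg i)) (IH _ _ (CkW Cg') (Cf i)).
by apply/funext => x; rewrite /partial deriveM.
Qed.

Lemma Ck_prod k (I : Type) (s : seq I) (F : I -> E -> R) :
  (forall i, Ck k (F i)) -> Ck k (fun x => \prod_(i <- s) F i x).
Proof.
move=> CF; elim: s => [|i s IH].
  by under eq_fun do rewrite big_nil; exact: Ck_cst.
by under eq_fun do rewrite big_cons; exact: Ck_mul.
Qed.

Lemma is_derive_line f (x v : E) (df : R) :
  is_derive (0 : R) 1 (fun h : R => f (h *: v + x)) df -> is_derive x v f df.
Proof.
move=> /cvg_is_derive h; apply: is_derive_cvg; move: h.
by under eq_fun do rewrite scale0r add0r addr0 [_%:A]mulr1.
Qed.

Lemma is_derive_flat_affine m (a b : R) (i : 'I_d) (x v : E) :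
  is_derive x v (fun x : E => flat m (a + b * x 0 i))
    (b * v 0 i * (- m%:R * flat m.+1 (a + b * x 0 i) + flat m.+2 (a + b * x 0 i))).
Proof.
apply: is_derive_line.
pose l (h : R) := (a + b * x 0 i) + (b * v 0 i) * h.
have dl : is_derive (0 : R) 1 l (b * v 0 i).
  have := is_deriveD (is_derive_cst (a + b * x 0 i) (0 : R) (1 : R))
    (is_deriveZ (b * v 0 i) (is_derive_id (0 : R) (1 : R))).
  by rewrite add0r [_%:A]mulr1.
rewrite (_ : (fun h : R => _) = flat m \o l); last first.
  by apply/funext => h; rewrite /l/= !mxE; congr flat; ring.
rewrite mulrC; apply: is_derive1_comp => //.
by rewrite {1}/l mulr0 addr0; exact: is_derive_flat.
Qed.

Lemma Ck_flat_affine k m (a b : R) (i : 'I_d) :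
  Ck k (fun x : E => flat m (a + b * x 0 i)).
Proof.
elim: k m => [|k IH] m.
  move=> x; apply: (@continuous_comp _ _ _ (fun x : E => a + b * x 0 i) (flat m)).
    have h : continuous (fun y : E => y 0 i) by exact: coord_continuous.
    exact: cvgD (cvg_cst a) (cvgM (cvg_cst b) (h x)).
  apply/differentiable_continuous/derivable1_diffP.
  by have [] := is_derive_flat m (a + b * x 0 i).
split.
- exact: Ck_continuous (IH m).
- by move=> x j; have [] := is_derive_flat_affine m a b i x (delta_mx 0 j).
move=> j; rewrite (_ : partial j _ = fun x : E => cst (b * (delta_mx 0 j : E) 0 i) x *
  (cst (- m%:R) x * flat m.+1 (a + b * x 0 i) + flat m.+2 (a + b * x 0 i))).
  apply: Ck_mul; first exact: Ck_cst.
  by apply: Ck_add => //; apply: Ck_mul => //; exact: Ck_cst.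
by apply/funext => x; rewrite /partial
  (derive_val (is_derive := is_derive_flat_affine m a b i x (delta_mx 0 j))).
Qed.

End smoothness.

Section kernel.
Context {R : realType}.

Lemma flat0_le1 (t : R) : flat 0 t <= 1.
Proof.
rewrite /flat; case: ifPn => // t0; rewrite expr0 mul1r -expR0 ler_expR.
by rewrite oppr_le0 invr_ge0 ltW.
Qed.

(** With [s = t^-1], this follows from exp(s) >= 1 + s^2/2. As [flat 2] is the derivative of
    [flat 0], it yields the Lipschitz constant of the profile. *)
Lemma flat2_le2 (t : R) : flat 2 t <= 2.
Proof.
rewrite /flat; case: ifPn => // t0; have s0 : 0 <= t^-1 by rewrite invr_ge0 ltW.
have := expR_ge1Dxn 1 s0; rewrite expRN ler_pdivrMr ?expR_gt0//.
rewrite (_ : 2`! = 2)//; set s := t^-1 => h.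
by rewrite -ler_pdivrMl// mulrC; apply: le_trans h; rewrite lerDr.
Qed.

Lemma flat0_lipschitz (s t : R) : `|flat 0 s - flat 0 t| <= 2 * `|s - t|.
Proof.
wlog st : s t / s <= t.
  move=> H; have [/H//|/ltW/H] := leP s t.
  by rewrite distrC [`|t - s|]distrC.
have [] := @MVT_segment R (flat 0) (flat 2) s t st.
- move=> x _; apply: is_derive_eq; first exact: is_derive_flat.
  by rewrite oppr0 mul0r add0r.
- apply: continuous_subspaceT => x; apply/differentiable_continuous/derivable1_diffP.
  by have [] := is_derive_flat 0 x.
move=> c _; rewrite distrC => ->; rewrite normrM distrC ler_wpM2r//.
by rewrite ger0_norm ?flat_ge0// flat2_le2.
Qed.

Lemma flat0_gt0 (t : R) : 0 < t -> 0 < flat 0 t.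
Proof. by move=> t0; rewrite /flat t0 expr0 mul1r expR_gt0. Qed.

Lemma flat0_nd (s t : R) : s <= t -> flat 0 s <= flat 0 t.
Proof.
move=> st; have [s0|s0] := ltP 0 s; last by rewrite {1}/flat ltNge s0 flat_ge0.
have t0 := lt_le_trans s0 st.
by rewrite /flat s0 t0 !expr0 !mul1r ler_expR lerN2 lef_pV2.
Qed.

(** The factors are exchanged one at a time; those left in place lie in [0, 1] and do not amplify
    the difference. *)
Lemma prod_lipschitz (I : Type) (s : seq I) (a b : I -> R) :
  (forall i, 0 <= a i <= 1) -> (forall i, 0 <= b i <= 1) ->
  `|\prod_(i <- s) a i - \prod_(i <- s) b i| <= \sum_(i <- s) `|a i - b i|.
Proof.
move=> a01 b01; elim: s => [|i s IH]; first by rewrite !big_nil subrr normr0.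
rewrite !big_cons.
have -> (x y z w : R) : x * y - z * w = (x - z) * y + z * (y - w) by ring.
apply: le_trans (ler_normD _ _) _; rewrite !normrM lerD//.
  rewrite ler_piMr// ger0_norm ?prodr_ge0//; last by move=> j _; case/andP: (a01 j).
  by apply: prodr_ile1 => j _; exact: a01.
apply: le_trans IH; rewrite ler_piMl// ger0_norm; by case/andP: (b01 i).
Qed.

Context {d : nat}.
Local Notation E := 'rV[R]_d.

(** A product over coordinates suits the sup norm: the bump is supported in a cube. The coefficients
    [1] and [- 1] are written out to match the affine form of [Ck_flat_affine]. *)
Definition bump_factor (e : R) (i : 'I_d) (x : E) : R :=
  flat 0 (e + 1 * x 0 i) * flat 0 (e + (- 1) * x 0 i).

Definition bump (e : R) (x : E) : R := \prod_i bump_factor e i x.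

Lemma bump_factor01 e i x : 0 <= bump_factor e i x <= 1.
Proof.
by rewrite /bump_factor mulr_ge0 ?flat_ge0//= mulr_ile1 ?flat_ge0 ?flat0_le1.
Qed.

Lemma bump_ge0 e x : 0 <= bump e x.
Proof. by apply: prodr_ge0 => i _; case/andP: (bump_factor01 e i x). Qed.

Lemma bump_le1 e x : bump e x <= 1.
Proof. by apply: prodr_ile1 => i _; exact: bump_factor01. Qed.

Lemma bump_even e x : bump e (- x) = bump e x.
Proof.
apply: eq_bigr => i _; rewrite /bump_factor mxE mulrC.
by congr (flat 0 _ * flat 0 _); ring.
Qed.

Lemma bump_support e x : 0 <= e -> e < `|x| -> bump e x = 0.
Proof.
move=> e0 ex; have [i xi] : exists i, e < `|x 0 i|.
  apply: contrapT => /forallNP h; move: ex; apply/negP; rewrite -leNgt.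
  apply/mx_norm_leP => // i j; rewrite (ord1 i).
  by rewrite leNgt; apply/negP; exact: h.
rewrite /bump (bigD1 i)//= /bump_factor mul1r mulN1r.
move: xi; rewrite ltr_normr => /orP[] xi.
  by rewrite {2}/flat subr_gt0 (lt_gtF xi) mulr0 mul0r.
rewrite {1}/flat (_ : (0 < _) = false) ?mul0r//.
by apply/negbTE; rewrite -leNgt; lra.
Qed.

Lemma bump_factor_lipschitz e i (x y : E) :
  `|bump_factor e i x - bump_factor e i y| <= 4 * `|x - y|.
Proof.
rewrite /bump_factor.
set a := flat 0 _; set b := flat 0 _; set a' := flat 0 _; set b' := flat 0 _.
have -> : a * b - a' * b' = (a - a') * b + a' * (b - b') by ring.
have xyi : `|x 0 i - y 0 i| <= `|x - y|.
  by have := norm_entry (x - y) 0 i; rewrite !mxE.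
apply: le_trans (ler_normD _ _) _; rewrite !normrM.
rewrite (_ : 4 * _ = 2 * `|x - y| + 2 * `|x - y|); last by ring.
apply: lerD.
  rewrite -[leRHS]mulr1; apply: ler_pM => //; last by rewrite ger0_norm ?flat_ge0 ?flat0_le1.
  apply: le_trans (flat0_lipschitz _ _) _; rewrite ler_wpM2l//.
  by rewrite (_ : _ - _ = x 0 i - y 0 i)//; ring.
rewrite -[leRHS]mul1r; apply: ler_pM => //; first by rewrite ger0_norm ?flat_ge0 ?flat0_le1.
apply: le_trans (flat0_lipschitz _ _) _; rewrite ler_wpM2l//.
by rewrite (_ : _ - _ = - (x 0 i - y 0 i)) ?normrN//; ring.
Qed.

Lemma bump_lipschitz e (x y : E) : `|bump e x - bump e y| <= d%:R * 4 * `|x - y|.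
Proof.
apply: le_trans (prod_lipschitz _ (fun i => bump_factor01 e i x) (fun i => bump_factor01 e i y)) _.
apply: (@le_trans _ _ (\sum_(i < d) 4 * `|x - y|)).
  by apply: ler_sum => i _; exact: bump_factor_lipschitz.
by rewrite sumr_const cardT size_enum_ord -[leRHS]mulrA [leRHS]mulr_natl.
Qed.

Lemma bump_lower e x : 0 < e -> `|x| <= e / 2 -> (flat 0 (e / 2) ^+ 2) ^+ d <= bump e x.
Proof.
move=> e0 xe; rewrite /bump -{1}(card_ord d) -prodr_const.
apply: ler_prod => i _; rewrite exprn_ge0 ?flat_ge0//= /bump_factor expr2.
have : `|x 0 i| <= e / 2 by apply: le_trans xe; exact: norm_entry.
rewrite ler_norml => /andP[h1 h2].
apply: ler_pM; rewrite ?flat_ge0//; apply: flat0_nd; lra.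
Qed.

Lemma Ck_bump_shift k e (x : E) : Ck k (fun y : E => bump e (x - y)).
Proof.
apply: Ck_prod => i; rewrite /bump_factor.
rewrite (_ : (fun y : E => _) = fun y : E => flat 0 ((e + x 0 i) + (- 1) * y 0 i) *
   flat 0 ((e - x 0 i) + 1 * y 0 i)).
  by apply: Ck_mul; exact: Ck_flat_affine.
by apply/funext => y; rewrite !mxE; congr (flat 0 _ * flat 0 _); ring.
Qed.

(** Evenness makes convolution with [k] self-adjoint in [L^2]. The field [mollifier_test] allows the
    weak divergence and the weak symmetric gradient to be tested with translated kernels, which
    computes the mollified quantities point by point. *)
Record mollifier (r : R) (k : E -> R) : Prop := Mollifier {
  mollifier_ge0 : forall x, 0 <= k x;
  mollifier_even : forall x, k (- x) = k x;
  mollifier_support : forall x, r < `|x| -> k x = 0;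
  mollifier_integrable : (leb d).-integrable setT (EFin \o k);
  mollifier_mass : \int[leb d]_x k x = 1;
  mollifier_bounded : exists C, forall x, k x <= C;
  mollifier_lipschitz : exists2 L, 0 <= L & forall x y, `|k x - k y| <= L * `|x - y|;
  mollifier_test : forall x, test_function (fun y => k (x - y))
}.

Lemma bump_continuous e : continuous (bump e : E -> R).
Proof.
rewrite (_ : bump e = fun y => bump e (0 - y)).
  exact: Ck_continuous (Ck_bump_shift 0 e 0).
by apply/funext => y; rewrite sub0r bump_even.
Qed.

Lemma integrable_bounded_support (f : E -> R) (r C : R) : measurable_fun setT f ->
  (forall x, `|f x| <= C) -> (forall x, r < `|x| -> f x = 0) ->
  (leb d).-integrable setT (EFin \o f).
Proof.
move=> mf fC fr; pose B := [set x : E | `|x| <= r].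
have mB : measurable B by exact: measurable_box.
have IB : (leb d).-integrable setT (EFin \o (fun x => C * \1_B x)).
  apply: integrable_cstM; apply: integrable_ge0 => //.
  by under eq_integral do rewrite /=; rewrite integral_indic// setIT leb_box_lty.
apply: integrable_le IB => // x; rewrite indicE.
have [xr|xr] := leP `|x| r; first by rewrite mem_set// mulr1.
by rewrite memNset ?mulr0 ?fr ?normr0//; apply/negP; rewrite -ltNge.
Qed.

Lemma integrable_bump e : 0 <= e -> (leb d).-integrable setT (EFin \o (bump e : E -> R)).
Proof.
move=> e0; apply: (@integrable_bounded_support _ e 1).
- by apply: continuous_measurable_rV; exact: bump_continuous.
- by move=> x; rewrite ger0_norm ?bump_ge0 ?bump_le1.
- by move=> x; exact: bump_support.
Qed.

Lemma leb_box_gt0 (n : nat) (M : R) : 0 < M -> (0 < leb n [set x : 'rV[R]_n | (`|x| <= M)%R])%E.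
Proof.
move=> M0; elim: n => [|n IH].
  rewrite /= /dirac indicE mem_set// /=.
  by apply/mx_norm_leP; [exact: ltW|move=> i []].
rewrite /= /consrV_measure /pushforward /= consrV_box ?ltW//.
rewrite product_measure1E//; last exact: measurable_box.
have E := @lebesgue_measure_itv R `[-M, M].
have M2 : - M < M by lra.
by apply: mule_gt0 => //; rewrite [X in (_ < X)%E]E/= lte_fin M2 -EFinD lte_fin; lra.
Qed.

Lemma bump_mass e : 0 < e -> 0 < \int[leb d]_x (bump e x : R).
Proof.
move=> e0; pose B := [set x : E | `|x| <= e / 2].
have mB : measurable B by exact: measurable_box.
(* On the cube of half size each of the [2 d] profiles is at least [flat 0 (e / 2)], which bounds
   the bump below on a set of positive measure. *)
pose c : R := (flat 0 (e / 2) ^+ 2) ^+ d.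
have c0 : 0 < c by rewrite !exprn_gt0// flat0_gt0// divr_gt0.
have IB : (leb d).-integrable setT (EFin \o (fun x => c * \1_B x)).
  apply: integrable_cstM; apply: integrable_ge0 => //.
  by under eq_integral do rewrite /=; rewrite integral_indic// setIT leb_box_lty.
apply: (@lt_le_trans _ _ (\int[leb d]_x (c * \1_B x))).
  rewrite RintegralZl//; last first.
    apply: integrable_ge0 => //.
    by under eq_integral do rewrite /=; rewrite integral_indic// setIT leb_box_lty.
  rewrite mulr_gt0// /Rintegral integral_indic// setIT fine_gt0//.
  by rewrite leb_box_gt0 ?divr_gt0//= leb_box_lty.
apply: le_Rintegral => //; first by apply: integrable_bump; exact: ltW.
move=> x _; rewrite indicE; have [xr|xr] := leP `|x| (e / 2).
  by rewrite mem_set// mulr1 bump_lower.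
by rewrite memNset ?mulr0 ?bump_ge0//; apply/negP; rewrite -ltNge.
Qed.

Lemma test_function_support (f : E -> R) (a : E) (r : R) : 0 < r ->
  (forall k, Ck k f) -> (forall y, r < `|a - y| -> f y = 0) -> test_function f.
Proof.
move=> r0 Cf fr; split => //; apply: bounded_closed_compact; last exact: closed_closure.
have sub : closure [set y | f y != 0] `<=` [set y | `|a - y| <= r].
  rewrite closureE; apply: smallest_sub.
    have := @closed_ball_closed R E a r; rewrite closed_ballE//.
  by move=> y /= fy; rewrite leNgt; apply/negP => /fr fy0; rewrite fy0 eqxx in fy.
exists (r + `|a|); split; first exact: num_real.
move=> M rM y /sub /= yr; apply: le_trans (ltW rM).
rewrite -[y](subrK a); apply: le_trans (ler_normD _ _) _.
by rewrite lerD2r distrC.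
Qed.

Lemma mollifier_exists (r : R) : 0 < r -> exists k, mollifier r k.
Proof.
move=> r0; have m0 := bump_mass r0; have r0' := ltW r0.
pose c := (\int[leb d]_x (bump r x : R))^-1.
have c0 : 0 < c by rewrite invr_gt0.
exists (fun x => c * bump r x); split.
- by move=> x; rewrite mulr_ge0 ?bump_ge0 ?ltW.
- by move=> x; rewrite bump_even.
- by move=> x rx; rewrite bump_support ?mulr0.
- exact: integrable_cstM (integrable_bump r0').
- rewrite RintegralZl//; last exact: integrable_bump.
  by rewrite mulVf// gt_eqF.
- by exists c => x; rewrite ler_piMr ?bump_le1 ?ltW.
- exists (c * (d%:R * 4)) => [|x y]; first by apply: mulr_ge0; [exact: ltW|exact: mulr_ge0].
  by rewrite -mulrBr normrM (gtr0_norm c0) -mulrA ler_wpM2l ?bump_lipschitz ?ltW.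
- move=> x; apply: (@test_function_support _ x r) => //.
    by move=> k; apply: Ck_mul; [exact: Ck_cst|exact: Ck_bump_shift].
  by move=> y ry; rewrite bump_support ?mulr0.
Qed.

End kernel.

(** * Averages of translates *)

Section averages.
Context {R : realType} {d : nat}.
Local Notation E := 'rV[R]_d.
Local Notation mu := (leb d : {sigma_finite_measure set E -> \bar R}).
Variables (r : R) (k : E -> R).
Hypothesis mk : mollifier r k.

Lemma mollifier_measurable : measurable_fun setT k.
Proof. exact: integrable_measurable (mollifier_integrable mk). Qed.

Lemma mollifier_sym (x y : E) : k (x - y) = k (y - x).
Proof. by rewrite -(mollifier_even mk) opprB. Qed.

Lemma measurable_sub2 : measurable_fun setT (fun z : E * E => z.1 - z.2).
Proof.
apply: measurable_fun_entries => i j; under eq_fun do rewrite !mxE.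
apply: measurable_funB.
  exact: measurableT_comp (measurable_entry i j) measurable_fst.
exact: measurableT_comp (measurable_entry i j) measurable_snd.
Qed.

Lemma measurable_kernel : measurable_fun setT (fun z : E * E => k (z.1 - z.2)).
Proof. exact: measurableT_comp mollifier_measurable measurable_sub2. Qed.

Lemma measurable_subl (x : E) : measurable_fun setT (fun y : E => x - y).
Proof.
apply: measurable_fun_entries => i j; under eq_fun do rewrite !mxE.
by apply: measurable_funB => //; exact: measurable_entry.
Qed.

Lemma integrable_kernel (x : E) : mu.-integrable setT (fun y => (k (x - y))%:E).
Proof.
have := integrable_shift (- x) (mollifier_integrable mk).
by apply: eq_integrable => // y _ /=; rewrite mollifier_sym.
Qed.

Lemma kernel_mass (x : E) : (\int[mu]_y (k (x - y))%:E = 1)%E.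
Proof.
transitivity (\int[mu]_y (EFin \o k) (y - x)%R)%E.
  by apply: eq_integral => y _ /=; rewrite mollifier_sym.
rewrite (integral_shift (- x)); last by apply/measurable_EFinP; exact: mollifier_measurable.
by rewrite -(EFin_Rintegral (mollifier_integrable mk)) (mollifier_mass mk).
Qed.

(** The measure [k (x - y) dx dy] has Lebesgue measure as both marginals ([pair_average_fst],
    [pair_average_snd]), so an error depending on one variable costs exactly its integral. Values in
    [\bar R] keep the manipulations free of integrability conditions. *)
Definition pair_average (G : E -> E -> R) : \bar R :=
  (\int[mu \x mu]_z (k (z.1 - z.2) * G z.1 z.2)%:E)%E.

Let mfst (h : E -> R) : measurable_fun setT h ->
  measurable_fun setT (fun z : E * E => h z.1).
Proof. by move=> mh; exact: measurableT_comp mh measurable_fst. Qed.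

Let msnd (h : E -> R) : measurable_fun setT h ->
  measurable_fun setT (fun z : E * E => h z.2).
Proof. by move=> mh; exact: measurableT_comp mh measurable_snd. Qed.

Lemma pair_average_fst (h : E -> R) : measurable_fun setT h -> (forall x, 0 <= h x) ->
  pair_average (fun x y => h x) = (\int[mu]_x (h x)%:E)%E.
Proof.
move=> mh h0; rewrite /pair_average.
rewrite (fubini_tonelli1 (fun z : E * E => (k (z.1 - z.2) * h z.1)%:E)); last 2 first.
- by apply/measurable_EFinP; apply: measurable_funM; [exact: measurable_kernel|exact: mfst].
- by move=> z; rewrite lee_fin mulr_ge0// (mollifier_ge0 mk).
apply: eq_integral => x _; rewrite /fubini_F/=.
under eq_integral do rewrite mulrC EFinM.
rewrite ge0_integralZl_EFin//; first by rewrite kernel_mass mule1.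
- by move=> y _; rewrite lee_fin (mollifier_ge0 mk).
- exact: measurable_int (integrable_kernel x).
Qed.

Lemma pair_average_snd (h : E -> R) : measurable_fun setT h -> (forall x, 0 <= h x) ->
  pair_average (fun x y => h y) = (\int[mu]_x (h x)%:E)%E.
Proof.
move=> mh h0; rewrite /pair_average.
rewrite (fubini_tonelli2 (fun z : E * E => (k (z.1 - z.2) * h z.2)%:E)); last 2 first.
- by apply/measurable_EFinP; apply: measurable_funM; [exact: measurable_kernel|exact: msnd].
- by move=> z; rewrite lee_fin mulr_ge0// (mollifier_ge0 mk).
apply: eq_integral => y _; rewrite /fubini_G/=.
under eq_integral do rewrite mulrC EFinM mollifier_sym.
rewrite ge0_integralZl_EFin//; first by rewrite kernel_mass mule1.
- by move=> x _; rewrite lee_fin (mollifier_ge0 mk).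
- exact: measurable_int (integrable_kernel y).
Qed.

Lemma le_pair_average (G H : E -> E -> R) :
  measurable_fun setT (fun z : E * E => G z.1 z.2) ->
  measurable_fun setT (fun z : E * E => H z.1 z.2) ->
  (forall x y, 0 <= G x y) ->
  (forall x y, `|x - y| <= r -> G x y <= H x y) ->
  (pair_average G <= pair_average H)%E.
Proof.
move=> mG mH G0 GH; apply: ge0_le_integral => //.
- by move=> z _; rewrite lee_fin mulr_ge0// (mollifier_ge0 mk).
- by apply/measurable_EFinP; apply: measurable_funM => //; exact: measurable_kernel.
- by apply/measurable_EFinP; apply: measurable_funM => //; exact: measurable_kernel.
move=> [x y] _ /=; rewrite lee_fin; have [xy|xy] := leP `|x - y| r.
  by rewrite ler_wpM2l ?(mollifier_ge0 mk)// GH.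
by rewrite (mollifier_support mk xy) !mul0r.
Qed.

Lemma pair_averageD (G H : E -> E -> R) :
  measurable_fun setT (fun z : E * E => G z.1 z.2) ->
  measurable_fun setT (fun z : E * E => H z.1 z.2) ->
  (forall x y, 0 <= G x y) -> (forall x y, 0 <= H x y) ->
  pair_average (fun x y => G x y + H x y) = (pair_average G + pair_average H)%E.
Proof.
move=> mG mH G0 H0; rewrite -ge0_integralD//.
- by apply: eq_integral => z _; rewrite mulrDr EFinD.
- by move=> z _; rewrite lee_fin mulr_ge0// (mollifier_ge0 mk).
- by apply/measurable_EFinP; apply: measurable_funM => //; exact: measurable_kernel.
- by move=> z _; rewrite lee_fin mulr_ge0// (mollifier_ge0 mk).
- by apply/measurable_EFinP; apply: measurable_funM => //; exact: measurable_kernel.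
Qed.

Lemma pair_averageZ (c : R) (G : E -> E -> R) : 0 <= c ->
  measurable_fun setT (fun z : E * E => G z.1 z.2) ->
  (forall x y, 0 <= G x y) ->
  pair_average (fun x y => c * G x y) = (c%:E * pair_average G)%E.
Proof.
move=> c0 mG G0; rewrite -ge0_integralZl_EFin//.
- by apply: eq_integral => z _; rewrite mulrCA EFinM.
- by move=> z _; rewrite lee_fin mulr_ge0// (mollifier_ge0 mk).
- by apply/measurable_EFinP; apply: measurable_funM => //; exact: measurable_kernel.
Qed.

Lemma measurable_osc (f : E -> R) : measurable_fun setT f ->
  measurable_fun setT (fun z : E * E => `|f z.1 - f z.2|).
Proof.
move=> mf; apply: measurableT_comp => //.
by apply: measurable_funB; [exact: mfst|exact: msnd].
Qed.

Lemma measurable_fst_fun (h : E -> R) : measurable_fun setT h ->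
  measurable_fun setT (fun z : E * E => h z.1).
Proof. exact: mfst. Qed.

Lemma measurable_snd_fun (h : E -> R) : measurable_fun setT h ->
  measurable_fun setT (fun z : E * E => h z.2).
Proof. exact: msnd. Qed.

End averages.

(** * The averaged oscillation of a function vanishes with the radius of the kernel *)

Section approximate_identity.
Context {R : realType} {d : nat}.
Local Notation E := 'rV[R]_d.
Local Notation mu := (leb d : {sigma_finite_measure set E -> \bar R}).
Variable K : nat -> E -> R.
Hypothesis mK : forall n, mollifier (n.+1%:R^-1) (K n).

(** This is the [L^1] continuity of translations, averaged over the kernel. The property is linear
    and stable under [L^1] limits, so it climbs from Lipschitz functions to orthants, to measurable
    sets, to simple functions and to integrable functions. *)
Definition osc_vanishes (f : E -> R) := forall e : R, 0 < e ->
  \forall n \near \oo, (pair_average (K n) (fun x y => `|f x - f y|)%R <= e%:E)%E.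

Lemma osc_vanishes_approx (f : E -> R) : measurable_fun setT f ->
  (forall e, 0 < e -> exists g, [/\ measurable_fun setT g, osc_vanishes g &
     (\int[mu]_x `|f x - g x|%R%:E <= e%:E)%E]) ->
  osc_vanishes f.
Proof.
move=> mf h e e0; have e3 : 0 < e / 3 by lra.
have [g [mg og fg]] := h _ e3.
have := og _ e3; apply: filterS => n on.
have mfg : measurable_fun setT (fun x => `|f x - g x|).
  by apply: measurableT_comp => //; exact: measurable_funB.
apply: (@le_trans _ _ (pair_average (K n) (fun x y => (`|g x - g y| + `|f x - g x|) + `|f y - g y|))).
  apply: (le_pair_average (mK n)) => //.
  - exact: measurable_osc.
  - apply: measurable_funD; last exact: (measurable_snd_fun mfg).
    by apply: measurable_funD; [exact: measurable_osc|exact: (measurable_fst_fun mfg)].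
  - move=> x y _; rewrite (_ : f x - f y = (g x - g y) + (f x - g x) - (f y - g y)); last by ring.
    by apply: le_trans (ler_normB _ _) _; rewrite lerD2r ler_normD.
rewrite (pair_averageD (mK n))//; last 2 first.
- by apply: measurable_funD; [exact: measurable_osc|exact: (measurable_fst_fun mfg)].
- exact: (measurable_snd_fun mfg).
rewrite (pair_averageD (mK n))//; last 2 first.
- exact: measurable_osc.
- exact: (measurable_fst_fun mfg).
rewrite (pair_average_fst (mK n) mfg)// (pair_average_snd (mK n) mfg)//.
rewrite (_ : e = e / 3 + e / 3 + e / 3); last by field.
by rewrite !EFinD; apply: leeD => //; exact: leeD.
Qed.

Lemma osc_vanishesD (f g : E -> R) : measurable_fun setT f -> measurable_fun setT g ->
  osc_vanishes f -> osc_vanishes g -> osc_vanishes (fun x => f x + g x).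
Proof.
move=> mf mg of_ og e e0; have e2 : 0 < e / 2 by lra.
have := og _ e2; apply: filter_app; have := of_ _ e2; apply: filterS => n fn gn.
apply: (@le_trans _ _ (pair_average (K n) (fun x y => `|f x - f y| + `|g x - g y|))).
  apply: (le_pair_average (mK n)) => //.
  - exact: (measurable_osc (measurable_funD mf mg)).
  - by apply: measurable_funD; exact: measurable_osc.
  - move=> x y _; rewrite (_ : _ - _ = (f x - f y) + (g x - g y)); last by ring.
    exact: ler_normD.
rewrite (pair_averageD (mK n))//; try exact: measurable_osc.
by rewrite (splitr e) EFinD leeD.
Qed.

Lemma osc_vanishesZ (c : R) (f : E -> R) : measurable_fun setT f ->
  osc_vanishes f -> osc_vanishes (fun x => c * f x).
Proof.
move=> mf of_ e e0; have c1 : 0 < `|c| + 1 by rewrite ltr_wpDl.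
have := of_ (e / (`|c| + 1)) ltac:(by rewrite divr_gt0).
apply: filterS => n fn.
rewrite (_ : (fun x y => _) = (fun x y => `|c| * `|f x - f y|)); last first.
  by apply/funext => x; apply/funext => y; rewrite -mulrBr normrM.
rewrite (pair_averageZ (mK n))//; last exact: measurable_osc.
apply: (@le_trans _ _ (`|c|%:E * (e / (`|c| + 1))%:E)%E).
  by apply: lee_wpmul2l.
by rewrite -EFinM lee_fin mulrA ler_pdivrMr// mulrC ler_wpM2l ?(ltW e0)// lerDl.
Qed.

Lemma osc_vanishes_sum (I : Type) (s : seq I) (F : I -> E -> R) :
  (forall i, measurable_fun setT (F i)) -> (forall i, osc_vanishes (F i)) ->
  osc_vanishes (fun x => \sum_(i <- s) F i x).
Proof.
move=> mF oF; elim: s => [|i s IH].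
  move=> e e0; apply: nearW => n; under eq_fun do rewrite big_nil.
  rewrite /pair_average; under eq_integral do rewrite !big_nil subrr normr0 mulr0.
  by rewrite integral0 lee_fin ltW.
under eq_fun do rewrite big_cons; apply: osc_vanishesD => //.
exact: measurable_sum.
Qed.

Lemma osc_vanishes_lipschitz (g : E -> R) (L M : R) : 0 <= L -> measurable_fun setT g ->
  (forall x y, `|g x - g y| <= L * `|x - y|) ->
  (forall x, M < `|x| -> g x = 0) -> osc_vanishes g.
Proof.
move=> L0 mg gL gM e e0.
(* The kernel radius is at most 1, so a pair with [x] outside [B] has its other point beyond [M] as
   well and contributes nothing. *)
pose B := [set x : E | `|x| <= M + 1].
have mB : measurable B by exact: measurable_box.
have fB : (mu B < +oo)%E by exact: leb_box_lty.
have mI : measurable_fun setT (\1_B : E -> R) by exact: measurable_indic.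
pose C := L * fine (mu B).
have C0 : 0 <= C by rewrite mulr_ge0// fine_ge0.
have : \forall n \near \oo, (C + 1) / e <= n.+1%:R :> R.
  near=> n; apply: (@le_trans _ _ n%:R); last by rewrite ler_nat.
  by near: n; exact: nbhs_infty_ger.
apply: filterS => n hn.
have rn : C * n.+1%:R^-1 <= e.
  rewrite ler_pdivrMr ?ltr0n// -ler_pdivrMl// mulrC.
  by apply: le_trans hn; rewrite ler_wpM2r ?invr_ge0 ?(ltW e0)// lerDl.
have rn1 : n.+1%:R^-1 <= 1 :> R by rewrite invf_le1 ?ltr0n// ler1n.
apply: (@le_trans _ _ (pair_average (K n) (fun x y => (L * n.+1%:R^-1) * \1_B x))).
  apply: (le_pair_average (mK n)) => //.
  - exact: measurable_osc.
  - by apply: measurable_funM => //; exact: (measurable_fst_fun mI).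
  move=> x y xy; rewrite indicE; have [xM|xM] := leP `|x| (M + 1).
    by rewrite mem_set// mulr1; apply: le_trans (gL x y) _; rewrite ler_wpM2l.
  rewrite gM ?gM ?subrr ?normr0 ?memNset ?mulr0//.
  - by apply/negP; rewrite -ltNge.
    have := ler_normD (x - y) y; rewrite subrK => h.
    rewrite -(ltrD2l 1) [1 + M]addrC; apply: lt_le_trans xM _; apply: le_trans h _.
    by rewrite lerD2r (le_trans xy).
  by apply: le_lt_trans xM; rewrite lerDl.
rewrite (pair_averageZ (mK n))//; first last.
- exact: (measurable_fst_fun mI).
- by rewrite mulr_ge0 ?invr_ge0.
rewrite (pair_average_fst (mK n))// integral_indic// setIT.
rewrite [X in (_ * X)%E](_ : _ = (fine (mu B))%:E); last first.
  by rewrite fineK// ge0_fin_numE.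
by rewrite -EFinM lee_fin mulrAC.
Unshelve. all: by end_near. Qed.

Definition clip01 (t : R) : R := Num.max 0 (Num.min 1 t).

Lemma clip01_itv t : 0 <= clip01 t <= 1.
Proof. by rewrite /clip01 le_max lexx/= ge_max ler01 ge_min lexx. Qed.

Lemma clip01_ge1 t : 1 <= t -> clip01 t = 1.
Proof. by move=> t1; rewrite /clip01 min_l// max_r. Qed.

Lemma clip01_le0 t : t <= 0 -> clip01 t = 0.
Proof. by move=> t0; rewrite /clip01 max_l// ge_min t0 orbT. Qed.

Lemma clip01_lipschitz s t : `|clip01 s - clip01 t| <= `|s - t|.
Proof.
wlog ts : s t / t <= s.
  move=> H; have [/H//|/ltW/H] := leP t s.
  by rewrite distrC [`|t - s|]distrC.
rewrite [leRHS]ger0_norm ?subr_ge0// /clip01 !maxEle !minEle ler_norml.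
case: (leP 1 s) => ?; case: (leP 1 t) => ?; rewrite ?ler01.
- by apply/andP; split; lra.
- by case: (leP 0 t) => ?; apply/andP; split; lra.
- lra.
- by case: (leP 0 s) => ?; case: (leP 0 t) => ?; apply/andP; split; lra.
Qed.

Definition cutoff (N : nat) (x : E) : R := clip01 (N.+1%:R - `|x|).

Lemma cutoff_lipschitz N x y : `|cutoff N x - cutoff N y| <= `|x - y|.
Proof.
apply: le_trans (clip01_lipschitz _ _) _.
rewrite (_ : _ - _ = `|y| - `|x|); last by ring.
by rewrite distrC; exact: ler_dist_dist.
Qed.

Lemma measurable_clip01 : measurable_fun setT clip01.
Proof.
by apply: measurable_maxr => //; apply: measurable_minr.
Qed.

Lemma measurable_cutoff N : measurable_fun setT (cutoff N).
Proof.
apply: measurableT_comp measurable_clip01 _.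
by apply: measurable_funB => //; exact: measurable_norm.
Qed.

Lemma cutoff_support N x : N.+1%:R < `|x| -> cutoff N x = 0.
Proof. by move=> h; rewrite /cutoff clip01_le0// subr_le0 ltW. Qed.

Lemma integrable_cutoff N : mu.-integrable setT (EFin \o cutoff N).
Proof.
apply: (@integrable_bounded_support _ _ _ N.+1%:R 1); first exact: measurable_cutoff.
- by move=> x; have /andP[c0 c1] := clip01_itv (N.+1%:R - `|x|); rewrite ger0_norm.
- exact: cutoff_support.
Qed.

Lemma cvg_cutoff x : cutoff N x @[N --> \oo] --> (1 : R).
Proof.
apply/cvgrPdist_le => e e0; near=> N.
rewrite /cutoff clip01_ge1 ?subrr ?normr0 ?(ltW e0)//.
rewrite lerBrDr -natr1 addrC lerD2r; near: N; exact: nbhs_infty_ger.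
Unshelve. all: by end_near. Qed.

(** Open orthants generate the sigma-algebra and are closed under intersection, the corner of an
    intersection being the coordinatewise maximum. Their indicators are pointwise limits of the
    Lipschitz functions [ramp]. *)
Definition upper_box (a : E) : set E := [set x | forall i, a 0 i < x 0 i].

Definition ramp (a : E) (m : nat) (x : E) : R :=
  \prod_(i < d) clip01 (m%:R * (x 0 i - a 0 i)).

Lemma ramp_itv a m x : 0 <= ramp a m x <= 1.
Proof.
apply/andP; split; first by apply: prodr_ge0 => i _; case/andP: (clip01_itv (m%:R * (x 0 i - a 0 i))).
by apply: prodr_ile1 => i _; exact: clip01_itv.
Qed.

Lemma measurable_ramp a m : measurable_fun setT (ramp a m).
Proof.
apply: measurable_prod => i _; apply: measurableT_comp measurable_clip01 _.
apply: measurable_funM => //; apply: measurable_funB => //.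
exact: measurable_entry.
Qed.

Lemma ramp_lipschitz a m x y : `|ramp a m x - ramp a m y| <= d%:R * m%:R * `|x - y|.
Proof.
apply: le_trans (prod_lipschitz _ (fun i => clip01_itv _) (fun i => clip01_itv _)) _.
apply: (@le_trans _ _ (\sum_(i < d) m%:R * `|x - y|)).
  apply: ler_sum => i _; apply: le_trans (clip01_lipschitz _ _) _.
  rewrite (_ : _ - _ = m%:R * (x - y) 0 i); last by rewrite !mxE; ring.
  by rewrite normrM ger0_norm// ler_wpM2l// norm_entry.
by rewrite sumr_const cardT size_enum_ord -[leRHS]mulrA [leRHS]mulr_natl.
Qed.

Lemma cvg_ramp a x : ramp a m x @[m --> \oo] --> (\1_(upper_box a) x : R).
Proof.
apply/cvgrPdist_le => e e0; rewrite indicE.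
have [xa|xa] := pselect (upper_box a x).
  rewrite mem_set//; near=> m; rewrite /ramp big1 ?subrr ?normr0 ?(ltW e0)// => i _.
  rewrite clip01_ge1// -ler_pdivrMr ?subr_gt0// mul1r.
  by move: i; near: m; apply: filter_forall => i; exact: nbhs_infty_ger.
rewrite memNset//; near=> m; move/existsNP : xa => [i /negP]; rewrite -leNgt => xi.
rewrite /ramp (bigD1 i)//= clip01_le0 ?mul0r ?subrr ?normr0 ?(ltW e0)//.
by rewrite mulr_ge0_le0// subr_le0.
Unshelve. all: by end_near. Qed.

Lemma dominated_L1_approx (F : nat -> E -> R) (f g : E -> R) :
  (forall n, measurable_fun setT (F n)) -> (forall x, F ^~ x @ \oo --> f x) ->
  mu.-integrable setT (EFin \o g) -> (forall n x, `|F n x| <= g x) ->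
  forall e, 0 < e -> exists n, (\int[mu]_x `|f x - F n x|%R%:E <= e%:E)%E.
Proof.
move=> mF Ff Ig Fg e e0.
have mf : measurable_fun setT f by apply: measurable_fun_cvg mF _ => x _; exact: Ff.
have fg x : `|f x| <= g x.
  have h : `|F n x| @[n --> \oo] --> `|f x| by exact: cvg_norm (Ff x).
  rewrite -(cvg_lim _ h)//; apply: limr_le.
    by apply/cvg_ex; exists `|f x|.
  exact: nearW.
have mD n : measurable_fun setT (fun x => `|f x - F n x|).
  by apply: measurableT_comp => //; exact: measurable_funB.
have I2 : mu.-integrable setT (EFin \o (fun x => 2 * g x)) by exact: integrable_cstM.
have D2 n x : `|f x - F n x| <= 2 * g x.
  by apply: le_trans (ler_normB _ _) _; rewrite mulr_natl mulr2n lerD.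
have D0 x : `|f x - F n x| @[n --> \oo] --> (0 : R).
  rewrite -(normr0 R) -(subrr (f x)); apply: cvg_norm; apply: cvgB => //.
  exact: cvg_cst.
have D3 n x : `| `|f x - F n x| | <= 2 * g x by rewrite normr_id.
have [_] := cvg_Rintegral_dominated mD D0 I2 D3.
rewrite Rintegral_cst// mul0r => /cvgrPdist_le /(_ _ e0) [n _ /(_ n (leqnn n))].
rewrite sub0r normrN => h; exists n.
have In : mu.-integrable setT (EFin \o (fun x => `|f x - F n x|)).
  by apply: integrable_le I2 => // x; rewrite normr_id.
rewrite -(EFin_Rintegral In) lee_fin; apply: le_trans h; exact: ler_norm.
Qed.

Lemma osc_vanishes_upper_box a N : osc_vanishes (fun x => \1_(upper_box a) x * cutoff N x).
Proof.
have cN x : 0 <= cutoff N x <= 1 by exact: clip01_itv.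
have Frl m x : `|ramp a m x * cutoff N x| <= cutoff N x.
  rewrite normrM ger0_norm; last by case/andP: (ramp_itv a m x).
  rewrite [`|cutoff _ _|]ger0_norm; last by case/andP: (cN x).
  by rewrite ler_piMl//; [case/andP: (cN x)|case/andP: (ramp_itv a m x)].
have mF m : measurable_fun setT (fun x => ramp a m x * cutoff N x).
  by apply: measurable_funM; [exact: measurable_ramp|exact: measurable_cutoff].
have Ff x : ramp a m x * cutoff N x @[m --> \oo] --> \1_(upper_box a) x * cutoff N x.
  by apply: cvgM; [exact: cvg_ramp|exact: cvg_cst].
apply: osc_vanishes_approx.
  by apply: measurable_fun_cvg mF _ => x _; exact: Ff.
move=> e e0; have [m hm] := dominated_L1_approx mF Ff (integrable_cutoff N) Frl e0.
exists (fun x => ramp a m x * cutoff N x); split => //.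
(* Both factors are bounded by 1, so the slopes add up: [d * m] from the ramp and 1 from the
   cutoff. *)
apply: (@osc_vanishes_lipschitz _ (d%:R * m%:R + 1) N.+1%:R) => //.
- move=> x y; rewrite (_ : _ - _ =
    (ramp a m x - ramp a m y) * cutoff N x + ramp a m y * (cutoff N x - cutoff N y)); last by ring.
  apply: le_trans (ler_normD _ _) _; rewrite !normrM mulrDl mul1r; apply: lerD.
    rewrite -[leRHS]mulr1; apply: ler_pM => //; first exact: ramp_lipschitz.
    by have /andP[c0 c1] := cN x; rewrite ger0_norm.
  rewrite -[leRHS]mul1r; apply: ler_pM => //; last exact: cutoff_lipschitz.
  by have /andP[c0 c1] := ramp_itv a m y; rewrite ger0_norm.
- by move=> x h; rewrite cutoff_support ?mulr0.
Qed.

Lemma measurable_upper_box a : measurable (upper_box a).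
Proof.
rewrite (_ : upper_box a = ~` \bigcup_i [set x : E | x 0 i <= a 0 i]).
  apply: measurableC; apply: countable_bigcupT_measurable; first exact: countableP.
  move=> i; rewrite -[X in measurable X]setTI.
  have := @measurable_entry R 1 d 0 i measurableT _ (measurable_itv `]-oo, a 0 i]).
  by congr measurable; congr setI.
apply/seteqP; split => [x h [i _ /=]|x h i]; first by rewrite leNgt h.
by rewrite ltNge; apply/negP => xi; apply: h; exists i.
Qed.

Lemma upper_boxes_generate :
  (@measurable _ E) = <<s [set A | exists a, A = upper_box a] >>.
Proof.
apply/seteqP; split; last first.
  apply: smallest_sub; first exact: sigma_algebra_measurable.
  by move=> _ [a ->]; exact: measurable_upper_box.
apply: smallest_sub; first exact: smallest_sigma_algebra.
move=> _ [[i j] _ [B mB <-]]; rewrite setTI /= (ord1 i) {i}.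
pose G := <<s [set A | exists a, A = upper_box a] >>.
have sG : sigma_algebra setT G by exact: smallest_sigma_algebra.
suff H (c : R) : G [set x : E | c < x 0 j].
  have : measurable_fun (setT : set (g_sigma_algebraType [set A | exists a : E, A = upper_box a]))
      (fun x : E => x 0 j).
    apply: (measurability _ (RGenOInfty.measurableE R)) => _ [_ [c ->] <-].
    rewrite setTI; apply: eq_ind (H c) _ _; apply/seteqP.
    by split => x /=; rewrite in_itv/= andbT.
  by move=> /(_ measurableT B mB); rewrite setTI.
(* A half-space is exhausted by orthants whose other corner coordinates tend to minus infinity. *)
rewrite (_ : [set x : E | c < x 0 j] = \bigcup_(n : nat)
    upper_box (\row_i (if i == j then c else - n%:R))).
  have [_ _ sU] := sG; apply: sU => n; apply: sub_sigma_algebra.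
  by exists (\row_i (if i == j then c else - n%:R)).
apply/seteqP; split => [x /= cx|x [n _ /(_ j)]]; last by rewrite mxE eqxx.
have [n hn] : exists n : nat, `|x| < n%:R by exists (Num.bound `|x|); exact: archi_boundP.
exists n => // i; rewrite mxE; case: eqP => [->//|_].
have := norm_entry x 0 i; move=> /le_lt_trans/(_ hn); rewrite ltr_norml.
by case/andP.
Qed.

(** Dynkin induction on [A]. The factor [cutoff N] gives finite weight even to the whole space, so
    that passing to a complement amounts to subtracting from [cutoff N] itself. *)
Lemma osc_vanishes_indic N (A : set E) : measurable A ->
  osc_vanishes (fun x => \1_A x * cutoff N x).
Proof.
move=> mA; move: (mA); rewrite upper_boxes_generate.
have cN x : 0 <= cutoff N x <= 1 by exact: clip01_itv.
have ocN : osc_vanishes (cutoff N).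
  apply: (@osc_vanishes_lipschitz _ 1 N.+1%:R) => //.
  - exact: measurable_cutoff.
  - by move=> x y; rewrite mul1r; exact: cutoff_lipschitz.
  - exact: cutoff_support.
have mi (B : set E) : measurable B -> measurable_fun setT (fun x => \1_B x * cutoff N x : R).
  by move=> mB; apply: measurable_funM => //; exact: measurable_cutoff.
move: A {mA}; apply: (@dynkin_induction _ _ [set A | exists a, A = upper_box a]
   (fun A => osc_vanishes (fun x => \1_A x * cutoff N x))).
- exact: upper_boxes_generate.
- move=> _ _ [a ->] [b ->]; exists (\row_i Num.max (a 0 i) (b 0 i)).
  apply/seteqP; split => x /=.
    by move=> [ha hb] i; rewrite mxE gt_max ha hb.
  by move=> h; split => i; have := h i; rewrite mxE gt_max => /andP[].
- by under eq_fun do rewrite indicT mul1r.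
- by move=> _ [a ->]; exact: osc_vanishes_upper_box.
- move=> A mA oA.
  rewrite (_ : (fun x => _) = (fun x => cutoff N x + (- 1) * (\1_A x * cutoff N x))).
    apply: osc_vanishesD => //; first exact: measurable_cutoff.
      by apply: measurable_funM => //; exact: mi.
    by apply: osc_vanishesZ => //; exact: mi.
  apply/funext => x; rewrite !indicE in_setC; case: (x \in A) => /=; ring.
move=> F mF tF oF.
(* By disjointness at most one term is nonzero at each [x], so the partial sums stay below
   [cutoff N], which dominates their convergence to the union. *)
pose S n := fun x => \sum_(i <- index_iota 0 n) \1_(F i) x * cutoff N x.
have mU : measurable (\bigcup_k F k) by exact: bigcup_measurable.
have mS n : measurable_fun setT (S n) by apply: measurable_sum => i; exact: mi.
have SE x i0 n : F i0 x -> S n x = (i0 < n)%N%:R * cutoff N x.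
  move=> Fx; rewrite /S; elim: n => [|n IH]; first by rewrite big_nil mul0r.
  rewrite big_nat_recr//= IH -mulrDl indicE [in RHS]ltnS [in RHS]leq_eqVlt; congr (_ * _).
  have [Ei|i0n] := eqVneq i0 n; first by rewrite -Ei mem_set// ltnn add0r.
  rewrite memNset ?addr0// => Fn; move/eqP : i0n; apply.
  by apply: (tF i0 n I I); exists x.
have S0 x n : (forall i, ~ F i x) -> S n x = 0.
  by move=> Fx; rewrite /S big1// => i _; rewrite indicE memNset// mul0r.
have Scvg x : S n x @[n --> \oo] --> \1_(\bigcup_k F k) x * cutoff N x.
  have [[i0 _ Fx]|nFx] := pselect ((\bigcup_k F k) x).
    rewrite indicE mem_set; last by exists i0.
    apply: cvg_near_cst; near=> n; rewrite (SE _ _ _ Fx) (_ : (i0 < n)%N)//.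
    by near: n; exact: nbhs_infty_gt.
  rewrite indicE memNset// mul0r; apply: cvg_near_cst; apply: nearW => n.
  by apply: S0 => i Fx; apply: nFx; exists i.
have Sb n x : `|S n x| <= cutoff N x.
  have /andP[c0 c1] := cN x.
  have [[i0 _ Fx]|nFx] := pselect ((\bigcup_k F k) x).
    by rewrite (SE _ _ _ Fx); case: (i0 < n)%N; rewrite ?mul1r ?mul0r ?normr0// ger0_norm.
  by rewrite S0 ?normr0// => i Fx; apply: nFx; exists i.
apply: osc_vanishes_approx; first exact: mi.
move=> e e0; have [n hn] := dominated_L1_approx mS Scvg (integrable_cutoff N) Sb e0.
exists (S n); split => //; apply: osc_vanishes_sum => i; [exact: mi|exact: oF].
Unshelve. all: by end_near. Qed.

Import HBSimple.

(** Cutting off at infinity and replacing [f] by a simple function cost [e / 2] each in [L^1]; what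
    remains is a finite combination of cut off indicators. *)
Lemma osc_vanishes_integrable (f : E -> R) : mu.-integrable setT (EFin \o f) ->
  osc_vanishes f.
Proof.
move=> If; have mf := integrable_measurable If.
have cN N x : 0 <= cutoff N x <= 1 by exact: clip01_itv.
apply: osc_vanishes_approx => // e e0; have e2 : 0 < e / 2 by lra.
have mfc N : measurable_fun setT (fun x => f x * cutoff N x).
  by apply: measurable_funM => //; exact: measurable_cutoff.
have fc x : f x * cutoff N x @[N --> \oo] --> f x.
  by rewrite -[X in _ --> X]mulr1; apply: cvgM; [exact: cvg_cst|exact: cvg_cutoff].
have fcb N x : `|f x * cutoff N x| <= `|f x|.
  have /andP[c0 c1] := cN N x; by rewrite normrM [`|cutoff _ _|]ger0_norm// ler_piMr.
have [N hN] := dominated_L1_approx mfc fc (integrable_normr If) fcb e2.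
have [g [Ig _ gf]] := approximation_sfun_integrable measurableT If.
have [m hm] : exists m, (\int[mu]_x `|f x - g m x|%R%:E <= (e / 2)%:E)%E.
  move: gf => /fine_cvgP[_ /cvgrPdist_le/(_ _ e2)] [m _ /(_ m (leqnn m))] /=.
  have Im : mu.-integrable setT (EFin \o (fun x => `|f x - g m x|)).
    exact/integrable_normr/integrableBr.
  rewrite sub0r normrN => h; exists m.
  rewrite -(EFin_Rintegral Im) lee_fin; apply: le_trans h; exact: ler_norm.
have mgm : measurable_fun setT (g m : E -> R) by [].
have mgc : measurable_fun setT (fun x => g m x * cutoff N x).
  by apply: measurable_funM => //; exact: measurable_cutoff.
exists (fun x => g m x * cutoff N x); split => //.
  pose s : seq R := finmap.enum_fset (fset_set (range (g m))).
  rewrite (_ : (fun x => _) =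
      (fun x => \sum_(y <- s) y * (\1_(g m @^-1` [set y]) x * cutoff N x))); last first.
    apply/funext => x; rewrite [in LHS]fimfunE fsbig_finite//= mulr_suml.
    by apply: eq_bigr => y _; rewrite mulrA.
  apply: osc_vanishes_sum => y.
    apply: measurable_funM => //; apply: measurable_funM; last exact: measurable_cutoff.
    by apply: measurable_indic; rewrite -[X in measurable X]setTI; exact: mgm.
  apply: osc_vanishesZ; last first.
    by apply: osc_vanishes_indic; rewrite -[X in measurable X]setTI; exact: mgm.
  apply: measurable_funM; last exact: measurable_cutoff.
  by apply: measurable_indic; rewrite -[X in measurable X]setTI; exact: mgm.
have m1 : measurable_fun setT (fun x => `|f x - f x * cutoff N x|).
  by apply: measurableT_comp => //; exact: measurable_funB.
have m2 : measurable_fun setT (fun x => `|f x - g m x|).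
  by apply: measurableT_comp => //; exact: measurable_funB.
apply: (@le_trans _ _ (\int[mu]_x ((`|f x - f x * cutoff N x|)%R%:E + (`|f x - g m x|)%R%:E))%E).
  apply: ge0_le_integral => //.
  - apply/measurable_EFinP; apply: measurableT_comp => //; exact: measurable_funB.
  - by apply: emeasurable_funD; exact/measurable_EFinP.
  move=> x _; rewrite -EFinD lee_fin.
  rewrite (_ : f x - g m x * _ = (f x - f x * cutoff N x) + (f x - g m x) * cutoff N x); last by ring.
  apply: le_trans (ler_normD _ _) _; rewrite lerD2l normrM.
  by have /andP[c0 c1] := cN N x; rewrite [`|cutoff _ _|]ger0_norm// ler_piMr.
rewrite ge0_integralD//; [|exact/measurable_EFinP..].
by rewrite (splitr e) EFinD leeD.
Qed.

Lemma ler_powRl (q a b : R) : 0 <= q -> 0 <= a -> a <= b -> a `^ q <= b `^ q.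
Proof.
move=> q0 a0 ab; apply: ge0_ler_powR; rewrite ?nnegrE//.
exact: le_trans a0 ab.
Qed.

(** The sum of three terms is at most three times the largest one; this crude bound replaces
    convexity. *)
Lemma powR_triangle3 (q a b c d' : R) : 0 <= q -> 0 <= a -> 0 <= b -> 0 <= c -> 0 <= d' ->
  a <= b + c + d' -> a `^ q <= 3 `^ q * (b `^ q + (c `^ q + d' `^ q)).
Proof.
move=> q0 a0 b0 c0 d0 h; set m := Num.max b (Num.max c d').
have m0 : 0 <= m by rewrite /m le_max b0.
have am : a <= 3 * m.
  have bm : b <= m by rewrite /m le_max lexx.
  have cm : c <= m by rewrite /m !le_max lexx orbT.
  have dm : d' <= m by rewrite /m !le_max lexx !orbT.
  lra.
apply: (@le_trans _ _ ((3 * m) `^ q)).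
  by apply: ge0_ler_powR; rewrite ?nnegrE// mulr_ge0.
rewrite powRM// ler_wpM2l ?powR_ge0//.
rewrite /m; case: (leP b (Num.max c d')) => _; last by rewrite lerDl addr_ge0 ?powR_ge0.
by case: (leP c d') => _; have := powR_ge0 b q; have := powR_ge0 c q; have := powR_ge0 d' q; lra.
Qed.

(** Both tails are removed. Discarding small values makes the truncation integrable when only
    [|f| ^ q] is; discarding large ones bounds it, so that the power [q] of a difference is
    controlled by the difference itself. *)
Definition trunc (m : nat) (f : E -> R) (x : E) : R :=
  if (m.+1%:R^-1 <= `|f x|) && (`|f x| <= m.+1%:R) then f x else 0.

Lemma measurable_trunc m f : measurable_fun setT f -> measurable_fun setT (trunc m f).
Proof.
move=> mf; apply: measurable_fun_ifT => //.
have mnf : measurable_fun setT (fun x => `|f x|) by exact: measurableT_comp.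
by apply: measurable_and; exact: measurable_fun_ler.
Qed.

Lemma measurable_powR_norm (q : R) (f : E -> R) : measurable_fun setT f ->
  measurable_fun setT (fun x => `|f x| `^ q).
Proof.
move=> mf; apply: (measurableT_comp (measurable_powR q)).
exact: measurableT_comp.
Qed.

Lemma trunc_integrable (q : R) m (f : E -> R) : 1 <= q -> measurable_fun setT f ->
  mu.-integrable setT (EFin \o (fun x => `|f x| `^ q)) ->
  mu.-integrable setT (EFin \o trunc m f).
Proof.
move=> q1 mf Iq; pose c : R := (m.+1%:R^-1) `^ (q - 1).
have c0 : 0 < c by rewrite powR_gt0 ?invr_gt0 ?ltr0n.
have q0 : 0 < q by rewrite (lt_le_trans ltr01).
apply: (@integrable_le _ _ _ _ _ (fun x => c^-1 * `|f x| `^ q)).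
- exact: measurable_trunc.
- move=> x; rewrite /trunc; case: ifPn => [/andP[h1 h2]|_].
    rewrite ler_pdivlMl// -mulr_powRB1// mulrC ler_wpM2l//.
    by apply: ge0_ler_powR; rewrite ?nnegrE ?invr_ge0// subr_ge0.
  by rewrite normr0 mulr_ge0 ?powR_ge0// invr_ge0 ltW.
- exact: integrable_cstM.
Qed.

Lemma osc_vanishes_powR (q : R) (f : E -> R) : 1 <= q -> measurable_fun setT f ->
  mu.-integrable setT (EFin \o (fun x => `|f x| `^ q)) ->
  forall e : R, 0 < e ->
  \forall n \near \oo,
    (pair_average (K n) (fun x y => `|f x - f y| `^ q)%R <= e%:E)%E.
Proof.
move=> q1 mf Iq e e0; have q0 : 0 < q by rewrite (lt_le_trans ltr01).
pose C : R := 3 `^ q; have C0 : 0 < C by rewrite powR_gt0.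
have e4 : 0 < e / (C * 4) by rewrite divr_gt0// mulr_gt0.
pose h m x := f x - trunc m f x.
have mt m := measurable_trunc m mf.
have mh m : measurable_fun setT (h m) by exact: measurable_funB.
have hf m x : `|h m x| <= `|f x|.
  by rewrite /h /trunc; case: ifP => _; rewrite ?subrr ?normr0// subr0.
have mhq m := measurable_powR_norm q (mh m).
have hcvg x : `|h m x| `^ q @[m --> \oo] --> (0 : R).
  have [m0 _ hm0] : \forall m \near \oo, trunc m f x = f x.
    have [fx0|fx0] := eqVneq (f x) 0.
      by apply: nearW => m; rewrite /trunc fx0; case: ifP.
    near=> m; rewrite /trunc ifT//; apply/andP; split.
      rewrite invf_ple ?posrE ?ltr0n ?normr_gt0//.
      apply: (@le_trans _ _ m%:R); last by rewrite ler_nat.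
      by near: m; exact: nbhs_infty_ger.
    apply: (@le_trans _ _ m%:R); last by rewrite ler_nat.
    by near: m; exact: nbhs_infty_ger.
  apply: cvg_near_cst; exists m0 => // m /hm0 hm.
  by rewrite /h hm subrr normr0 powR0// gt_eqF.
have hb m x : `| `|h m x| `^ q | <= `|f x| `^ q.
  by rewrite ger0_norm ?powR_ge0//; apply: ler_powRl => //; exact: ltW.
have [m hm] := dominated_L1_approx mhq hcvg Iq hb e4.
have {}hm : (\int[mu]_x (`|h m x| `^ q)%:E <= (e / (C * 4))%:E)%E.
  apply: le_trans hm; rewrite le_eqVlt; apply/orP; left; apply/eqP.
  by apply: eq_integral => x _; rewrite sub0r normrN (ger0_norm (powR_ge0 _ _)).
(* Truncated values are at most [m.+1], so a difference [a] of two of them satisfies [a ^ q <= D a].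
   The budget [e] is split into one half for the truncation and one quarter for each of the two
   remainders. *)
pose D : R := (2 * m.+1%:R) `^ (q - 1).
have D0 : 0 < D by rewrite powR_gt0// mulr_gt0 ?ltr0n.
have e2 : 0 < e / (C * D * 2) by rewrite divr_gt0// !mulr_gt0.
have := osc_vanishes_integrable (trunc_integrable m q1 mf Iq) e2.
apply: filterS => n hn.
have mot := measurable_osc (mt m).
have m1 : measurable_fun setT (fun z : E * E => D * `|trunc m f z.1 - trunc m f z.2|).
  exact: measurable_funM.
have m2 : measurable_fun setT (fun z : E * E => `|h m z.1| `^ q + `|h m z.2| `^ q).
  by apply: measurable_funD; [exact: (measurable_fst_fun (mhq m))|exact: (measurable_snd_fun (mhq m))].
apply: (@le_trans _ _ (pair_average (K n) (fun x y =>
   C * (D * `|trunc m f x - trunc m f y| + (`|h m x| `^ q + `|h m y| `^ q))))).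
  apply: (le_pair_average (mK n)) => //.
  - by apply: (measurableT_comp (measurable_powR q)); exact: measurable_osc.
  - by apply: measurable_funM => //; exact: measurable_funD.
  move=> x y _.
  apply: (@le_trans _ _ (C * (`|trunc m f x - trunc m f y| `^ q + (`|h m x| `^ q + `|h m y| `^ q)))).
    apply: powR_triangle3 => //; first exact: ltW.
    rewrite (_ : f x - f y = (trunc m f x - trunc m f y) + h m x - h m y); last by rewrite /h; ring.
    by apply: le_trans (ler_normB _ _) _; rewrite lerD2r ler_normD.
  rewrite ler_wpM2l ?(ltW C0)// lerD2r -mulr_powRB1// mulrC ler_wpM2r//.
  have tb z : `|trunc m f z| <= m.+1%:R.
    by rewrite /trunc; case: ifPn => [/andP[]//|_]; rewrite normr0.
  apply: ge0_ler_powR; rewrite ?nnegrE ?subr_ge0 ?mulr_ge0//.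
  by apply: le_trans (ler_normB _ _) _; rewrite mulr_natl mulr2n lerD.
rewrite (pair_averageZ (mK n)) ?(ltW C0)//; last 2 first.
- exact: measurable_funD.
- by move=> x y; rewrite !addr_ge0 ?powR_ge0// mulr_ge0// ltW.
rewrite (pair_averageD (mK n))//; last by move=> x y; rewrite mulr_ge0// ltW.
rewrite (pair_averageZ (mK n)) ?(ltW D0)//.
rewrite (pair_averageD (mK n)); last 4 first.
- exact: (measurable_fst_fun (mhq m)).
- exact: (measurable_snd_fun (mhq m)).
- by move=> x y; exact: powR_ge0.
- by move=> x y; exact: powR_ge0.
rewrite (pair_average_fst (mK n))// (pair_average_snd (mK n))//.
apply: (@le_trans _ _ (C%:E * (D%:E * (e / (C * D * 2))%:E + ((e / (C * 4))%:E + (e / (C * 4))%:E)))%E).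
  apply: lee_wpmul2l; first by rewrite lee_fin ltW.
  apply: leeD; last exact: leeD.
  by apply: lee_wpmul2l => //; rewrite lee_fin ltW.
rewrite -(EFinM D) -!EFinD -(EFinM C) lee_fin le_eqVlt; apply/orP; left; apply/eqP.
by field; rewrite !gt_eqF.
Unshelve. all: by end_near. Qed.

End approximate_identity.

Lemma cvg_Rintegral_dnbhs d (X : measurableType d) (R : realType)
    (mu : {measure set X -> \bar R}) (F : R -> X -> R) (f g : X -> R) :
  (forall h, measurable_fun setT (F h)) ->
  (forall x, F h x @[h --> 0^'] --> f x) ->
  mu.-integrable setT (EFin \o g) ->
  (forall h x, h != 0 -> `|h| <= 1 -> `|F h x| <= g x) ->
  \int[mu]_x F h x @[h --> 0^'] --> \int[mu]_x f x.
Proof.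
move=> mF Ff Ig Fg; apply/cvgr_dnbhsP => u [u0 cu].
(* The domination is assumed for [|h| <= 1] only; the finitely many terms of [u] that violate it are
   replaced by 1, which does not affect the limit. *)
pose v n := if `|u n| <= 1 then u n else 1.
have v0 n : v n != 0 by rewrite /v; case: ifP => // _; exact: oner_neq0.
have v1 n : `|v n| <= 1 by rewrite /v; case: ifPn => // _; rewrite normr1.
have uv : \forall n \near \oo, u n = v n.
  move/cvgr0Pnorm_le : (cu) => /(_ 1 ltr01); apply: filterS => n un.
  by rewrite /v un.
have cv : v @ \oo --> 0.
  by apply: cvg_trans cu; apply: near_eq_cvg; apply: filterS uv => n ->.
apply: (@cvg_trans _ (\int[mu]_x F (v n) x @[n --> \oo])).
  by apply: near_eq_cvg; apply: filterS uv => n ->.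
have Fv x : F (v n) x @[n --> \oo] --> f x.
  by have /cvgr_dnbhsP := Ff x; apply; split.
exact: (cvg_Rintegral_dominated (fun n => mF (v n)) Fv Ig (fun n x => Fg _ x (v0 n) (v1 n))).2.
Qed.

(** * Convolution and integration by parts *)

Section kernel_derivative.
Context {R : realType} {d : nat}.
Local Notation E := 'rV[R]_d.
Local Notation mu := (leb d : {sigma_finite_measure set E -> \bar R}).
Local Notation e_ j := (delta_mx 0 j : E).

Lemma norm_delta (j : 'I_d) : `|e_ j| <= 1.
Proof.
by apply/mx_norm_leP => // a b; rewrite mxE; case: (_ && _); rewrite /= ?normr1 ?normr0.
Qed.

Lemma norm_shift_le (h : R) (j : 'I_d) : `|h *: e_ j| <= `|h|.
Proof. by rewrite normrZ ler_piMr// norm_delta. Qed.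

Lemma test_function_ck1 (f : E -> R) : test_function f ->
  [/\ continuous f, forall x j, is_derive x (e_ j) f (partial j f x) &
      forall j, continuous (partial j f)].
Proof.
move=> [Cf _]; have [cf df Cf1] := Cf 1%N; split => //.
Qed.

Lemma compact_norm_bound (f : E -> R) (A : set E) : compact A -> continuous f ->
  exists C, forall x, A x -> `|f x| <= C.
Proof.
move=> cA cf; have [A0|A0] := pselect (A !=set0); last first.
  by exists 0 => x Ax; exfalso; apply: A0; exists x.
have cnf : continuous (fun x : E => `|f x|).
  by move=> x; apply: (continuous_comp (cf x)); exact: norm_continuous.
have [c _ hc] := EVT_max_rV A0 cA (continuous_subspaceT cnf).
by exists `|f c| => x Ax; apply: hc; rewrite inE.
Qed.

Lemma test_function_bounds (f : E -> R) : test_function f ->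
  exists C M : R, [/\ 0 <= C, forall x, M < `|x| -> f x = 0 /\ forall j, partial j f x = 0,
    forall x, `|f x| <= C,
    forall x j, `|partial j f x| <= C &
    forall x j h, `|f (h *: e_ j + x) - f x| <= C * `|h|].
Proof.
move=> tf; have [cf df cdf] := test_function_ck1 tf.
have [_ cK] := tf; set K := closure _ in cK.
have f0 x : ~ K x -> f x = 0.
  move=> nKx; apply: contrapT => /eqP fx; apply: nKx.
  exact: subset_closure.
have oK : open (~` K) by rewrite openC; exact: closed_closure.
have df0 x j : ~ K x -> partial j f x = 0.
  move=> nKx; apply: derive_val; apply: (@near_eq_is_derive _ _ _ (cst 0)).
    have := open_nbhs_nbhs (conj oK nKx); apply: filterS => y nKy.
    by rewrite [RHS]f0.
have [C0 hC0] := compact_norm_bound cK cf.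
have /choice[C1 hC1] j : exists C, forall x, K x -> `|partial j f x| <= C.
  exact: compact_norm_bound cK (cdf j).
have [M [_ hM]] := compact_bounded cK.
pose C : R := `|C0| + \sum_j `|C1 j|.
have s0 : 0 <= \sum_j `|C1 j| by apply: sumr_ge0.
have Cge0 : 0 <= C by rewrite addr_ge0.
have pC x j : `|partial j f x| <= C.
  have [Kx|nKx] := pselect (K x); last by rewrite df0// normr0.
  apply: le_trans (hC1 j x Kx) _; apply: le_trans (ler_norm _) _.
  rewrite /C (bigD1 j)//= addrCA lerDl addr_ge0//; exact: sumr_ge0.
exists C, (M + 1); split => //.
- move=> x Mx; have nKx : ~ K x.
    move=> /(hM (M + 1)); rewrite ltrDl ltr01 => /(_ isT) /=.
    by rewrite leNgt Mx.
  by split=> [|j]; [exact: f0|exact: df0].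
- move=> x; have [Kx|nKx] := pselect (K x); last by rewrite f0// normr0.
  by apply: le_trans (hC0 x Kx) _; apply: le_trans (ler_norm _) _; rewrite lerDl.
- move=> x j.
  pose g (t : R) := f (t *: e_ j + x).
  have dg (t : R) : is_derive t 1 g (partial j f (t *: e_ j + x)).
    apply: is_derive_cvg; rewrite /g; have := cvg_is_derive (df (t *: e_ j + x) j).
    rewrite [X in X @ _ --> _ -> _](_ : _ = fun h : R =>
      h^-1 *: (f ((h *: (1 : R) + t) *: e_ j + x) - f (t *: e_ j + x)))//.
    by apply/funext => h; rewrite [h *: 1]mulr1 scalerDl addrA.
  have cg (a b : R) : {within `[a, b], continuous g}.
    apply: continuous_subspaceT => t; apply/differentiable_continuous/derivable1_diffP.
    by have [] := dg t.
  move=> h; have -> : f x = g 0 by rewrite /g scale0r add0r.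
  rewrite -/(g h); have [h0|h0] := leP 0 h.
    have [] := @MVT_segment R g _ 0 h h0 (fun t _ => dg t) (cg 0 h).
    by move=> c _ ->; rewrite normrM subr0 ler_wpM2r.
  have [] := @MVT_segment R g _ h 0 (ltW h0) (fun t _ => dg t) (cg h 0).
  by move=> c _; rewrite distrC => ->; rewrite normrM sub0r normrN ler_wpM2r.
Qed.

Lemma mollifier_test0 (r : R) (k : E -> R) : mollifier r k -> test_function k.
Proof.
move=> mk; have := mollifier_test mk 0.
by congr test_function; apply/funext => y; rewrite sub0r (mollifier_even mk).
Qed.

(** An increment [h] of [y] is an increment [- h] of the argument of [k], so the difference
    quotients are read along the opposite sequence. *)
Lemma is_derive_reflect (k : E -> R) (x y : E) (j : 'I_d) (dk : R) :
  is_derive (x - y) (e_ j) k dk -> is_derive y (e_ j) (fun y => k (x - y)) (- dk).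
Proof.
move=> /cvg_is_derive hk; apply: is_derive_cvg.
apply/cvgr_dnbhsP => u [u0 cu].
have h : (- u n)^-1 *: (k (- u n *: e_ j + (x - y)) - k (x - y)) @[n --> \oo] --> dk.
  move/cvgr_dnbhsP : hk => /(_ (fun n => - u n)); apply; split => [n|].
    by rewrite oppr_eq0.
  by rewrite -oppr0; exact: cvgN.
rewrite [X in X @ _ --> _](_ : _ = fun n =>
    - ((- u n)^-1 *: (k (- u n *: e_ j + (x - y)) - k (x - y)))); last first.
  apply/funext => n; rewrite invrN scaleNr opprK; congr (_ *: (k _ - _)).
  by rewrite opprD addrCA scaleNr.
exact: cvgN h.
Qed.

End kernel_derivative.

Section measurable_parameter_integral.
Context d1 d2 (X : measurableType d1) (Y : measurableType d2) (R : realType).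
Variable m2 : {sigma_finite_measure set Y -> \bar R}.

(** No integrability is required: by Tonelli the integrals of the positive and negative parts are
    measurable in the parameter, their difference is measurable in [\bar R], and so is [fine]. *)
Lemma measurable_Rintegral_snd (f : X -> Y -> R) :
  measurable_fun setT (fun z : X * Y => f z.1 z.2) ->
  measurable_fun setT (fun x => \int[m2]_y f x y).
Proof.
move=> mf; pose F := fun z : X * Y => (f z.1 z.2)%:E.
have mF : measurable_fun setT F by exact/measurable_EFinP.
apply: (@measurableT_comp _ _ _ _ _ _ (@fine R)); first exact: fine_measurable.
rewrite (_ : (fun x => _) = (fun x => fubini_F m2 F^\+%E x - fubini_F m2 F^\-%E x)%E).
  apply: emeasurable_funB; apply: measurable_fun_fubini_tonelli_F => //.
  - exact: measurable_funepos.
  - exact: measurable_funeneg.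
apply/funext => x; rewrite integralE /fubini_F; congr (_ - _)%E.
  by apply: eq_integral => y _; rewrite !funeposE.
by apply: eq_integral => y _; rewrite !funenegE.
Qed.

End measurable_parameter_integral.

Section convolution.
Context {R : realType} {d : nat}.
Local Notation E := 'rV[R]_d.
Local Notation mu := (leb d : {sigma_finite_measure set E -> \bar R}).
Local Notation e_ j := (delta_mx 0 j : E).
Local Notation I f := (mu.-integrable setT (EFin \o f)).

Definition sq_integrable (f : E -> R) :=
  measurable_fun setT f /\ I (fun x => f x ^+ 2).

Definition cvl (k f : E -> R) (x : E) : R := \int[mu]_y (k (x - y) * f y).

Definition ball_indic (r : R) (x : E) : R := \1_[set x : E | `|x| <= r] x.

Lemma ball_indicE (r : R) (x : E) : ball_indic r x = ((`|x| <= r)%R : bool)%:R.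
Proof.
rewrite /ball_indic indicE; case: (leP `|x| r) => h; first by rewrite mem_set.
by rewrite memNset//; apply/negP; rewrite -ltNge.
Qed.

Lemma ball_indic_ge0 r x : 0 <= ball_indic r x.
Proof. by rewrite ball_indicE. Qed.

Lemma ball_indic_le1 r x : ball_indic r x <= 1.
Proof. by rewrite ball_indicE lern1 leq_b1. Qed.

Lemma ball_indic01 r x : ball_indic r x = 0 \/ ball_indic r x = 1.
Proof. by rewrite ball_indicE; case: (_ <= _)%R; [right|left]. Qed.

Lemma measurable_ball_indic r : measurable_fun setT (ball_indic r).
Proof. by apply: measurable_indic; exact: measurable_box. Qed.

Lemma ball_indicN r x : ball_indic r (- x) = ball_indic r x.
Proof. by rewrite !ball_indicE normrN. Qed.

Definition ball_volume r : R := fine (leb d [set x : E | `|x| <= r]).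

Lemma ball_volume_gt0 r : 0 < r -> 0 < ball_volume r.
Proof. by move=> r0; rewrite fine_gt0// leb_box_gt0//= leb_box_lty. Qed.

Lemma integrable_ball r (x : E) : I (fun y => ball_indic r (x - y)).
Proof.
apply: (@integrable_bounded_support _ _ _ (r + `|x|) 1).
- exact: measurableT_comp (measurable_ball_indic r) (measurable_subl x).
- by move=> y; rewrite ger0_norm ?ball_indic_ge0 ?ball_indic_le1.
- move=> y h; rewrite ball_indicE leNgt (_ : r < _)//.
  have := ler_normB x (x - y); rewrite opprB addrC subrK; lra.
Qed.

Lemma ball_volumeE r (x : E) : \int[mu]_y ball_indic r (x - y) = ball_volume r.
Proof.
rewrite /ball_volume /Rintegral; congr fine.
have mB : measurable [set x : E | `|x| <= r] by exact: measurable_box.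
rewrite -(setIT [set x : E | `|x| <= r]) -(integral_indic mu measurableT mB).
rewrite -[RHS](integral_shift (- x)); last first.
  by apply/measurable_EFinP; exact: measurable_indic.
by apply: eq_integral => y _; rewrite -[in LHS]ball_indicN opprB.
Qed.

Section ball_mass.
Variables (f : E -> R) (sf : sq_integrable f) (r : R).
Hypothesis r0 : 0 < r.

(** The common majorant of the convolutions of [f] with kernels bounded by a multiple of
    [ball_indic r], hence of their derivatives too. For square integrable [f] it is both bounded and
    square integrable, which supplies most of the later dominations. *)
Definition ball_mass (x : E) : R := \int[mu]_y (ball_indic r (x - y) * `|f y|).
Definition ball_energy (x : E) : R := \int[mu]_y (ball_indic r (x - y) * f y ^+ 2).

Let mf : measurable_fun setT f := sf.1.
Let mnf : measurable_fun setT (fun y => `|f y|).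
Proof. exact: measurableT_comp. Qed.

Lemma measurable_ball_shift : measurable_fun setT (fun z : E * E => ball_indic r (z.1 - z.2)).
Proof. exact: measurableT_comp (measurable_ball_indic r) measurable_sub2. Qed.

Lemma integrable_ball_mass x : I (fun y : E => ball_indic r (x - y) * `|f y|).
Proof.
apply: (@integrable_le _ _ _ _ _ (fun y : E => ball_indic r (x - y) + f y ^+ 2)).
- apply: measurable_funM => //.
  exact: measurableT_comp (measurable_ball_indic r) (measurable_subl x).
- move=> y; case: (ball_indic01 r (x - y)) => ->; rewrite ?mul1r ?mul0r ?normr0 ?add0r ?sqr_ge0//.
  by rewrite normr_id -(real_normK (num_real (f y))); have := sqr_ge0 (`|f y| - 1); nra.
- by apply: integrableDr; [exact: integrable_ball|exact: sf.2].
Qed.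

Lemma integrable_ball_energy x : I (fun y : E => ball_indic r (x - y) * f y ^+ 2).
Proof.
apply: (@integrable_le _ _ _ _ _ (fun y : E => f y ^+ 2)) sf.2.
- apply: measurable_funM; last exact: measurable_funX.
  exact: measurableT_comp (measurable_ball_indic r) (measurable_subl x).
- move=> y; rewrite normrM (ger0_norm (sqr_ge0 _)) ger0_norm ?ball_indic_ge0//.
  by rewrite ler_piMl ?sqr_ge0 ?ball_indic_le1.
Qed.

Lemma measurable_ball_mass : measurable_fun setT ball_mass.
Proof.
apply: measurable_Rintegral_snd; apply: measurable_funM.
  exact: measurable_ball_shift.
exact: (measurable_snd_fun mnf).
Qed.

Lemma measurable_ball_energy : measurable_fun setT ball_energy.
Proof.
apply: measurable_Rintegral_snd; apply: measurable_funM.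
  exact: measurable_ball_shift.
have := @measurable_snd_fun R d _ (measurable_funX 2 mf); exact.
Qed.

Lemma ball_mass_ge0 x : 0 <= ball_mass x.
Proof. by apply: Rintegral_ge0 => y _; rewrite mulr_ge0 ?ball_indic_ge0. Qed.

Lemma ball_energy_ge0 x : 0 <= ball_energy x.
Proof. by apply: Rintegral_ge0 => y _; rewrite mulr_ge0 ?ball_indic_ge0 ?sqr_ge0. Qed.

Lemma ball_mass_sq x : ball_mass x ^+ 2 <= ball_volume r * ball_energy x.
Proof.
have V0 := ball_volume_gt0 r0; have := ball_mass_ge0 x; rewrite le_eqVlt => /predU1P[<-|m0].
  by rewrite expr0n/= mulr_ge0 ?ball_energy_ge0 ?ltW.
(* Cauchy-Schwarz through [2 |f| <= t + f^2 / t]. For this [t], the mean of [|f|] over the ball, the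
   first term integrates to [ball_mass x], half of the left-hand side. *)
pose t := ball_mass x / ball_volume r; have t0 : 0 < t by rewrite divr_gt0.
have : ball_mass x * 2 <= \int[mu]_y (t * ball_indic r (x - y) + t^-1 * (ball_indic r (x - y) * f y ^+ 2)).
  rewrite -RintegralZr//; last exact: integrable_ball_mass.
  apply: le_Rintegral => //.
  - under eq_fun do rewrite mulrC; exact: integrable_cstM (integrable_ball_mass x).
  - by apply: integrableDr; apply: integrable_cstM; [exact: integrable_ball|exact: integrable_ball_energy].
  move=> y _; case: (ball_indic01 r (x - y)) => ->; first by rewrite !mul0r !mulr0 addr0.
  rewrite !mul1r mulr1 -(real_normK (num_real (f y))).
  rewrite -lerBlDl ler_pdivlMl//; have := sqr_ge0 (`|f y| - t); nra.
rewrite RintegralD//; last 2 first.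
- exact: integrable_cstM (integrable_ball r x).
- exact: integrable_cstM (integrable_ball_energy x).
rewrite (RintegralZl _ measurableT (integrable_ball r x))
  (RintegralZl _ measurableT (integrable_ball_energy x)) ball_volumeE.
rewrite -/(ball_energy x) {1}/t divfK ?gt_eqF// mulr_natr mulr2n lerD2l.
rewrite /t invf_div => h; rewrite expr2 -ler_pdivlMl//.
by apply: le_trans h _; rewrite mulrA [_^-1 * _]mulrC.
Qed.

Lemma ball_energy_le x : ball_energy x <= \int[mu]_y f y ^+ 2.
Proof.
apply: le_Rintegral => //; [exact: integrable_ball_energy|exact: sf.2|].
by move=> y _; rewrite ler_piMl ?sqr_ge0 ?ball_indic_le1.
Qed.

(** The [+ 1] comes from [a <= a^2 + 1], used in place of a square root. *)
Lemma ball_mass_le x : ball_mass x <= ball_volume r * (\int[mu]_y f y ^+ 2) + 1.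
Proof.
have h : ball_mass x ^+ 2 <= ball_volume r * (\int[mu]_y f y ^+ 2).
  apply: le_trans (ball_mass_sq x) _.
  by rewrite ler_wpM2l ?(ltW (ball_volume_gt0 r0))// ball_energy_le.
by have := sqr_ge0 (ball_mass x - 1); nra.
Qed.

Lemma ball_mass_bounded : exists2 M, 0 <= M & forall x, ball_mass x <= M.
Proof.
exists (ball_volume r * (\int[mu]_y f y ^+ 2) + 1) => [|x]; last exact: ball_mass_le.
rewrite addr_ge0// mulr_ge0 ?(ltW (ball_volume_gt0 r0)) ?Rintegral_ge0// => y _; exact: sqr_ge0.
Qed.

(** By Tonelli and the symmetry of the ball, the integral of [ball_energy] is the ball volume times
    the integral of [f^2]; by [ball_mass_sq] it controls the square of the mass. *)
Lemma integrable_ball_mass_sq : sq_integrable ball_mass.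
Proof.
split; first exact: measurable_ball_mass.
apply: (@integrable_le _ _ _ _ _ (fun x => ball_volume r * ball_energy x)).
- by apply: measurable_funX; exact: measurable_ball_mass.
- by move=> x; rewrite ger0_norm ?sqr_ge0// ball_mass_sq.
apply: integrable_cstM; apply: integrable_ge0.
- exact: measurable_ball_energy.
- exact: ball_energy_ge0.
have -> : (\int[mu]_x (ball_energy x)%:E = \int[mu]_x \int[mu]_y (ball_indic r (x - y) * f y ^+ 2)%:E)%E.
  by apply: eq_integral => x _; rewrite EFin_Rintegral//; exact: integrable_ball_energy.
rewrite (fubini_tonelli (fun z : E * E => (ball_indic r (z.1 - z.2) * f z.2 ^+ 2)%:E))/=; last 2 first.
- apply/measurable_EFinP; apply: measurable_funM; first exact: measurable_ball_shift.
  have := @measurable_snd_fun R d _ (measurable_funX 2 mf); exact.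
- by move=> z; rewrite lee_fin mulr_ge0 ?ball_indic_ge0 ?sqr_ge0.
have E0 y : (\int[mu]_x (ball_indic r (x - y) * f y ^+ 2)%:E = (ball_volume r)%:E * (f y ^+ 2)%:E)%E.
  rewrite -(ball_volumeE r y) EFin_Rintegral; last exact: integrable_ball.
  rewrite muleC -ge0_integralZl_EFin ?sqr_ge0//.
  - by apply: eq_integral => x _; rewrite -EFinM mulrC -[in RHS]ball_indicN opprB.
  - by move=> x _; rewrite lee_fin ball_indic_ge0.
  - exact: measurable_int (integrable_ball r y).
under eq_integral do rewrite E0.
rewrite ge0_integralZl_EFin//; last 3 first.
- by move=> x _; rewrite lee_fin sqr_ge0.
- exact: measurable_int sf.2.
- exact: ltW (ball_volume_gt0 r0).
by apply: lte_mul_pinfty; rewrite ?lee_fin ?(ltW (ball_volume_gt0 r0))//; exact: integrable_lty sf.2.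
Qed.

End ball_mass.

(** A single majorant for a function, its derivative in direction [j] and its difference quotients
    of step at most 1: what is needed to exchange that derivative with an integral, in a form stable
    under products. *)
Record controlled (j : 'I_d) (f df F : E -> R) : Prop := Controlled {
  controlled_derive : forall x, is_derive x (e_ j) f (df x);
  controlled_measurable : measurable_fun setT f;
  controlled_measurable_derive : measurable_fun setT df;
  controlled_le : forall x, `|f x| <= F x;
  controlled_derive_le : forall x, `|df x| <= F x;
  controlled_increment : forall x h, `|h| <= 1 ->
    `|f (h *: e_ j + x) - f x| <= `|h| * F x }.

(** The increment of a product splits into three terms, each at most [|h| F G] because [|h| <= 1];
    hence the factor 3. *)
Lemma controlledM j f df F g dg G : controlled j f df F -> controlled j g dg G ->
  controlled j (fun x => f x * g x) (fun x => df x * g x + f x * dg x)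
    (fun x => 3 * (F x * G x)).
Proof.
move=> [f1 f2 f3 f4 f5 f6] [g1 g2 g3 g4 g5 g6].
have F0 x : 0 <= F x by exact: le_trans (f4 x).
have G0 x : 0 <= G x by exact: le_trans (g4 x).
have FG a b x : `|a| <= F x -> `|b| <= G x -> `|a * b| <= F x * G x.
  by move=> aF bG; rewrite normrM ler_pM.
split.
- move=> x; have := is_deriveM (f1 x) (g1 x) => /is_derive_eq; apply.
  by rewrite /GRing.scale/= addrC mulrC; congr (_ + _); exact: mulrC.
- exact: measurable_funM.
- by apply: measurable_funD; exact: measurable_funM.
- by move=> x; have := FG _ _ x (f4 x) (g4 x); have := mulr_ge0 (F0 x) (G0 x); lra.
- move=> x; apply: le_trans (ler_normD _ _) _.
  have := FG _ _ x (f5 x) (g4 x); have := FG _ _ x (f4 x) (g5 x).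
  have := mulr_ge0 (F0 x) (G0 x); lra.
- move=> x h h1; set y := h *: e_ j + x.
  have -> : f y * g y - f x * g x = (f y - f x) * (g y - g x) + (f y - f x) * g x + f x * (g y - g x).
    by ring.
  have hG : `|h| * G x <= G x by rewrite ler_piMl.
  have A1 : `|(f y - f x) * (g y - g x)| <= `|h| * (F x * G x).
    rewrite normrM mulrA ler_pM//; [exact: f6|exact: le_trans (g6 x h h1) hG].
  have A2 : `|(f y - f x) * g x| <= `|h| * (F x * G x).
    by rewrite normrM mulrA ler_pM//; exact: f6.
  have A3 : `|f x * (g y - g x)| <= `|h| * (F x * G x).
    by rewrite normrM mulrCA ler_pM//; exact: g6.
  have := ler_normD ((f y - f x) * (g y - g x) + (f y - f x) * g x) (f x * (g y - g x)).
  have := ler_normD ((f y - f x) * (g y - g x)) ((f y - f x) * g x); lra.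
Qed.

(* Translation invariance makes the difference quotients integrate to zero. *)
Lemma controlled_integral0 j f df F : controlled j f df F -> I F ->
  \int[mu]_x df x = 0.
Proof.
move=> [f1 f2 f3 f4 f5 f6] IF.
have If : I f by exact: integrable_le f2 f4 IF.
have Ifh h : I (fun x => f (h *: e_ j + x)).
  have := integrable_shift (h *: e_ j) If; apply: eq_integrable => // x _ /=.
  by rewrite addrC.
have mfh h : measurable_fun setT (fun x => h^-1 * (f (h *: e_ j + x) - f x)).
  apply: measurable_funM => //; apply: measurable_funB => //.
  exact: integrable_measurable (Ifh h).
have fc x : h^-1 * (f (h *: e_ j + x) - f x) @[h --> 0^'] --> df x.
  exact: cvg_is_derive (f1 x).
have fF h x : h != 0 -> `|h| <= 1 -> `|h^-1 * (f (h *: e_ j + x) - f x)| <= F x.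
  by move=> h0 h1; rewrite normrM normfV ler_pdivrMl ?normr_gt0//; exact: f6.
have := cvg_Rintegral_dnbhs mfh fc IF fF.
have -> : (fun h : R => \int[mu]_x (h^-1 * (f (h *: e_ j + x) - f x))) = cst 0.
  apply/funext => h; rewrite RintegralZl//; last exact: integrableBr (Ifh h) If.
  rewrite RintegralB//.
  have -> : \int[mu]_x f (h *: e_ j + x) = \int[mu]_x f x.
    rewrite /Rintegral; congr fine; rewrite -[RHS](integral_shift (h *: e_ j)).
      by apply: eq_integral => x _; rewrite addrC.
    exact: measurable_int If.
  by rewrite subrr mulr0.
move=> /(cvg_lim (@Rhausdorff R)) <-; apply: (cvg_lim (@Rhausdorff R)).
exact: (@cvg_cst R 0).
Qed.

(** The derivative of the product integrates to zero by [controlled_integral0]. Only the product of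
    the two majorants has to be integrable, so one factor may be merely bounded. *)
Lemma integration_by_parts_controlled j f df F g dg G :
  controlled j f df F -> controlled j g dg G -> I (fun x => F x * G x) ->
  \int[mu]_x (df x * g x) = - \int[mu]_x (f x * dg x).
Proof.
move=> cf cg IFG; have := controlled_integral0 (controlledM cf cg) (integrable_cstM 3 IFG).
case: cf cg => [f1 f2 f3 f4 f5 f6] [g1 g2 g3 g4 g5 g6].
rewrite RintegralD//; first by move=> /eqP; rewrite addr_eq0 => /eqP.
- by apply: integrable_le IFG => [|x]; [exact: measurable_funM|rewrite normrM ler_pM].
- by apply: integrable_le IFG => [|x]; [exact: measurable_funM|rewrite normrM ler_pM].
Qed.

Lemma test_function_kernel (f : E -> R) : test_function f ->
  exists C r : R, [/\ 0 <= C, 0 < r, forall x, `|f x| <= C * ball_indic r x &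
    forall j, controlled j f (partial j f) (fun x => C * ball_indic r x)].
Proof.
move=> tf; have [cf df cdf] := test_function_ck1 tf.
have [C [M [C0 f0 fC dfC fL]]] := test_function_bounds tf.
(* Beyond [M + 2] a step of length at most 1 cannot come back within [M], so the increment vanishes
   along with the function. The absolute value makes the radius positive. *)
pose r := `|M| + 2; have r0 : 0 < r by rewrite ltr_wpDl.
have Mr : M + 2 <= r by rewrite lerD2r ler_norm.
have B x a : (M < `|x| -> a = 0) -> `|a| <= C -> `|a| <= C * ball_indic r x.
  move=> a0 aC; rewrite ball_indicE; have [xr|rx] := leP `|x| r; first by rewrite mulr1.
  by rewrite a0 ?normr0 ?mulr0//; lra.
exists C, r; split => // [x|j]; first by apply: B => // /f0[].
split => //.
- exact: continuous_measurable_rV.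
- exact: continuous_measurable_rV.
- by move=> x; apply: B => // /f0[].
- by move=> x; apply: B => // /f0[_].
- move=> x h h1; rewrite ball_indicE; have [xr|rx] := leP `|x| r.
    by rewrite mulr1 mulrC.
  have h2 := norm_shift_le h j.
  have h3 := ler_normB (h *: e_ j + x) (h *: e_ j); rewrite addrC addKr in h3.
  have /f0[-> _] : M < `|h *: e_ j + x| by lra.
  have /f0[-> _] : M < `|x| by lra.
  by rewrite subrr normr0 !mulr0.
Qed.

Section bounded_kernel.
Variables (kap : E -> R) (C r : R).
Hypothesis (mkap : measurable_fun setT kap).
Hypothesis kapC : forall x, `|kap x| <= C * ball_indic r x.
Variable f : E -> R.
Hypothesis sf : sq_integrable f.

Let mf : measurable_fun setT f := sf.1.

Lemma integrable_cvl x : I (fun y => kap (x - y) * f y).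
Proof.
apply: (@integrable_le _ _ _ _ _ (fun y : E => C * (ball_indic r (x - y) * `|f y|))).
- apply: measurable_funM => //; exact: measurableT_comp mkap (measurable_subl x).
- by move=> y; rewrite normrM mulrA ler_wpM2r.
- exact: integrable_cstM (integrable_ball_mass sf r x).
Qed.

Lemma cvl_le x : `|cvl kap f x| <= C * ball_mass f r x.
Proof.
rewrite /ball_mass -RintegralZl//; last exact: integrable_ball_mass.
apply: Rintegral_norm_le; [exact: integrable_cvl|exact: integrable_cstM (integrable_ball_mass sf r x)|].
by move=> y; rewrite normrM mulrA ler_wpM2r.
Qed.

Lemma measurable_cvl : measurable_fun setT (cvl kap f).
Proof.
apply: measurable_Rintegral_snd; apply: measurable_funM.
  exact: measurableT_comp mkap measurable_sub2.
exact: (measurable_snd_fun mf).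
Qed.

End bounded_kernel.

(** The derivative falls on the kernel. Its difference quotients are bounded by [C] and vanish off a
    fixed ball, so [ball_mass] dominates and the limit passes under the integral. *)
Lemma cvl_controlled (k f : E -> R) (C r : R) (j : 'I_d) : 0 < r -> sq_integrable f ->
  controlled j k (partial j k) (fun x => C * ball_indic r x) ->
  controlled j (cvl k f) (cvl (partial j k) f) (fun x => C * ball_mass f r x).
Proof.
move=> r0 sf [k1 k2 k3 k4 k5 k6].
have mf : measurable_fun setT f := sf.1.
have C0 : 0 <= C.
  have := le_trans (normr_ge0 _) (k4 0); rewrite ball_indicE normr0 (ltW r0) mulr1; exact.
have Ik := integrable_cvl k2 k4 sf.
have Ij := integrable_cvl k3 k5 sf.
have Im x := integrable_cstM C (integrable_ball_mass sf r x).
have diff h x : cvl k f (h *: e_ j + x) - cvl k f x =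
    \int[mu]_y ((k (h *: e_ j + (x - y)) - k (x - y)) * f y).
  rewrite /cvl -RintegralB//; apply: eq_Rintegral => y _.
  by rewrite mulrBl addrA.
have Id h x : I (fun y => (k (h *: e_ j + (x - y)) - k (x - y)) * f y).
  have := integrableBr (Ik (h *: e_ j + x)) (Ik x); apply: eq_integrable => // y _ /=.
  by rewrite mulrBl addrA.
split.
- move=> x; apply: is_derive_cvg.
  rewrite [X in X @ _ --> _](_ : _ = fun h : R =>
    \int[mu]_y (h^-1 * ((k (h *: e_ j + (x - y)) - k (x - y)) * f y))); last first.
    by apply/funext => h; rewrite diff RintegralZl.
  apply: (@cvg_Rintegral_dnbhs _ _ _ _ _ _ (fun y : E => C * (ball_indic r (x - y) * `|f y|))).
  + by move=> h; apply: measurable_funM => //; exact: integrable_measurable (Id h x).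
  + move=> y; under eq_fun do rewrite mulrA.
    apply: cvgMl; exact: cvg_is_derive (k1 (x - y)).
  + exact: Im.
  + move=> h y h0 h1; rewrite !normrM mulrA (mulrA C) ler_wpM2r//.
    by rewrite normfV ler_pdivrMl ?normr_gt0//; exact: k6.
- exact: (measurable_cvl k2 sf).
- exact: (measurable_cvl k3 sf).
- exact: (cvl_le k2 k4 sf).
- exact: (cvl_le k3 k5 sf).
- move=> x h h1; rewrite diff /ball_mass -RintegralZl//; last exact: integrable_ball_mass.
  rewrite -RintegralZl//; apply: Rintegral_norm_le => //.
  + exact: integrable_cstM.
  + move=> y; rewrite normrM !mulrA ler_wpM2r// -mulrA; exact: k6.
Qed.

Lemma mollifier_ball (k : E -> R) (r : R) : mollifier r k ->
  exists2 C, 0 <= C & forall x, `|k x| <= C * ball_indic r x.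
Proof.
move=> mk; have [C kC] := mollifier_bounded mk.
have C0 : 0 <= C by exact: le_trans (mollifier_ge0 mk 0) (kC 0).
exists C => // x; rewrite ball_indicE ger0_norm; last exact: mollifier_ge0 mk x.
have [xr|rx] := leP `|x| r; first by rewrite mulr1.
by rewrite (mollifier_support mk rx) mulr0.
Qed.

(** The difference [k (x - z) - k (y - z)] vanishes unless [z] is within [r] of [x] or of [y], and
    is at most [L |x - y|]; the integral is thus controlled by the two ball masses. *)
Lemma cvl_lipschitz (k f : E -> R) (r : R) : 0 < r -> mollifier r k -> sq_integrable f ->
  exists2 L, 0 <= L & forall x y, `|cvl k f x - cvl k f y| <= L * `|x - y|.
Proof.
move=> r0 mk sf; have [C C0 kC] := mollifier_ball mk.
have [L L0 kL] := mollifier_lipschitz mk.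
have [M M0 mM] := ball_mass_bounded sf r0.
have Ik := integrable_cvl (mollifier_measurable mk) kC sf.
have Im z := integrable_ball_mass sf r z.
exists (L * (M + M)) => [|x y]; first by rewrite mulr_ge0 ?addr_ge0.
have h : `|cvl k f x - cvl k f y| <= L * `|x - y| * (ball_mass f r x + ball_mass f r y).
  rewrite /cvl -RintegralB// /ball_mass -RintegralD// -RintegralZl//; last exact: integrableDr.
  apply: Rintegral_norm_le.
  - exact: integrableBr.
  - by apply: integrable_cstM; exact: integrableDr.
  - move=> z; rewrite -mulrBl normrM -mulrDl mulrA ler_wpM2r//.
    have hL : `|k (x - z) - k (y - z)| <= L * `|x - y|.
      by apply: le_trans (kL _ _) _; rewrite opprB addrA subrK.
    rewrite !ball_indicE; have [xz|xz] := leP `|x - z| r; have [yz|yz] := leP `|y - z| r;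
      rewrite /= ?addr0 ?add0r ?mulr1 ?mulr0//.
      by have := mulr_ge0 L0 (normr_ge0 (x - y)); lra.
    by rewrite !(mollifier_support mk)// subrr normr0.
apply: le_trans h _; rewrite mulrAC ler_wpM2r// ler_wpM2l// lerD//.
Qed.

End convolution.

(** * Mollified fields *)

Section matrix_norm.
Context {R : realType} {m n : nat}.
Implicit Type A : 'M[R]_(m, n).

Lemma mxdot_ge0 A : 0 <= mxdot A A.
Proof. by apply: sumr_ge0 => i _; apply: sumr_ge0 => j _; rewrite -expr2 sqr_ge0. Qed.

Lemma sqr_enorm A : enorm A ^+ 2 = mxdot A A.
Proof. by rewrite sqr_sqrtr// mxdot_ge0. Qed.

Lemma enorm_ge0 A : 0 <= enorm A.
Proof. exact: sqrtr_ge0. Qed.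

Lemma enorm0 : enorm (0 : 'M[R]_(m, n)) = 0.
Proof.
by rewrite /enorm /mxdot big1 ?sqrtr0// => i _; rewrite big1// => j _; rewrite mxE mul0r.
Qed.

Lemma norm_entry_le_enorm A i j : `|A i j| <= enorm A.
Proof.
rewrite -sqrtr_sqr ler_sqrt ?mxdot_ge0// /mxdot (bigD1 i)//= (bigD1 j)//= -expr2 -addrA lerDl.
by rewrite addr_ge0//; do ![apply: sumr_ge0 => ? _]; rewrite -expr2 sqr_ge0.
Qed.

Lemma enorm_le_sum A : enorm A <= \sum_i \sum_j `|A i j|.
Proof.
have s0 : 0 <= \sum_i \sum_j `|A i j| by do 2![apply: sumr_ge0 => ? _].
rewrite -(ger0_norm s0) -sqrtr_sqr ler_sqrt ?sqr_ge0// expr2 mulr_suml.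
apply: ler_sum => i _; rewrite mulr_suml; apply: ler_sum => j _.
rewrite -expr2 -(real_normK (num_real _)) expr2 ler_wpM2l//.
rewrite (bigD1 i)//= (bigD1 j)//= -addrA lerDl addr_ge0//; do ![apply: sumr_ge0 => ? _] => //.
Qed.

Lemma measurable_enorm d (X : measurableType d) (f : X -> 'M[R]_(m, n)) :
  (forall i j, measurable_fun setT (fun x => f x i j)) ->
  measurable_fun setT (fun x => enorm (f x)).
Proof.
have ms : measurable_fun setT (@Num.sqrt R) := continuous_measurable_fun (@sqrt_continuous R).
move=> mf; apply: (measurableT_comp ms).
apply: measurable_sum => i; apply: measurable_sum => j; exact: measurable_funM.
Qed.

End matrix_norm.

Section row_vectors.
Context {R : realType} {n : nat}.
Implicit Types u v : 'rV[R]_n.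

Lemma mxdot_row u v : mxdot u v = \sum_j u 0 j * v 0 j.
Proof. by rewrite /mxdot big_ord1. Qed.

End row_vectors.

Section Lebesgue_spaces.
Context {R : realType} {d m n : nat}.
Local Notation E := 'rV[R]_d.
Local Notation mu := (leb d : {sigma_finite_measure set E -> \bar R}).
Local Notation I f := (mu.-integrable setT (EFin \o f)).
Implicit Type f : E -> 'M[R]_(m, n).

Lemma Lp_entry_measurable p f : Lp p f -> forall i j, measurable_fun setT (fun x => f x i j).
Proof. by move=> [mf _] i j; exact: measurableT_comp (measurable_entry i j) mf. Qed.

Lemma Lp_normE (p : R) f : 0 < p ->
  Lp_norm p%:E f = poweR (\int[mu]_x (enorm (f x) `^ p)%:E)%E p^-1.
Proof.
move=> p0; rewrite /Lp_norm Lnorm.unlock.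
under eq_integral => x _ do rewrite abse_EFin (ger0_norm (enorm_ge0 _)) poweR_EFin.
by [].
Qed.

Lemma Lp_norm_lty (p : R) f : 0 < p ->
  (Lp_norm p%:E f < +oo)%E <-> (\int[mu]_x (enorm (f x) `^ p)%:E < +oo)%E.
Proof.
move=> p0; rewrite Lp_normE//; split; last exact: poweR_lty.
by apply: lty_poweRy; rewrite invr_eq0 gt_eqF.
Qed.

Lemma Lp_entry_integrable (p : R) f i j : 0 < p -> Lp p%:E f ->
  I (fun x => `|f x i j| `^ p).
Proof.
move=> p0 Lf; have mf := Lp_entry_measurable Lf; have [_ /(Lp_norm_lty f p0) foo] := Lf.
apply: integrable_ge0; [exact: measurable_powR_norm|by move=> x; exact: powR_ge0|].
apply: le_lt_trans foo; apply: ge0_le_integral_any => x _.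
  by rewrite lee_fin powR_ge0.
by rewrite lee_fin ge0_ler_powR ?nnegrE ?enorm_ge0 ?norm_entry_le_enorm ?(ltW p0).
Qed.

Lemma Lp_entry_le (p : R) f i j (N : R) : 0 < p -> 0 <= N -> measurable_fun setT f ->
  (Lp_norm p%:E f <= N%:E)%E -> \int[mu]_x `|f x i j| `^ p <= N `^ p.
Proof.
move=> p0 N0 mf fN; have Lf : Lp p%:E f by split => //; exact: le_lt_trans fN (ltry _).
rewrite -lee_fin EFin_Rintegral; last exact: Lp_entry_integrable.
apply: (@le_trans _ _ (\int[mu]_x (enorm (f x) `^ p)%:E)%E).
  apply: ge0_le_integral_any => x _; first by rewrite lee_fin powR_ge0.
  by rewrite lee_fin ge0_ler_powR ?nnegrE ?enorm_ge0 ?norm_entry_le_enorm ?(ltW p0).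
have i0 : (0 <= \int[mu]_x (enorm (f x) `^ p)%:E)%E.
  by apply: integral_ge0 => x _; rewrite lee_fin powR_ge0.
rewrite -poweR_EFin -[leLHS]poweRe1// -(mulVf (lt0r_neq0 p0)) poweRrM -Lp_normE//.
apply: gt0_ler_poweR => //; first exact: ltW.
  by rewrite in_itv/= leey andbT Lnorm_ge0.
by rewrite in_itv/= leey andbT lee_fin.
Qed.

Lemma Lp2_sq_integrable f : Lp 2%:E f -> forall i j, sq_integrable (fun x => f x i j).
Proof.
move=> Lf i j; split; first exact: Lp_entry_measurable Lf i j.
have := Lp_entry_integrable i j (ltr0n R 2) Lf; apply: eq_integrable => // x _ /=.
by rewrite powR_mulrn// real_normK ?num_real.
Qed.

Lemma sq_integrable_Lp2 f : (forall i j, sq_integrable (fun x => f x i j)) -> Lp 2%:E f.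
Proof.
move=> sf; split; first by apply: measurable_fun_entries => i j; exact: (sf i j).1.
apply/Lp_norm_lty => //.
have e x : enorm (f x) `^ 2 = \sum_i \sum_j f x i j ^+ 2.
  rewrite powR_mulrn ?enorm_ge0// sqr_enorm /mxdot.
  by apply: eq_bigr => i _; apply: eq_bigr => j _; rewrite expr2.
under eq_integral do rewrite e.
apply: integrable_lty => //; apply: integrable_sumr => i; apply: integrable_sumr => j.
exact: (sf i j).2.
Qed.

Lemma bounded_Lp_infty f (C : R) : measurable_fun setT f ->
  (forall x i j, `|f x i j| <= C) -> Lp +oo%E f.
Proof.
move=> mf fC; split => //; rewrite /Lp_norm Lnorm.unlock; case: ifPn => [_|_]; last by [].
apply: (@le_lt_trans _ _ (\sum_(i < m) \sum_(j < n) C)%:E); last exact: ltry.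
apply/ess_supP; apply: nearW => x /=; rewrite lee_fin ger0_norm ?enorm_ge0//.
apply: le_trans (enorm_le_sum _) _; apply: ler_sum => i _; exact: ler_sum.
Qed.

(** Needed because [Lnorm] at [+oo] is the essential supremum only on a space of positive measure,
    and 0 by convention otherwise. *)
Lemma leb_setT_gt0 : (0 < mu setT)%E.
Proof.
apply: lt_le_trans (@leb_box_gt0 R d 1 ltr01) _.
by apply: le_measure; rewrite ?inE//; exact: measurable_box.
Qed.

Lemma Lp_infty_ae_le f : {ae mu, forall x, ((enorm (f x))%:E <= Lp_norm +oo%E f)%E}.
Proof.
rewrite /Lp_norm Lnorm.unlock leb_setT_gt0.
have := ess_sup_ge mu (abse \o (fun x => (enorm (f x))%:E)).
by apply: filterS => x; rewrite /= ger0_norm ?enorm_ge0.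
Qed.

Lemma bounded_loc_integrable f (C : R) : measurable_fun setT f ->
  (forall x i j, `|f x i j| <= C) -> loc_integrable f.
Proof.
move=> mf fC; split => // K cK; have [M [_ hM]] := compact_bounded cK.
have KM : K `<=` [set x | `|x| <= M + 1].
  by move=> x; apply: hM; rewrite ltrDl.
pose C' : R := `|\sum_(i < m) \sum_(j < n) C|.
have fC' x : enorm (f x) <= C'.
  apply: le_trans (enorm_le_sum _) _; apply: le_trans (ler_norm _).
  by apply: ler_sum => i _; exact: ler_sum.
have mB := @measurable_box R d (M + 1).
apply: (@le_lt_trans _ _ (\int[mu]_(x in [set x : E | (`|x| <= M + 1)%R]) (cst C'%:E) x)%E).
  rewrite integral_mkcond [leRHS]integral_mkcond; apply: ge0_le_integral_any => x _.
    by apply: erestrict_ge0 => y _; rewrite lee_fin enorm_ge0.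
  rewrite !patchE; case: ifPn => [|_].
    by rewrite inE => Kx; rewrite (mem_set (KM _ Kx)) lee_fin fC'.
  by case: ifPn => // _; rewrite lee_fin normr_ge0.
rewrite integral_cst//; apply: lte_mul_pinfty; rewrite ?lee_fin ?normr_ge0//.
exact: (leb_box_lty d (M + 1)).
Qed.

End Lebesgue_spaces.

Section weak_gradients.
Context {R : realType} {d : nat}.
Local Notation E := 'rV[R]_d.
Local Notation mu := (leb d : {sigma_finite_measure set E -> \bar R}).
Local Notation I f := (mu.-integrable setT (EFin \o f)).
Local Notation e_ j := (delta_mx 0 j : E).

Lemma controlled_weak_gradient (f : E -> R) (g : E -> E) (F : E -> R) (C : R) :
  (forall j, controlled j f (fun x => g x 0 j) F) -> measurable_fun setT f ->
  measurable_fun setT F -> (forall x, `|f x| <= F x) -> (forall x, F x <= C) ->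
  is_weak_gradient f g.
Proof.
move=> fg mf mF fF FC; have F0 x : 0 <= F x by exact: le_trans (fF x).
split.
- apply: (@bounded_loc_integrable _ _ _ _ _ C).
    by apply: measurable_fun_entries => i j; under eq_fun do rewrite mxE !ord1 eqxx mulr1n.
  by move=> x i j; rewrite mxE !ord1 eqxx mulr1n (le_trans (fF x)).
- apply: (@bounded_loc_integrable _ _ _ _ _ C).
    by apply: measurable_fun_entries => i j; rewrite ord1; case: (fg j).
  by move=> x i j; rewrite ord1; case: (fg j) => _ _ _ _ h _; exact: le_trans (h x) (FC x).
move=> psi j /test_function_kernel[C' [r [C'0 r0 _ cpsi]]].
rewrite /pairing /dist_partial /pairing.
apply: integration_by_parts_controlled (fg j) (cpsi j) _.
apply: (@integrable_le _ _ _ _ _ (fun x : E => `|C| * C' * ball_indic r x)).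
- by apply: measurable_funM => //; apply: measurable_funM => //; exact: measurable_ball_indic.
- move=> x; rewrite mulrA normrM (ger0_norm (ball_indic_ge0 _ _)) ler_wpM2r ?ball_indic_ge0//.
  rewrite normrM (ger0_norm C'0) ler_wpM2r// ger0_norm// (le_trans (FC x))// ler_norm//.
apply: integrable_cstM; have := integrable_ball r (0 : E); apply: eq_integrable => // x _ /=.
by rewrite sub0r ball_indicN.
Qed.

Lemma ball_indic_sq_integrable r : sq_integrable (ball_indic r : E -> R).
Proof.
split; first exact: measurable_ball_indic.
have := integrable_ball r (0 : E); apply: eq_integrable => // x _ /=.
by rewrite sub0r ball_indicN; case: (ball_indic01 r x) => ->; rewrite ?expr0n ?expr1n.
Qed.

Lemma sq_integrable_le (f g : E -> R) (C : R) : measurable_fun setT f -> sq_integrable g ->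
  (forall x, `|f x| <= C * g x) -> sq_integrable f.
Proof.
move=> mf [mg Ig] fg; split => //.
apply: (@integrable_le _ _ _ _ _ (fun x : E => C ^+ 2 * g x ^+ 2)).
- exact: measurable_funX.
- move=> x; rewrite -exprMn normrX -[leRHS](real_normK (num_real _)) lerXn2r ?nnegrE//.
  exact: le_trans (fg x) (ler_norm _).
exact: integrable_cstM.
Qed.

Definition gradient (f : E -> R) (x : E) : E := \row_j partial j f x.

(** It makes translated kernels admissible as potentials in the weak divergence condition. *)
Lemma test_function_W12 (f : E -> R) : test_function f -> W12 f (gradient f).
Proof.
move=> tf; have [C [r [C0 r0 fC cf]]] := test_function_kernel tf.
have [ctf _ cdf] := test_function_ck1 tf.
have mf := continuous_measurable_rV ctf.
have mB := @measurable_ball_indic R d r.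
split.
- apply: sq_integrable_Lp2 => i j; under eq_fun do rewrite mxE !ord1 eqxx mulr1n.
  exact: sq_integrable_le mf (ball_indic_sq_integrable r) fC.
- apply: sq_integrable_Lp2 => i j; rewrite ord1; under eq_fun do rewrite mxE.
  apply: sq_integrable_le (ball_indic_sq_integrable r) (controlled_derive_le (cf j)).
  exact: continuous_measurable_rV.
apply: (@controlled_weak_gradient f _ (fun x => C * ball_indic r x) C) => //.
- move=> j; rewrite (_ : (fun x => _) = partial j f)//.
  by apply/funext => x; rewrite mxE.
- exact: measurable_funM.
- by move=> x; rewrite ler_piMr// ball_indic_le1.
Qed.

Section mollified_field.
Variables (u : E -> E) (k : E -> R) (r : R).
Hypothesis su : forall i, sq_integrable (fun x => u x 0 i).
Hypothesis div_u : forall q g, W12 q g -> \int[mu]_x mxdot (u x) (g x) = 0.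
Hypotheses (r0 : 0 < r) (mk : mollifier r k).

Definition mollify (x : E) : E := \row_i cvl k (fun y => u y 0 i) x.

Definition mollify_jacobian (x : E) : 'M[R]_d :=
  \matrix_(i, j) cvl (partial j k) (fun y => u y 0 i) x.

Lemma mollify_controlled : exists C s : R, [/\ 0 <= C, 0 < s &
  forall i j, controlled j (fun x => mollify x 0 i) (fun x => mollify_jacobian x i j)
    (fun x => C * ball_mass (fun y => u y 0 i) s x)].
Proof.
have [C [s [C0 s0 _ ck]]] := test_function_kernel (mollifier_test0 mk).
exists C, s; split => // i j.
have -> : (fun x => mollify x 0 i) = cvl k (fun y => u y 0 i).
  by apply/funext => x; rewrite mxE.
have -> : (fun x => mollify_jacobian x i j) = cvl (partial j k) (fun y => u y 0 i).
  by apply/funext => x; rewrite mxE.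
exact: cvl_controlled.
Qed.

(** The divergence condition is tested with the potential [y |-> k (x - y)], whose gradient is minus
    that of [k] at [x - y]; the pairing is then minus the trace of the Jacobian at [x]. *)
Lemma div_mollify x : \sum_j mollify_jacobian x j j = 0.
Proof.
have [C [s [C0 s0 _ ck]]] := test_function_kernel (mollifier_test0 mk).
have tk := mollifier_test mk x.
have Ik j := integrable_cvl (controlled_measurable_derive (ck j)) (controlled_derive_le (ck j)) (su j) x.
have pk j y : partial j (fun y => k (x - y)) y = - partial j k (x - y).
  apply: derive_val; apply: is_derive_reflect.
  exact: controlled_derive (ck j) (x - y).
have := div_u (test_function_W12 tk).
rewrite (_ : \int[mu]_y _ = - \sum_j mollify_jacobian x j j); first by move/eqP; rewrite oppr_eq0 => /eqP.
under eq_Rintegral => y _ do rewrite mxdot_row.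
rewrite Rintegral_sumr; last first.
  move=> j; under eq_fun do rewrite mxE pk mulrN mulrC.
  exact: integrableNr (Ik j).
rewrite -sumrN; apply: eq_bigr => j _; rewrite mxE /cvl.
under eq_Rintegral => y _ do rewrite mxE pk mulrN mulrC -mulN1r.
by rewrite RintegralZl// mulN1r.
Qed.

Lemma mollify_Lp2 : Lp 2%:E mollify.
Proof.
have [C [s [C0 s0 ck]]] := mollify_controlled.
apply: sq_integrable_Lp2 => a i; rewrite ord1.
have [D _ kD] := mollifier_ball mk.
apply: (@sq_integrable_le _ (ball_mass (fun y => u y 0 i) r) D).
- under eq_fun do rewrite mxE; exact: (measurable_cvl (mollifier_measurable mk) (su i)).
- exact: integrable_ball_mass_sq.
- by move=> x; rewrite mxE; exact: (cvl_le (mollifier_measurable mk) kD (su i)).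
Qed.

Lemma mollify_test_field (T : R) : test_field T (fun=> mollify) (fun=> mollify_jacobian).
Proof.
have [C [s [C0 s0 ck]]] := mollify_controlled.
have /choice[M hM] i : exists M, forall x, ball_mass (fun y => u y 0 i) s x <= M.
  by have [M _ hM] := ball_mass_bounded (su i) s0; exists M.
pose N := C * \sum_i `|M i|.
have MN i : C * M i <= N.
  rewrite ler_wpM2l// (bigD1 i)//= (le_trans (ler_norm _))// lerDl; exact: sumr_ge0.
have mN i x : C * ball_mass (fun y => u y 0 i) s x <= N.
  by apply: le_trans (MN i); rewrite ler_wpM2l.
have mm i : measurable_fun setT (fun x => C * ball_mass (fun y => u y 0 i) s x).
  by apply: measurable_funM => //; exact: measurable_ball_mass (su i) s.
have mv i : measurable_fun setT (fun x => mollify x 0 i).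
  under eq_fun do rewrite mxE; exact: (measurable_cvl (mollifier_measurable mk) (su i)).
have zero p (m n : nat) : p != 0%E -> Lp_norm p (fun _ : E => 0 : 'M[R]_(m, n)) = 0%E.
  move=> p0; rewrite /Lp_norm (_ : (fun x => _) = cst 0%E) ?Lnorm0//.
  by apply/funext => x; rewrite enorm0.
split.
- have /choice[L hL] i : exists L, forall x y,
      `|cvl k (fun y => u y 0 i) x - cvl k (fun y => u y 0 i) y| <= L * `|x - y|.
    by have [L _ hL] := cvl_lipschitz r0 mk (su i); exists L.
  pose K : R := \sum_i `|L i|; have K0 : 0 <= K by apply: sumr_ge0.
  exists K; split; first exact: num_real.
  move=> K' KK' [[s1 x] [s2 y]] _ /=.
  (* The field is constant in time and the norm of a pair is the larger of the two norms, so a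
     Lipschitz constant in space serves for time and space jointly. *)
  apply: (@le_trans _ _ (K * `|x - y|)); last first.
    by rewrite ler_pM ?(ltW KK')// prod_normE le_max lexx orbT.
  apply/mx_norm_leP => [|a i]; first by rewrite mulr_ge0.
  rewrite ord1 !mxE; apply: le_trans (hL i x y) _.
  by rewrite ler_wpM2r// (le_trans (ler_norm _))// /K (bigD1 i)//= lerDl sumr_ge0.
- move=> t _; split.
  + exact: mollify_Lp2.
  + apply: (@bounded_Lp_infty _ _ _ _ _ N).
      by apply: measurable_fun_entries => a i; rewrite ord1.
    move=> x a i; rewrite ord1; exact: le_trans (controlled_le (ck i i) x) (mN i x).
  + apply: (@bounded_Lp_infty _ _ _ _ _ N).
      apply: measurable_fun_entries => i j; exact: controlled_measurable_derive (ck i j).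
    move=> x i j; exact: le_trans (controlled_derive_le (ck i j) x) (mN i x).
  + move=> i; apply: (@controlled_weak_gradient _ _ (fun x => C * ball_mass (fun y => u y 0 i) s x) N) => //.
      by move=> j; under [X in controlled _ _ X _]eq_fun do rewrite mxE; exact: ck.
    exact: controlled_le (ck i i).
- exists 0 => s1 t _ _; rewrite mul0r.
  rewrite (_ : (mollify \- mollify)%R = fun=> 0); last by apply/funext => x; rewrite /= subrr.
  rewrite (_ : (mollify_jacobian \- mollify_jacobian)%R = fun=> 0);
    last by apply/funext => x; rewrite /= subrr.
  by rewrite !zero.
(* For the weak divergence, integration by parts moves the derivatives from [psi] back to the
   mollified field, whose Jacobian has zero trace. *)
- move=> t _ psi /test_function_kernel[C' [s' [C'0 s'0 _ cpsi]]].
  have IFG i : I (fun x => C * ball_mass (fun y => u y 0 i) s x * (C' * ball_indic s' x)).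
    apply: (@integrable_le _ _ _ _ _ (fun x : E => `|N| * C' * ball_indic s' x)).
    + by apply: measurable_funM => //; apply: measurable_funM => //; exact: measurable_ball_indic.
    + have F0 x := le_trans (normr_ge0 _) (controlled_le (ck i i) x).
      move=> x; rewrite mulrA normrM (ger0_norm (ball_indic_ge0 _ _)) ler_wpM2r ?ball_indic_ge0//.
      rewrite normrM (ger0_norm C'0) ler_wpM2r// ger0_norm// (le_trans (mN i x))// ler_norm//.
    apply: integrable_cstM; have := integrable_ball s' (0 : E); apply: eq_integrable => // x _ /=.
    by rewrite sub0r ball_indicN.
  transitivity (\sum_i \int[mu]_x (mollify_jacobian x i i * psi x)).
    apply: eq_bigr => i _; rewrite /dist_partial /pairing.
    by rewrite (integration_by_parts_controlled (ck i i) (cpsi i) (IFG i)).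
  rewrite -Rintegral_sumr; last first.
    move=> i; apply: integrable_le (IFG i).
      apply: measurable_funM; [exact: controlled_measurable_derive (ck i i)|
        exact: controlled_measurable (cpsi i)].
    move=> x; rewrite normrM ler_pM//; [exact: controlled_derive_le (ck i i) x|
      exact: controlled_le (cpsi i) x].
  under eq_Rintegral => x _ do rewrite -mulr_suml div_mollify mul0r.
  by rewrite /Rintegral integral0.
Qed.

End mollified_field.
End weak_gradients.

(** * The energy flux at a fixed time *)

Section flux.
Context {R : realType} {d : nat}.
Local Notation E := 'rV[R]_d.
Local Notation mu := (leb d : {sigma_finite_measure set E -> \bar R}).
Local Notation I f := (mu.-integrable setT (EFin \o f)).
Local Notation e_ j := (delta_mx 0 j : E).

Lemma sq_integrable_mul (f g : E -> R) : sq_integrable f -> sq_integrable g ->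
  I (fun x => f x * g x).
Proof.
move=> [mf If] [mg Ig]; apply: (integrable_le _ _ (integrableDr If Ig)).
  exact: measurable_funM.
move=> x; rewrite normrM -(real_normK (num_real (f x))) -(real_normK (num_real (g x))).
by have := sqr_ge0 (`|f x| - `|g x|); have := normr_ge0 (f x); have := normr_ge0 (g x); nra.
Qed.

Section flux_identity.
Variables (u : E -> E) (k : E -> R) (r : R) (S : E -> 'M[R]_d).
Hypothesis su : forall i, sq_integrable (fun x => u x 0 i).
Hypothesis div_u : forall q g, W12 q g -> \int[mu]_x mxdot (u x) (g x) = 0.
Hypotheses (r0 : 0 < r) (mk : mollifier r k).
Hypothesis uS : is_sym_gradient u S.

Local Notation v := (mollify u k).
Local Notation J := (mollify_jacobian u k).

(* The pairing of [u \otimes u] with the gradient of the mollified [w]; at [w := u] it is half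
   of the time derivative of the mollified energy [\int u . (k * u)]. *)
Definition flux (w : E -> E) : R :=
  \sum_i \sum_j \int[mu]_x (u x 0 i * u x 0 j * mollify_jacobian w k x i j).

Lemma mollify_sq_integrable i : sq_integrable (fun x => v x 0 i).
Proof. exact: Lp2_sq_integrable (mollify_Lp2 su r0 mk) 0 i. Qed.

Lemma mollify_jacobian_bounded : exists N : R, forall x i j, `|J x i j| <= N.
Proof.
have [C [s [C0 s0 ck]]] := mollify_controlled su mk.
have /choice[M hM] i : exists M, forall x, ball_mass (fun y => u y 0 i) s x <= M.
  by have [M _ hM] := ball_mass_bounded (su i) s0; exists M.
exists (C * \sum_i `|M i|) => x i j; apply: le_trans (controlled_derive_le (ck i j) x) _.
rewrite ler_wpM2l// (le_trans (hM i x))// (bigD1 i)//= (le_trans (ler_norm _))// lerDl.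
exact: sumr_ge0.
Qed.

Lemma measurable_mollify_jacobian i j : measurable_fun setT (fun x => J x i j).
Proof.
by have [C [s [_ _ ck]]] := mollify_controlled su mk; exact: controlled_measurable_derive (ck i j).
Qed.

(** The integral of the [j]-th derivative of [v_j v_i v_i] vanishes, which is [key]; after summation
    over [j] its right-hand side contains the divergence of [v]. *)
Lemma mollify_trilinear0 : \sum_i \sum_j \int[mu]_x (v x 0 i * v x 0 j * J x i j) = 0.
Proof.
have [C [s [C0 s0 ck]]] := mollify_controlled su mk.
have [N JN] := mollify_jacobian_bounded.
pose F i x := C * ball_mass (fun y => u y 0 i) s x.
have F0 i x : 0 <= F i x by exact: le_trans (controlled_le (ck i i) x).
have sF i : sq_integrable (F i).
  apply: (@sq_integrable_le _ _ _ (ball_mass (fun y => u y 0 i) s) C).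
  - by apply: measurable_funM => //; exact: measurable_ball_mass (su i) s.
  - exact: integrable_ball_mass_sq.
  - by move=> x; rewrite ger0_norm.
have /choice[M hM] i : exists M, forall x, ball_mass (fun y => u y 0 i) s x <= M.
  by have [M _ hM] := ball_mass_bounded (su i) s0; exists M.
(* The cubic majorant is integrable because one factor is bounded and the other two are square
   integrable. *)
have IF i j : I (fun x => F j x * (3 * (F i x * F i x))).
  apply: (@integrable_le _ _ _ _ _ (fun x => 3 * (C * M i) * (F j x * F i x))).
  - apply: measurable_funM; first exact: (sF j).1.
    by apply: measurable_funM => //; apply: measurable_funM; exact: (sF i).1.
  - move=> x; rewrite ger0_norm; last first.
      by apply: mulr_ge0; [exact: F0|apply: mulr_ge0 => //; apply: mulr_ge0; exact: F0].
    have h : F i x <= C * M i by rewrite ler_wpM2l.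
    have := mulr_ge0 (F0 j x) (F0 i x); nra.
  - by apply: integrable_cstM; exact: sq_integrable_mul.
have Ivv i j : I (fun x => v x 0 i * v x 0 j).
  exact: sq_integrable_mul (mollify_sq_integrable i) (mollify_sq_integrable j).
have IJ i j a b : I (fun x => v x 0 i * v x 0 j * J x a b).
  exact: integrable_bounded_mul (Ivv i j) (measurable_mollify_jacobian a b) (fun x => JN x a b).
have key i j : 2 * \int[mu]_x (v x 0 i * v x 0 j * J x i j) = - \int[mu]_x (v x 0 i * v x 0 i * J x j j).
  have := controlled_integral0 (controlledM (ck j j) (controlledM (ck i j) (ck i j)))
    (integrable_cstM 3 (IF i j)).
  rewrite (_ : (fun x => _) = fun x => v x 0 i * v x 0 i * J x j j + 2 * (v x 0 i * v x 0 j * J x i j));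
    last first.
    by apply/funext => x; ring.
  rewrite RintegralD// ?RintegralZl//; last exact: integrable_cstM.
  by move=> /eqP; rewrite addrC addr_eq0 => /eqP.
have : 2 * (\sum_i \sum_j \int[mu]_x (v x 0 i * v x 0 j * J x i j)) = 0.
  rewrite mulr_sumr big1// => i _; rewrite mulr_sumr.
  under eq_bigr do rewrite key.
  rewrite sumrN -Rintegral_sumr//.
  under eq_Rintegral => x _ do rewrite -mulr_sumr (div_mollify su div_u mk) mulr0.
  by rewrite /Rintegral integral0 oppr0.
by move/eqP; rewrite mulf_eq0 pnatr_eq0/= => /eqP.
Qed.

(** The weak symmetric gradient is tested with [y |-> k (x - y)]; the minus sign of the weak
    derivative cancels that of the reflection. *)
Lemma mollify_sym_gradient x i j :
  cvl k (fun y => S y i j) x = (J x i j + J x j i) / 2.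
Proof.
have [C [s [C0 s0 _ ck]]] := test_function_kernel (mollifier_test0 mk).
have pk l y : partial l (fun y => k (x - y)) y = - partial l k (x - y).
  apply: derive_val; apply: is_derive_reflect.
  exact: controlled_derive (ck l) (x - y).
have Ik l a := integrable_cvl (controlled_measurable_derive (ck l)) (controlled_derive_le (ck l)) (su a) x.
have [_ _ /(_ _ i j (mollifier_test mk x))] := uS.
have D a l : dist_partial l (fun y => u y 0 a) (fun y => k (x - y)) = J x a l.
  rewrite mxE /cvl /dist_partial /pairing.
  under eq_Rintegral => y _ do rewrite pk mulrN mulrC -mulN1r.
  by rewrite RintegralZl// mulN1r opprK.
rewrite /dist_sym_gradient !D mulrC => <-; rewrite /cvl /pairing.
by apply: eq_Rintegral => y _; rewrite mulrC.
Qed.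

(** Subtracting [mollify_trilinear0] produces the commutator. As the latter is symmetric in [i] and
    [j], exchanging the indices and averaging leaves only the symmetric part of the Jacobian. *)
Lemma flux_symE : flux u =
  \sum_i \sum_j \int[mu]_x ((u x 0 i * u x 0 j - v x 0 i * v x 0 j) * cvl k (fun y => S y i j) x).
Proof.
have [N JN] := mollify_jacobian_bounded.
pose D i j x := u x 0 i * u x 0 j - v x 0 i * v x 0 j.
have Iuu i j : I (fun x => u x 0 i * u x 0 j) by exact: sq_integrable_mul.
have Ivv i j : I (fun x => v x 0 i * v x 0 j).
  exact: sq_integrable_mul (mollify_sq_integrable i) (mollify_sq_integrable j).
have IJ f a b : I f -> I (fun x => f x * J x a b).
  by move=> If; exact: integrable_bounded_mul If (measurable_mollify_jacobian a b) (fun x => JN x a b).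
have ID i j a b : I (fun x => D i j x * J x a b) by apply: IJ; exact: integrableBr.
have E1 : flux u = \sum_i \sum_j \int[mu]_x (D i j x * J x i j).
  rewrite /flux -[LHS]subr0 -[X in _ - X]mollify_trilinear0 -sumrB; apply: eq_bigr => i _.
  rewrite -sumrB; apply: eq_bigr => j _; rewrite -RintegralB//; last 2 first.
  - exact: IJ.
  - exact: IJ.
  by apply: eq_Rintegral => x _; rewrite -mulrBl.
have E2 : flux u = \sum_i \sum_j \int[mu]_x (D i j x * J x j i).
  rewrite E1 exchange_big; apply: eq_bigr => i _; apply: eq_bigr => j _.
  by apply: eq_Rintegral => x _; rewrite /D; congr (_ * _); ring.
have -> : flux u =
    2^-1 * (\sum_i \sum_j \int[mu]_x (D i j x * J x i j) + \sum_i \sum_j \int[mu]_x (D i j x * J x j i)).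
  by rewrite -E1 -E2; lra.
rewrite -big_split/= mulr_sumr; apply: eq_bigr => i _.
rewrite -big_split/= mulr_sumr; apply: eq_bigr => j _.
rewrite -RintegralD// -RintegralZl//; last exact: integrableDr.
by apply: eq_Rintegral => x _; rewrite mollify_sym_gradient /D; lra.
Qed.

End flux_identity.
End flux.

(** * Mollification in [L^q]: boundedness and convergence *)

Section mollified_powers.
Context {R : realType} {d : nat}.
Local Notation E := 'rV[R]_d.
Local Notation mu := (leb d : {sigma_finite_measure set E -> \bar R}).
Local Notation I f := (mu.-integrable setT (EFin \o f)).
Variables (r : R) (k : E -> R) (q : R).
Hypotheses (mk : mollifier r k) (q1 : 1 <= q).

Let q0 : 0 < q. Proof. exact: lt_le_trans ltr01 q1. Qed.

Lemma Rintegral_kernel x : \int[mu]_y k (x - y) = 1.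
Proof. by rewrite /Rintegral (kernel_mass mk). Qed.

Lemma le1D_powR (t : R) : 0 <= t -> t <= 1 + t `^ q.
Proof.
move=> t0; have [t1|t1] := leP t 1; first by rewrite (le_trans t1)// lerDl powR_ge0.
by rewrite (le_trans (le1r_powR (ltW t1) q1))// lerDr.
Qed.

Lemma integrable_kernel_le (x : E) (g h : E -> R) : measurable_fun setT g ->
  (forall y, `|g y| <= h y) -> I (fun y => k (x - y) * h y) -> I (fun y => k (x - y) * g y).
Proof.
move=> mg gh; apply: integrable_le.
  apply: measurable_funM => //; exact: measurableT_comp (mollifier_measurable mk) (measurable_subl x).
by move=> y; rewrite normrM (ger0_norm (mollifier_ge0 mk _)) ler_wpM2l// (mollifier_ge0 mk).
Qed.

Lemma integrable_kernel_mul (x : E) (g : E -> R) : I g -> I (fun y => k (x - y) * g y).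
Proof.
move=> Ig; have [C kC] := mollifier_bounded mk.
have := @integrable_bounded_mul _ _ _ _ g (fun y => k (x - y)) C Ig.
under [X in _ -> _ -> I X]eq_fun do rewrite mulrC; apply.
  exact: measurableT_comp (mollifier_measurable mk) (measurable_subl x).
by move=> y; rewrite ger0_norm ?(mollifier_ge0 mk).
Qed.

Lemma integrable_kernel_powR (x : E) (g : E -> R) : measurable_fun setT g ->
  I (fun y => k (x - y) * `|g y| `^ q) -> I (fun y => k (x - y) * g y).
Proof.
move=> mg Ig; apply: (@integrable_kernel_le x g (fun y => 1 + `|g y| `^ q)) => //.
  by move=> y; exact: le1D_powR.
have := integrableDr (integrable_kernel mk x) Ig; apply: eq_integrable => // y _ /=.
by rewrite mulrDr mulr1.
Qed.

(* Jensen's inequality up to a constant, from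
   [s <= m + s ^ q / m ^ (q - 1)] with [m] half of the average. *)
Lemma kernel_jensen (x : E) (g : E -> R) : measurable_fun setT g -> (forall y, 0 <= g y) ->
  I (fun y => k (x - y) * g y `^ q) ->
  (\int[mu]_y (k (x - y) * g y)) `^ q <= 2 `^ q * \int[mu]_y (k (x - y) * g y `^ q).
Proof.
move=> mg g0 Iq; have Ig : I (fun y => k (x - y) * g y).
  by apply: integrable_kernel_powR => //; under eq_fun do rewrite ger0_norm//.
set M := \int[mu]_y _; set W := \int[mu]_y _.
have W0 : 0 <= W by apply: Rintegral_ge0 => y _; rewrite mulr_ge0 ?powR_ge0 ?(mollifier_ge0 mk).
have : 0 <= M by apply: Rintegral_ge0 => y _; rewrite mulr_ge0 ?(mollifier_ge0 mk).
rewrite le_eqVlt => /predU1P[<-|M0]; first by rewrite powR0 ?gt_eqF// mulr_ge0 ?powR_ge0.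
pose m := M / 2; have m0 : 0 < m by rewrite divr_gt0.
have mq0 : 0 < m `^ (q - 1) by rewrite powR_gt0.
have key s : 0 <= s -> s <= m + (m `^ (q - 1))^-1 * s `^ q.
  move=> s0; have [sm|ms] := leP s m.
    by rewrite (le_trans sm)// lerDl mulr_ge0 ?invr_ge0 ?powR_ge0.
  rewrite (@le_trans _ _ ((m `^ (q - 1))^-1 * s `^ q))// ?lerDr ?(ltW m0)//.
  rewrite ler_pdivlMl// -(mulr_powRB1 s0 q0) mulrC ler_wpM2l//.
  by rewrite ler_powRl ?(ltW ms) ?(ltW m0)// subr_ge0.
have : M <= \int[mu]_y (m * k (x - y) + (m `^ (q - 1))^-1 * (k (x - y) * g y `^ q)).
  apply: le_Rintegral => //.
    by apply: integrableDr; apply: integrable_cstM => //; exact: integrable_kernel mk x.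
  move=> y _; rewrite (le_trans (ler_wpM2l (mollifier_ge0 mk (x - y)) (key _ (g0 y))))//.
  by rewrite mulrDr mulrC mulrCA.
rewrite RintegralD//; last 2 first.
- exact: integrable_cstM (integrable_kernel mk x).
- exact: integrable_cstM.
rewrite (RintegralZl _ measurableT (integrable_kernel mk x)) (RintegralZl _ measurableT Iq)
  Rintegral_kernel mulr1 -/W.
have Mm : M = 2 * m by rewrite /m mulrCA mulfV ?mulr1// pnatr_eq0.
rewrite {1}Mm mulr2n mulrDl mul1r lerD2l ler_pdivlMl// mulrC mulr_powRB1// => [h|]; last exact: ltW.
by rewrite Mm powRM ?(ltW m0)// ler_wpM2l ?powR_ge0.
Qed.

(** Jensen in [y] at each [x], then Tonelli. The choice [G x y = |f y|] gives the [L^q] bound on the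
    mollification, and [G x y = |f x - f y|] its rate of approximation. *)
Lemma kernel_jensen_pair (G : E -> E -> R) (w : E -> R) :
  measurable_fun setT (fun z : E * E => G z.1 z.2) -> (forall x y, 0 <= G x y) ->
  (forall x, I (fun y => k (x - y) * G x y `^ q)) ->
  (forall x, `|w x| <= \int[mu]_y (k (x - y) * G x y)) ->
  (\int[mu]_x (`|w x| `^ q)%:E <= (2 `^ q)%:E * pair_average k (fun x y => G x y `^ q)%R)%E.
Proof.
move=> mG G0 IG wG.
have mGq : measurable_fun setT (fun z : E * E => G z.1 z.2 `^ q).
  exact: measurableT_comp (measurable_powR q) mG.
have mG1 x : measurable_fun setT (G x) by exact: measurableT_comp mG (pair1_measurable x).
rewrite -(pair_averageZ mk)//; last first.
  by move=> x y; exact: powR_ge0.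
rewrite /pair_average fubini_tonelli1; last 2 first.
- apply/measurable_EFinP; apply: measurable_funM; first exact: measurable_kernel mk.
  exact: measurable_funM.
- by move=> z; rewrite lee_fin !mulr_ge0 ?powR_ge0 ?(mollifier_ge0 mk).
apply: ge0_le_integral_any => x _; first by rewrite lee_fin powR_ge0.
rewrite /fubini_F/= -EFin_Rintegral; last first.
  have := integrable_cstM (2 `^ q) (IG x); apply: eq_integrable => // y _ /=.
  by rewrite mulrCA.
rewrite lee_fin (le_trans (ler_powRl (ltW q0) (normr_ge0 _) (wG x)))//.
rewrite (le_trans (kernel_jensen (mG1 x) (G0 x) (IG x)))// -RintegralZl//.
by under eq_Rintegral => y _ do rewrite mulrCA.
Qed.

Section mollified_function.
Variable f : E -> R.
Hypotheses (sf : sq_integrable f) (Iq : I (fun x => `|f x| `^ q)).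

Let mf : measurable_fun setT f := sf.1.

Let Ikf x : I (fun y => k (x - y) * `|f y| `^ q).
Proof. exact: integrable_kernel_mul. Qed.

Let mv : measurable_fun setT (cvl k f) := measurable_cvl (mollifier_measurable mk) sf.

Lemma powR_norm_sub (a b : R) : `|a - b| `^ q <= 3 `^ q * (`|a| `^ q + `|b| `^ q).
Proof.
have := @powR_triangle3 R q `|a - b| `|a| `|b| 0 (ltW q0).
rewrite powR0 ?gt_eqF// !addr0; apply => //; exact: ler_normB.
Qed.

Lemma mollify_powR_le : (\int[mu]_x (`|cvl k f x| `^ q)%:E <=
  (2 `^ q)%:E * \int[mu]_x (`|f x| `^ q)%:E)%E.
Proof.
have mq := measurable_powR_norm q mf.
rewrite -(pair_average_snd mk mq) => [|x]; last exact: powR_ge0.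
apply: kernel_jensen_pair => //.
- by apply: (measurable_snd_fun (h := fun y => `|f y|)); exact: measurableT_comp.
- move=> x; apply: Rintegral_norm_le.
  + exact: integrable_kernel_powR.
  + by apply: integrable_kernel_powR; [exact: measurableT_comp|under eq_fun do rewrite normr_id].
  + by move=> y; rewrite normrM (ger0_norm (mollifier_ge0 mk _)).
Qed.

Lemma mollify_powR_integrable : I (fun x => `|cvl k f x| `^ q).
Proof.
apply: integrable_ge0; [exact: measurable_powR_norm|by move=> x; exact: powR_ge0|].
apply: le_lt_trans mollify_powR_le _; apply: lte_mul_pinfty; rewrite ?lee_fin ?powR_ge0//.
exact: integrable_lty Iq.
Qed.

Lemma mollify_diff_powR_integrable : I (fun x => `|f x - cvl k f x| `^ q).
Proof.
apply: (@integrable_le _ _ _ _ _ (fun x => 3 `^ q * (`|f x| `^ q + `|cvl k f x| `^ q))).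
- by apply: measurable_powR_norm; exact: measurable_funB.
- by move=> x; rewrite ger0_norm ?powR_ge0// powR_norm_sub.
by apply: integrable_cstM; apply: integrableDr => //; exact: mollify_powR_integrable.
Qed.

Lemma mollify_diff_powR_le : (\int[mu]_x (`|f x - cvl k f x| `^ q)%:E <=
  (2 `^ q)%:E * pair_average k (fun x y => `|f x - f y| `^ q)%R)%E.
Proof.
have Ix x : I (fun y => k (x - y) * `|f x - f y| `^ q).
  apply: (@integrable_kernel_le x _ (fun y => 3 `^ q * (`|f x| `^ q + `|f y| `^ q))).
  - by apply: measurable_powR_norm; exact: measurable_funB.
  - by move=> y; rewrite ger0_norm ?powR_ge0// powR_norm_sub.
  have := integrable_cstM (3 `^ q)
    (integrableDr (integrable_cstM (`|f x| `^ q) (integrable_kernel mk x)) (Ikf x)).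
  by apply: eq_integrable => // y _ /=; congr EFin; ring.
have I1 x : I (fun y => k (x - y) * (f x - f y)).
  by apply: integrable_kernel_powR => //; exact: measurable_funB.
apply: kernel_jensen_pair => //; first exact: measurable_osc mf.
(* The kernel has mass 1, so [f x] is itself an average against [k (x - y)]. *)
move=> x; have -> : f x - cvl k f x = \int[mu]_y (k (x - y) * (f x - f y)).
  rewrite -[X in X - _]mulr1 -(Rintegral_kernel x) -RintegralZl//; last exact: integrable_kernel mk x.
  rewrite /cvl -RintegralB//; last 2 first.
  - exact: integrable_cstM (integrable_kernel mk x).
  - exact: integrable_kernel_powR.
  by apply: eq_Rintegral => y _; rewrite mulrBr mulrC.
apply: Rintegral_norm_le => //.
- apply: integrable_kernel_powR; first by apply: measurableT_comp => //; exact: measurable_funB.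
  by under eq_fun do rewrite normr_id.
- by move=> y; rewrite normrM (ger0_norm (mollifier_ge0 mk _)).
Qed.

End mollified_function.
End mollified_powers.

Section approximation.
Context {R : realType} {d : nat}.
Local Notation E := 'rV[R]_d.
Local Notation mu := (leb d : {sigma_finite_measure set E -> \bar R}).
Local Notation I f := (mu.-integrable setT (EFin \o f)).
Variable K : nat -> E -> R.
Hypothesis mK : forall n, mollifier (n.+1%:R^-1) (K n).

Lemma mollify_powR_cvg (q : R) (f : E -> R) : 1 <= q -> sq_integrable f ->
  I (fun x => `|f x| `^ q) -> forall e : R, 0 < e ->
  \forall n \near \oo, \int[mu]_x (`|f x - cvl (K n) f x| `^ q) <= e.
Proof.
move=> q1 sf Iq e e0; have c0 : 0 < (2 : R) `^ q by rewrite powR_gt0.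
have := osc_vanishes_powR mK q1 sf.1 Iq (divr_gt0 e0 c0).
apply: filterS => n h; rewrite -lee_fin.
have := mollify_diff_powR_integrable (mK n) q1 sf Iq => Id.
rewrite EFin_Rintegral; last exact: Id.
apply: le_trans (mollify_diff_powR_le (mK n) q1 sf Iq) _.
apply: (le_trans (lee_wpmul2l _ h)); first by rewrite lee_fin ltW.
by rewrite -EFinM mulrCA mulfV ?gt_eqF// mulr1.
Qed.

End approximation.

Section powers.
Context {R : realType}.

(** An arithmetic-geometric mean inequality with a free weight, used in place of Cauchy-Schwarz: a
    merely bounded factor will carry [t], a small one [t^-1]. *)
Lemma powRM_young (p a b t : R) : 0 <= a -> 0 <= b -> 0 < t ->
  (a * b) `^ p <= t * a `^ (2 * p) + t^-1 * b `^ (2 * p).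
Proof.
move=> a0 b0 t0; rewrite powRM// mulrC [b `^ p * _]mulrC (mulrC 2 p) !powRrM !powR_mulrn ?powR_ge0//.
set A := a `^ p; set B := b `^ p.
have A0 : 0 <= A by exact: powR_ge0.
have B0 : 0 <= B by exact: powR_ge0.
rewrite -subr_ge0 -(pmulr_rge0 _ t0) mulrBr mulrDr (mulrA t t^-1) mulfV ?gt_eqF// mul1r.
have := sqr_ge0 (t * A - B); have := mulr_ge0 A0 B0; nra.
Qed.

Lemma powRD_le (p a b : R) : 0 < p -> 0 <= a -> 0 <= b ->
  (a + b) `^ p <= 3 `^ p * (a `^ p + b `^ p).
Proof.
move=> p0 a0 b0; have := @powR_triangle3 R p (a + b) a b 0 (ltW p0).
by rewrite powR0 ?gt_eqF// !addr0; apply => //; exact: addr_ge0.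
Qed.

(** From [a b - a' b' = a (b - b') + b' (a - a')]. The weight [t] falls on the factors that are only
    bounded, [t^-1] on the differences, which tend to zero under mollification. *)
Lemma stress_powR_le (p t a b a' b' : R) : 0 < p -> 0 < t ->
  `|a * b - a' * b'| `^ p <= 3 `^ p * (t * (`|a| `^ (2 * p) + `|b'| `^ (2 * p)) +
    t^-1 * (`|b - b'| `^ (2 * p) + `|a - a'| `^ (2 * p))).
Proof.
move=> p0 t0; have h : `|a * b - a' * b'| <= `|a| * `|b - b'| + `|b'| * `|a - a'|.
  rewrite -!normrM (_ : a * b - a' * b' = a * (b - b') + b' * (a - a')); last by ring.
  exact: ler_normD.
apply: le_trans (ler_powRl (ltW p0) (normr_ge0 _) h) _.
apply: le_trans (powRD_le p0 _ _) _; rewrite ?mulr_ge0//.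
rewrite ler_wpM2l ?powR_ge0// !mulrDr addrACA lerD//; exact: powRM_young.
Qed.

End powers.

(** * Bounds on the commutator and on the flux *)

Section flux_estimate.
Context {R : realType} {d : nat}.
Local Notation E := 'rV[R]_d.
Local Notation mu := (leb d : {sigma_finite_measure set E -> \bar R}).
Local Notation I f := (mu.-integrable setT (EFin \o f)).
Variables (u : E -> E) (p : R).
Hypothesis su : forall i, sq_integrable (fun x => u x 0 i).
Hypothesis p1 : 1 <= p.
Hypothesis Iq : forall i, I (fun x => `|u x 0 i| `^ (2 * p)).

Let p0 : 0 < p. Proof. exact: lt_le_trans ltr01 p1. Qed.
Let q1 : 1 <= 2 * p. Proof. by rewrite (le_trans p1)// ler_peMl ?(ltW p0)// ler1n. Qed.

Section one_kernel.
Variables (r : R) (k : E -> R).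
Hypotheses (r0 : 0 < r) (mk : mollifier r k).

(* The commutator of Constantin, E and Titi. *)
Definition stress (i j : 'I_d) (x : E) : R :=
  u x 0 i * u x 0 j - mollify u k x 0 i * mollify u k x 0 j.

Local Notation v i := (cvl k (fun y => u y 0 i)).

Let mu_ i : measurable_fun setT (fun x => u x 0 i) := (su i).1.
Let mv i : measurable_fun setT (v i) := measurable_cvl (mollifier_measurable mk) (su i).

Let Iv i : I (fun x => `|v i x| `^ (2 * p)).
Proof. exact: (mollify_powR_integrable mk q1 (su i) (Iq i)). Qed.

Let Iw i : I (fun x => `|u x 0 i - v i x| `^ (2 * p)).
Proof. exact: (mollify_diff_powR_integrable mk q1 (su i) (Iq i)). Qed.

Lemma stress_powR_pointwise i j t x : 0 < t ->
  `|stress i j x| `^ p <= 3 `^ p * (t * (`|u x 0 i| `^ (2 * p) + `|v j x| `^ (2 * p)) +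
    t^-1 * (`|u x 0 j - v j x| `^ (2 * p) + `|u x 0 i - v i x| `^ (2 * p))).
Proof. by move=> t0; rewrite /stress !mxE; exact: stress_powR_le. Qed.

Lemma measurable_stress i j : measurable_fun setT (stress i j).
Proof.
rewrite /stress; apply: measurable_funB; apply: measurable_funM => //.
  by under eq_fun do rewrite mxE; exact: mv.
by under eq_fun do rewrite mxE; exact: mv.
Qed.

Let Ibound i j t : I (fun x => 3 `^ p * (t * (`|u x 0 i| `^ (2 * p) + `|v j x| `^ (2 * p)) +
    t^-1 * (`|u x 0 j - v j x| `^ (2 * p) + `|u x 0 i - v i x| `^ (2 * p)))).
Proof.
apply: integrable_cstM; apply: integrableDr; apply: integrable_cstM; exact: integrableDr.
Qed.

Lemma stress_powR_integrable i j : I (fun x => `|stress i j x| `^ p).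
Proof.
apply: (integrable_le _ _ (Ibound i j 1)).
  by apply: measurable_powR_norm; exact: measurable_stress.
by move=> x; rewrite ger0_norm ?powR_ge0//; exact: stress_powR_pointwise.
Qed.

Lemma stress_powR_Rintegral i j t (M : R) : 0 < t ->
  (forall i, \int[mu]_x (`|u x 0 i| `^ (2 * p)) <= M) ->
  \int[mu]_x (`|stress i j x| `^ p) <= 3 `^ p * (t * ((1 + 2 `^ (2 * p)) * M) +
    t^-1 * (\int[mu]_x (`|u x 0 j - v j x| `^ (2 * p)) + \int[mu]_x (`|u x 0 i - v i x| `^ (2 * p)))).
Proof.
move=> t0 uM.
have vM : \int[mu]_x (`|v j x| `^ (2 * p)) <= 2 `^ (2 * p) * M.
  rewrite (@le_trans _ _ (2 `^ (2 * p) * \int[mu]_x (`|u x 0 j| `^ (2 * p))))//; last first.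
    by rewrite ler_wpM2l ?powR_ge0.
  rewrite -lee_fin EFinM (EFin_Rintegral (Iv j)) (EFin_Rintegral (Iq j)).
  exact: (mollify_powR_le mk q1 (su j) (Iq j)).
apply: (@le_trans _ _ (\int[mu]_x (3 `^ p * (t * (`|u x 0 i| `^ (2 * p) + `|v j x| `^ (2 * p)) +
    t^-1 * (`|u x 0 j - v j x| `^ (2 * p) + `|u x 0 i - v i x| `^ (2 * p)))))).
  apply: le_Rintegral => //; first exact: stress_powR_integrable.
  by move=> x _; exact: stress_powR_pointwise.
have I1 : I (fun x => `|u x 0 i| `^ (2 * p) + `|v j x| `^ (2 * p)) by exact: integrableDr.
have I2 : I (fun x => `|u x 0 j - v j x| `^ (2 * p) + `|u x 0 i - v i x| `^ (2 * p)) by exact: integrableDr.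
have I3 := integrable_cstM t I1; have I4 := integrable_cstM t^-1 I2.
rewrite (RintegralZl _ measurableT (integrableDr I3 I4)) (RintegralD measurableT I3 I4).
rewrite (RintegralZl _ measurableT I1) (RintegralZl _ measurableT I2).
rewrite (RintegralD measurableT (Iq i) (Iv j)) (RintegralD measurableT (Iw j) (Iw i)).
apply: ler_wpM2l; first exact: powR_ge0.
rewrite lerD2r; apply: ler_wpM2l; first exact: ltW.
by rewrite [leRHS]mulrDl mul1r; apply: lerD; [exact: uM|exact: vM].
Qed.

(** The outcome of [stress_powR_Rintegral] at [t = 1]: [1 + 2 ^ (2 p)] accounts for [u] and its
    mollification, and each of the two differences costs a further [3 ^ (2 p)]. *)
Definition stress_const : R :=
  3 `^ p * ((1 + 2 `^ (2 * p)) + 2 * (3 `^ (2 * p) * (1 + 2 `^ (2 * p)))).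

Lemma stress_const_ge0 : 0 <= stress_const.
Proof. by rewrite !(mulr_ge0, addr_ge0, powR_ge0). Qed.

Lemma stress_powR_bound i j (M : R) :
  (forall i, \int[mu]_x (`|u x 0 i| `^ (2 * p)) <= M) ->
  \int[mu]_x (`|stress i j x| `^ p) <= stress_const * M.
Proof.
move=> uM; apply: le_trans (stress_powR_Rintegral i j ltr01 uM) _.
have w l : \int[mu]_x (`|u x 0 l - v l x| `^ (2 * p)) <= 3 `^ (2 * p) * ((1 + 2 `^ (2 * p)) * M).
  apply: (@le_trans _ _ (\int[mu]_x (3 `^ (2 * p) * (`|u x 0 l| `^ (2 * p) + `|v l x| `^ (2 * p))))).
    apply: le_Rintegral => //; first by apply: integrable_cstM; apply: integrableDr.
    by move=> x _; exact: (powR_norm_sub q1).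
  rewrite RintegralZl//; last exact: integrableDr.
  rewrite RintegralD//; apply: ler_wpM2l; first exact: powR_ge0.
  rewrite [leRHS]mulrDl mul1r; apply: lerD; first exact: uM.
  rewrite (@le_trans _ _ (2 `^ (2 * p) * \int[mu]_x (`|u x 0 l| `^ (2 * p))))//; last first.
    by rewrite ler_wpM2l ?powR_ge0.
  rewrite -lee_fin EFinM (EFin_Rintegral (Iv l)) (EFin_Rintegral (Iq l)).
  exact: (mollify_powR_le mk q1 (su l) (Iq l)).
rewrite /stress_const -mulrA ler_wpM2l ?powR_ge0// mul1r invr1 mul1r [leRHS]mulrDl lerD2l.
apply: le_trans (lerD (w j) (w i)) _.
by rewrite -[leLHS]mulr2n -[leLHS]mulr_natl !mulrA.
Qed.

Section gauge.
Variables (S : E -> 'M[R]_d) (Psi : E -> R) (beta c : R).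
Hypothesis div_u : forall q g, W12 q g -> \int[mu]_x mxdot (u x) (g x) = 0.
Hypothesis uS : is_sym_gradient u S.
Hypotheses (beta0 : 0 <= beta) (c0 : 0 <= c).
Hypotheses (IPsi : I Psi) (Psi0 : forall x, 0 <= Psi x).
(** The form in which the bound on [S] enters: [beta] measures the size of [S], [Psi] is a modular
    density, and the free scale [s] weighs the two terms against each other. The exponential case
    supplies it by [young_expR]; in the bounded case [p = 1] and [Psi] is zero. *)
Hypothesis gauge : forall x i j t s, 0 <= t -> 0 < s ->
  t * `|cvl k (fun y => S y i j) x| <= beta * s * (c * (s `^ p)^-1 * t `^ p + cvl k Psi x).

(** Tonelli and the marginal identity [pair_average_snd]. This makes the modular part of the flux
    bound independent of the kernel. *)
Lemma integrable_cvl_ge0 : I (cvl k Psi) /\ \int[mu]_x cvl k Psi x = \int[mu]_x Psi x.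
Proof.
have mPsi := integrable_measurable IPsi.
have mc : measurable_fun setT (cvl k Psi).
  apply: measurable_Rintegral_snd; apply: measurable_funM; first exact: (measurable_kernel mk).
  exact: (measurable_snd_fun mPsi).
have cPsi0 x : 0 <= cvl k Psi x.
  by apply: Rintegral_ge0 => y _; rewrite mulr_ge0 ?(mollifier_ge0 mk).
have eqI : (\int[mu]_x (cvl k Psi x)%:E = \int[mu]_x (Psi x)%:E)%E.
  rewrite -(pair_average_snd mk mPsi Psi0) /pair_average fubini_tonelli1; last 2 first.
  - apply/measurable_EFinP; apply: measurable_funM; first exact: (measurable_kernel mk).
    exact: (measurable_snd_fun mPsi).
  - by move=> z; rewrite lee_fin mulr_ge0 ?(mollifier_ge0 mk).
  apply: eq_integral => x _; rewrite /fubini_F/= EFin_Rintegral//.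
  exact: (integrable_kernel_mul mk x IPsi).
have Ic : I (cvl k Psi).
  by apply: integrable_ge0 => //; rewrite eqI; exact: integrable_lty IPsi.
by split => //; apply: EFin_inj; rewrite !EFin_Rintegral.
Qed.

Lemma flux_le (s A : R) : 0 < s -> (forall i j, \int[mu]_x (`|stress i j x| `^ p) <= A) ->
  `|flux u k u| <= d%:R ^+ 2 * (beta * s * (c * (s `^ p)^-1 * A + \int[mu]_x Psi x)).
Proof.
move=> s0 stA; have [Ic intc] := integrable_cvl_ge0.
rewrite (flux_symE su div_u r0 mk uS).
set B := beta * s * _; have -> : d%:R ^+ 2 * B = \sum_(i < d) \sum_(j < d) B.
  by rewrite !sumr_const card_ord -mulrnA -[in RHS]mulr_natl natrM expr2.
apply: le_trans (ler_norm_sum _ _ _) _; apply: ler_sum => i _.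
apply: le_trans (ler_norm_sum _ _ _) _; apply: ler_sum => j _.
pose b x := beta * s * (c * (s `^ p)^-1 * `|stress i j x| `^ p + cvl k Psi x).
have I1 := integrable_cstM (c * (s `^ p)^-1) (stress_powR_integrable i j).
have Ib : I b by apply: integrable_cstM; exact: integrableDr.
have sb x : `|stress i j x * cvl k (fun y => S y i j) x| <= b x.
  by rewrite normrM; exact: gauge.
apply: (@le_trans _ _ (\int[mu]_x b x)).
  apply: Rintegral_norm_le => //; apply: integrable_le sb Ib.
  apply: measurable_funM; first exact: measurable_stress.
  have -> : cvl k (fun y => S y i j) =
      fun x => (mollify_jacobian u k x i j + mollify_jacobian u k x j i) / 2.
    by apply/funext => x; rewrite (mollify_sym_gradient su mk uS).
  by apply: measurable_funM => //; apply: measurable_funD; exact: (measurable_mollify_jacobian su mk).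
rewrite /b RintegralZl//; last exact: integrableDr.
rewrite RintegralD// RintegralZl//; last exact: stress_powR_integrable.
rewrite intc /B ler_wpM2l ?mulr_ge0 ?(ltW s0)// lerD2r ler_wpM2l//.
by rewrite mulr_ge0 ?invr_ge0 ?powR_ge0.
Qed.

End gauge.
End one_kernel.
End flux_estimate.

(** * The pairing of [L^p] with [L^exp], and the two instances of the gauge *)

Section young.
Context {R : realType}.

(** The two terms cover two regimes. If [c] is at most [4 / sigma * s ^ (sigma / 2)], the first one
    suffices; otherwise [c] is so large that [s <= exp (c / 2)], and the exponential absorbs the
    product. *)
Lemma young_expR (sigma s c : R) : 0 < sigma -> 0 <= s -> 0 <= c ->
  s * c <= 4 / sigma * s `^ (1 + sigma / 2) + 2 * (expR c - 1).
Proof.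
move=> sg0 s0' c0; have ec0 : 0 <= expR c - 1 by rewrite subr_ge0 -expR0 ler_expR.
have sg4 : 0 <= 4 / sigma by rewrite divr_ge0// ltW.
move: s0'; rewrite le_eqVlt => /predU1P[<-|s0].
  by rewrite mul0r; apply: addr_ge0; apply: mulr_ge0 => //; exact: powR_ge0.
have e1 : 1 <= expR (c / 2) by rewrite -expR0 ler_expR divr_ge0.
have ec : expR c = expR (c / 2) ^+ 2.
  by rewrite -expRM_natl mulrCA mulfV ?mulr1 ?pnatr_eq0.
have h0 : 0 < 1 + sigma / 2 by rewrite addr_gt0 ?divr_gt0.
have P : s * s `^ (sigma / 2) = s `^ (1 + sigma / 2).
  by rewrite -(mulr_powRB1 (ltW s0) h0) addrAC subrr add0r.
have [cs|sc] := leP c (4 / sigma * s `^ (sigma / 2)).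
  apply: (@le_trans _ _ (4 / sigma * s `^ (1 + sigma / 2))).
    by rewrite -P mulrCA ler_wpM2l ?(ltW s0).
  by rewrite lerDl mulr_ge0// subr_ge0 -expR0 ler_expR.
(* The bound [ln x < x] at [x = s ^ (sigma / 2)] puts [sigma / 2 * ln s] below [sigma / 4 * c]; this
   fixes the constant [4 / sigma]. *)
have lns : ln s <= c / 2.
  have := ln_sublinear (powR_gt0 (sigma / 2) s0); rewrite ln_powR => h1.
  have h2 : s `^ (sigma / 2) < sigma / 4 * c.
    by rewrite -[sigma / 4]invf_div ltr_pdivlMl// divr_gt0.
  have h3 : sigma / 2 * ln s < sigma / 2 * (c / 2) by lra.
  by move: h3; rewrite ltr_pM2l ?divr_gt0// => /ltW.
have se : s <= expR (c / 2) by rewrite -(lnK s0) ler_expR.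
have ce := expR_ge1Dx (c / 2).
apply: (@le_trans _ _ (2 * (expR c - 1))); last by rewrite lerDr mulr_ge0 ?powR_ge0// divr_ge0// ltW.
(* With [x = expR (c / 2)], the inequality [c <= 2 (x - 1)] gives
   [x c <= 2 x (x - 1) <= 2 (x^2 - 1)], since [x >= 1]. *)
rewrite ec; apply: (@le_trans _ _ (expR (c / 2) * c)); first by rewrite ler_wpM2r.
by set x := expR (c / 2) in e1 ce *; nra.
Qed.

End young.

Section gauges.
Context {R : realType} {d : nat}.
Local Notation E := 'rV[R]_d.
Local Notation mu := (leb d : {sigma_finite_measure set E -> \bar R}).
Local Notation I f := (mu.-integrable setT (EFin \o f)).
Variables (r : R) (k : E -> R) (S : E -> 'M[R]_d).
Hypothesis mk : mollifier r k.

Let kge0 := mollifier_ge0 mk.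

Lemma gauge_exp (sigma beta : R) : 0 < sigma -> 0 < beta -> measurable_fun setT S ->
  (Orlicz_int beta S < +oo)%E ->
  let Psi x := 2 * Orlicz_psi (enorm (S x) / beta) in
  [/\ I Psi, forall x, 0 <= Psi x &
  forall x i j t s, 0 <= t -> 0 < s ->
  t * `|cvl k (fun y => S y i j) x| <= beta * s *
    (4 / sigma * (s `^ (1 + sigma / 2))^-1 * t `^ (1 + sigma / 2) + cvl k Psi x)].
Proof.
move=> sg0 b0 mS Soo Psi.
have mij i j : measurable_fun setT (fun x => S x i j) := measurableT_comp (measurable_entry i j) mS.
have psi0 x : 0 <= Orlicz_psi (enorm (S x) / beta).
  by rewrite subr_ge0 -expR0 ler_expR divr_ge0 ?enorm_ge0// ltW.
have Psi0 x : 0 <= Psi x by rewrite mulr_ge0.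
have mpsi : measurable_fun setT (fun x => Orlicz_psi (enorm (S x) / beta)).
  apply: measurable_funB => //; apply: measurableT_comp => //.
  by apply: measurable_funM => //; exact: measurable_enorm.
have IPsi : I Psi by apply: integrable_cstM; apply: integrable_ge0.
have c0 : 0 <= 4 / sigma by rewrite divr_ge0// ltW.
split => // x i j t s t0 s0; set q := 1 + sigma / 2.
(* Young's inequality at [t / s] and [enorm (S y) / beta], multiplied by [beta * s]. *)
have key y : t * `|S y i j| <= beta * s * (4 / sigma * (s `^ q)^-1 * t `^ q + Psi y).
  have := young_expR sg0 (divr_ge0 t0 (ltW s0)) (divr_ge0 (enorm_ge0 (S y)) (ltW b0)).
  have -> : (t / s) `^ (1 + sigma / 2) = (s `^ q)^-1 * t `^ q.
    rewrite powRM ?invr_ge0 ?(ltW s0)// mulrC -[s^-1]powR_inv1 ?(ltW s0)//.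
    by rewrite -powRrM mulN1r powRN.
  rewrite mulrA => h.
  apply: (@le_trans _ _ (beta * s * (t / s * (enorm (S y) / beta)))).
    rewrite (_ : beta * s * _ = t * enorm (S y)); last by field; rewrite !gt_eqF.
    by rewrite ler_wpM2l// norm_entry_le_enorm.
  rewrite ler_wpM2l ?mulr_ge0 ?(ltW s0) ?(ltW b0)//.
have IkPsi : I (fun y => k (x - y) * Psi y) := integrable_kernel_mul mk x IPsi.
have Ib : I (fun y => k (x - y) * (beta * s * (4 / sigma * (s `^ q)^-1 * t `^ q + Psi y))).
  have := integrable_cstM (beta * s)
    (integrableDr (integrable_cstM (4 / sigma * (s `^ q)^-1 * t `^ q) (integrable_kernel mk x)) IkPsi).
  by apply: eq_integrable => // y _ /=; congr EFin; ring.
(* The integrability of [S] against the kernel is drawn from the modular: [c <= exp(c) - 1] bounds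
   its entries by [beta * Psi]. *)
have IkS : I (fun y => k (x - y) * S y i j).
  apply: (@integrable_kernel_le _ _ r k mk x _ (fun y => beta * Psi y)) => //.
    move=> y; have le1 := norm_entry_le_enorm (S y) i j.
    have := expR_ge1Dx (enorm (S y) / beta); rewrite -lerBrDl ler_pdivrMr// => h.
    have := mulr_ge0 (ltW b0) (psi0 y); rewrite /Psi /Orlicz_psi in h *; lra.
  have := integrable_cstM beta IkPsi; apply: eq_integrable => // y _ /=; congr EFin; ring.
rewrite /cvl -[t in t * _](ger0_norm t0) -normrM -RintegralZl//.
apply: (@le_trans _ _ (\int[mu]_y (k (x - y) * (beta * s * (4 / sigma * (s `^ q)^-1 * t `^ q + Psi y))))).
  apply: Rintegral_norm_le => //; first exact: integrable_cstM.
  move=> y; rewrite mulrCA normrM (ger0_norm (kge0 _)) ler_wpM2l// normrM (ger0_norm t0).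
  exact: key.
under eq_Rintegral => y _ do rewrite mulrCA mulrDr (mulrC (k _) (_ * t `^ q)).
have I1 := integrable_cstM (4 / sigma * (s `^ q)^-1 * t `^ q) (integrable_kernel mk x).
rewrite RintegralZl//; last exact: integrableDr.
rewrite RintegralD// RintegralZl//; last exact: integrable_kernel mk x.
by rewrite (Rintegral_kernel mk) mulr1.
Qed.

(** The right-hand side is just [beta * t]; the exponents 1, the factor [1] and the null convolution
    present it as the hypothesis [gauge] for [p = 1], [c = 1] and zero [Psi]. *)
Lemma gauge_bounded (beta : R) : 0 <= beta -> measurable_fun setT S ->
  {ae mu, forall x, enorm (S x) <= beta} ->
  forall x i j t s, 0 <= t -> 0 < s ->
  t * `|cvl k (fun y => S y i j) x| <= beta * s *
    (1 * (s `^ 1)^-1 * t `^ 1 + cvl k (fun=> 0) x).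
Proof.
move=> b0 mS aeS x i j t s t0 s0.
have mij : measurable_fun setT (fun x => S x i j) := measurableT_comp (measurable_entry i j) mS.
have mkx : measurable_fun setT (fun y : E => k (x - y)).
  exact: measurableT_comp (mollifier_measurable mk) (measurable_subl x).
have mkS : measurable_fun setT (fun y : E => k (x - y) * S y i j) by exact: measurable_funM.
have le1 : (\int[mu]_y `|(k (x - y) * S y i j)%:E| <= beta%:E)%E.
  apply: (@le_trans _ _ (\int[mu]_y (beta%:E * (k (x - y))%:E))%E).
    apply: ae_ge0_le_integral => //.
    - by apply: measurableT_comp => //; exact/measurable_EFinP.
    - by move=> y _; rewrite -EFinM lee_fin mulr_ge0.
    - by apply/measurable_EFinP; apply: measurable_funM.
    apply: filterS aeS => y Sy _; rewrite -EFinM lee_fin normrM (ger0_norm (kge0 _)) mulrC.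
    by rewrite ler_wpM2r// (le_trans (norm_entry_le_enorm _ _ _)).
  rewrite ge0_integralZl_EFin//; last 2 first.
  - by move=> y _; rewrite lee_fin.
  - exact/measurable_EFinP.
  by rewrite (kernel_mass mk) mule1.
have IkS : I (fun y => k (x - y) * S y i j).
  apply/integrableP; split; first exact/measurable_EFinP.
  exact: le_lt_trans le1 (ltry _).
have h : `|cvl k (fun y => S y i j) x| <= beta.
  apply: le_trans (le_normr_Rintegral measurableT IkS) _.
  by rewrite -lee_fin EFin_Rintegral//; exact: integrable_normr.
rewrite !powRr1 ?(ltW s0)// mul1r /cvl; under [X in _ + X]eq_Rintegral => y _ do rewrite mulr0.
rewrite /Rintegral integral0 addr0 -mulrA mulVKf ?gt_eqF// mulrC ler_wpM2r//.
Qed.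

End gauges.

Section vanishing_flux.
Context {R : realType} {d : nat}.
Local Notation E := 'rV[R]_d.
Local Notation mu := (leb d : {sigma_finite_measure set E -> \bar R}).
Local Notation I f := (mu.-integrable setT (EFin \o f)).
Variables (u : E -> E) (p : R).
Hypothesis su : forall i, sq_integrable (fun x => u x 0 i).
Hypothesis p1 : 1 <= p.
Hypothesis Iq : forall i, I (fun x => `|u x 0 i| `^ (2 * p)).
Variable K : nat -> E -> R.
Hypothesis mK : forall n, mollifier (n.+1%:R^-1) (K n).

Let p0 : 0 < p. Proof. exact: lt_le_trans ltr01 p1. Qed.
Let q1 : 1 <= 2 * p. Proof. by rewrite (le_trans p1)// ler_peMl ?(ltW p0)// ler1n. Qed.

Lemma stress_powR_cvg (e : R) : 0 < e ->
  \forall n \near \oo, forall i j, \int[mu]_x (`|stress u (K n) i j x| `^ p) <= e.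
Proof.
move=> e0; pose M := \sum_i \int[mu]_x (`|u x 0 i| `^ (2 * p)).
have m0 i : 0 <= \int[mu]_x (`|u x 0 i| `^ (2 * p)).
  by apply: Rintegral_ge0 => x _; exact: powR_ge0.
have uM i : \int[mu]_x (`|u x 0 i| `^ (2 * p)) <= M.
  by rewrite /M (bigD1 i)//= lerDl sumr_ge0.
have M0 : 0 <= M by exact: sumr_ge0.
pose A := (1 + 2 `^ (2 * p)) * M.
have A0 : 0 <= A by rewrite mulr_ge0// addr_ge0// powR_ge0.
pose C : R := 3 `^ p; have C0 : 0 < C by rewrite powR_gt0.
have CA0 : 0 < C * A + 1 by rewrite ltr_wpDl// mulr_ge0// ltW.
(* This weight keeps the [t] term of [stress_powR_Rintegral] below [e / 2]; once it is fixed, [e']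
   makes the two [t^-1] terms share the other half. Adding 1 avoids a division by zero. *)
pose t := e / (2 * (C * A + 1)); have t0 : 0 < t by rewrite divr_gt0// mulr_gt0.
pose e' := e * t / (4 * C); have e'0 : 0 < e' by rewrite divr_gt0// mulr_gt0.
have : \forall n \near \oo, forall i,
    \int[mu]_x (`|u x 0 i - cvl (K n) (fun y => u y 0 i) x| `^ (2 * p)) <= e'.
  by apply: filter_forall => i; exact: (mollify_powR_cvg mK q1 (su i) (Iq i) e'0).
apply: filterS => n hn i j.
have := stress_powR_Rintegral su p1 Iq (mK n) i j t0 uM.
rewrite -/A -/C => /le_trans; apply.
have h : t^-1 * (\int[mu]_x (`|u x 0 j - cvl (K n) (fun y => u y 0 j) x| `^ (2 * p)) +
    \int[mu]_x (`|u x 0 i - cvl (K n) (fun y => u y 0 i) x| `^ (2 * p))) <= e / (2 * C).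
  apply: (@le_trans _ _ (t^-1 * (e' + e'))).
    by rewrite ler_wpM2l ?invr_ge0 ?(ltW t0)// lerD.
  by rewrite (_ : t^-1 * (e' + e') = e / (2 * C))// /e'; field; rewrite !gt_eqF.
apply: (@le_trans _ _ (C * (t * A + e / (2 * C)))); first by rewrite ler_pM2l// lerD2l.
rewrite mulrDr (_ : C * (e / (2 * C)) = e / 2); last by field; rewrite gt_eqF.
rewrite [leRHS](splitr e) lerD2r.
rewrite (_ : C * (t * A) = e / 2 * (C * A / (C * A + 1))); last first.
  by rewrite /t; field; rewrite gt_eqF.
by rewrite ler_piMr ?divr_ge0 ?(ltW e0)// ler_pdivrMr// mul1r lerDl.
Qed.

Variables (S : E -> 'M[R]_d) (Psi : E -> R) (beta c : R).
Hypothesis div_u : forall q g, W12 q g -> \int[mu]_x mxdot (u x) (g x) = 0.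
Hypothesis uS : is_sym_gradient u S.
Hypotheses (beta0 : 0 <= beta) (c0 : 0 <= c).
Hypotheses (IPsi : I Psi) (Psi0 : forall x, 0 <= Psi x).
Hypothesis gauge : forall n x i j t s, 0 <= t -> 0 < s ->
  t * `|cvl (K n) (fun y => S y i j) x| <= beta * s * (c * (s `^ p)^-1 * t `^ p + cvl (K n) Psi x).

Lemma flux_cvg0 : flux u (K n) u @[n --> \oo] --> 0.
Proof.
apply/cvgr0Pnorm_le => e e0.
have r0 n : 0 < n.+1%:R^-1 :> R by rewrite invr_gt0.
pose D : R := d%:R ^+ 2 * beta; have D0 : 0 <= D by rewrite mulr_ge0// sqr_ge0.
pose P := \int[mu]_x Psi x; have P0 : 0 <= P by apply: Rintegral_ge0 => x _; exact: Psi0.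
have DP : 0 < D * P + 1 by rewrite ltr_wpDl// mulr_ge0.
(* For this [s] the modular term is at most [e / 2] whatever [n]; only then is [n] taken large, to
   beat the factor [B], which depends on [s]. *)
pose s := e / (2 * (D * P + 1)); have s0 : 0 < s by rewrite divr_gt0// mulr_gt0.
pose B := D * s * (c * (s `^ p)^-1).
have B0 : 0 <= B by rewrite /B mulr_ge0 ?(mulr_ge0 D0 (ltW s0))// mulr_ge0// invr_ge0 powR_ge0.
have B1 : 0 < B + 1 by rewrite ltr_wpDl.
have A0 : 0 < e / (2 * (B + 1)) by rewrite divr_gt0// mulr_gt0.
apply: filterS (stress_powR_cvg A0) => n hn.
apply: le_trans (flux_le su p1 Iq (r0 n) (mK n) div_u uS beta0 c0 IPsi Psi0 (gauge n) s0 hn) _.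
rewrite -/P; set A := e / _.
rewrite (_ : _ * _ = B * A + D * s * P); last by rewrite /B /D; ring.
have h1 : B * A <= e / 2.
  rewrite (_ : B * A = e / 2 * (B / (B + 1))); last by rewrite /A; field; rewrite gt_eqF.
  by rewrite ler_piMr ?divr_ge0 ?(ltW e0)// ler_pdivrMr// mul1r lerDl.
have h2 : D * s * P <= e / 2.
  rewrite (_ : D * s * P = e / 2 * (D * P / (D * P + 1))); last by rewrite /s; field; rewrite gt_eqF.
  by rewrite ler_piMr ?divr_ge0 ?(ltW e0)// ler_pdivrMr// mul1r lerDl.
by lra.
Qed.

End vanishing_flux.

(** * The energy balance of the mollified field *)

Section time_lemmas.
Context {R : realType}.
Local Notation leb1 := (@lebesgue_measure R).

(** A null set contains no nonempty open interval, so the times where [P] holds are dense in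
    [[0, T]]. Along such sequences, facts known at almost every time extend to every time by
    continuity. *)
Lemma ae_sequence (T t : R) (P : R -> Prop) : 0 < T -> t \in `[0, T] ->
  {ae leb1, forall s : R, s \in `]0, T[ -> P s} ->
  exists s : nat -> R, (forall n, (s n \in `]0, T[) /\ P (s n)) /\ (s @ \oo --> t).
Proof.
move=> T0 /[!in_itv]/= /andP[t0 tT] [N [mN N0 PN]].
have ex n : exists s, ((s \in `]0, T[) /\ P s) /\ `|t - s| <= n.+1%:R^-1.
  have e0 : 0 < n.+1%:R^-1 :> R by rewrite invr_gt0.
  apply: contrapT => hn; pose a := Num.max 0 (t - n.+1%:R^-1); pose b := Num.min T (t + n.+1%:R^-1).
  have ab : a < b.
    rewrite /a /b; move: (n.+1%:R^-1) e0 => e e0.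
    by rewrite lt_min !gt_max; do ?[apply/andP; split]; lra.
  have sub : `]a, b[%classic `<=` N.
    move=> s /=; rewrite in_itv/= /a /b gt_max lt_min => /andP[/andP[s0 s1] /andP[s2 s3]].
    apply: PN => /= Ps; apply: hn; exists s; split; last first.
      rewrite ler_norml; move: (n.+1%:R^-1) s1 s3 => e s1 s3; apply/andP; split; lra.
    have sT : s \in `]0, T[ by rewrite in_itv/= s0 s2.
    by split => //; exact: Ps.
  have : (leb1 `]a, b[%classic <= leb1 N)%E by apply: le_measure; rewrite ?inE//; exact: measurable_itv.
  by rewrite N0 lebesgue_measure_itv/= lte_fin ab -EFinB lee_fin subr_le0 leNgt ab.
have [s hs] := choice ex; exists s; split; first by move=> n; case: (hs n).
apply/cvgrPdist_le => e e0.
have [m _ hm] : \forall n \near \oo, n.+1%:R^-1 <= e :> R.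
  by have /cvgr0Pnorm_le/(_ _ e0) := @cvg_harmonic R; apply: filterS => n /=;
    apply: le_trans; exact: ler_norm.
exists m => // n mn; apply: le_trans (hs n).2 _; exact: hm.
Qed.

Lemma within_cvg_sequence (T t : R) (f : R -> R) (s : nat -> R) :
  {within `[0, T], continuous f} -> t \in `[0, T] -> (forall n, s n \in `[0, T]) ->
  s @ \oo --> t -> f (s n) @[n --> \oo] --> f t.
Proof.
move=> /subspace_continuousP cf tT sT st.
apply: cvg_trans (cf t tT); move=> A; rewrite /within/= => hA.
have hB : nbhs t [set x | `[0, T]%classic x -> A (f x)] := hA.
have hs : \forall n \near \oo, `[0, T]%classic (s n) -> A (f (s n)) := st _ hB.
by apply: filterS hs => n h; apply: h; exact: sT.
Qed.

(* Half-open, so that the indicators of the intervals of a partition add up. *)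
Definition itv_indic (a b r : R) : R := ((a <= r < b)%R : bool)%:R.

Lemma itv_indicE (a b : R) : itv_indic a b = \1_[set` `[a, b[] :> (R -> R).
Proof.
apply/funext => r; rewrite /itv_indic indicE; congr (_%:R); congr nat_of_bool.
by apply/idP/idP => [h|]; rewrite ?inE/= in_itv/=//; rewrite mem_set//= in_itv.
Qed.

Lemma measurable_itv_indic (a b : R) : measurable_fun setT (itv_indic a b).
Proof. by rewrite itv_indicE; exact: measurable_indic. Qed.

Lemma integrable_itv_indic (a b : R) : leb1.-integrable setT (EFin \o itv_indic a b).
Proof.
apply: integrable_ge0; [exact: measurable_itv_indic|by move=> r; rewrite ler0n|].
rewrite itv_indicE integral_indic// setIT.
by rewrite /= lebesgue_measure_itv/=; case: ifP => _; rewrite ?ltry// -EFinB ltry.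
Qed.

Lemma itv_indicB (a b r : R) : 0 <= a -> a <= b -> itv_indic a b r = itv_indic 0 b r - itv_indic 0 a r.
Proof.
rewrite /itv_indic => a0 ab; have [ar|ra] := leP a r; have [rb|br] := ltP r b; have [r0|r0] := leP 0 r;
  rewrite /= ?subr0 ?subrr//; try lra.
Qed.

Lemma itv_indic_le (a b r : R) : 0 <= itv_indic a b r <= 1.
Proof. by rewrite /itv_indic ler0n lern1 leq_b1. Qed.

Section bounded_time_function.
Variables (f : R -> R) (C : R).
Hypotheses (mf : measurable_fun setT f) (fC : forall r, `|f r| <= C).

Lemma integrable_itv_mul (a b : R) : leb1.-integrable setT (EFin \o (fun r => itv_indic a b r * f r)).
Proof. exact: integrable_bounded_mul (integrable_itv_indic a b) mf fC. Qed.

Lemma Rintegral_itv_indic (t : R) :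
  \int[leb1]_(r in `[0, t]) f r = \int[leb1]_r (itv_indic 0 t r * f r).
Proof.
have E0 : \int[leb1]_(r in `[0, t[) f r = \int[leb1]_r (itv_indic 0 t r * f r).
  rewrite Rintegral_mkcond; apply: eq_Rintegral => r _.
  by rewrite itv_indicE patchE indicE; case: ifP; rewrite ?mul1r ?mul0r.
rewrite -E0 Rintegral_itv_bndo_bndc//.
rewrite integrable_mkcond//; have := integrable_itv_mul 0 t.
apply: eq_integrable => // r _ /=; rewrite patchE itv_indicE indicE.
by case: ifP; rewrite ?mul1r ?mul0r.
Qed.

Lemma Rintegral_itv_indic_lipschitz (a b : R) : 0 <= a -> a <= b ->
  `|\int[leb1]_r (itv_indic 0 b r * f r) - \int[leb1]_r (itv_indic 0 a r * f r)| <= C * (b - a).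
Proof.
move=> a0 ab; rewrite -RintegralB//; last 2 first.
- exact: integrable_itv_mul.
- exact: integrable_itv_mul.
under eq_Rintegral => r _ do rewrite -mulrBl -itv_indicB//.
have -> : C * (b - a) = \int[leb1]_r (C * itv_indic a b r).
  rewrite RintegralZl//; last exact: integrable_itv_indic.
  congr (_ * _); apply: EFin_inj; rewrite EFin_Rintegral; last exact: integrable_itv_indic.
  rewrite itv_indicE integral_indic// setIT /= lebesgue_measure_itv/= lte_fin.
  by move: ab; rewrite le_eqVlt => /predU1P[->|->]; rewrite ?ltxx ?subrr ?EFinB.
apply: Rintegral_norm_le.
- exact: integrable_itv_mul.
- by apply: integrable_cstM; exact: integrable_itv_indic.
by move=> r; have /andP[i0 _] := itv_indic_le a b r; rewrite normrM (ger0_norm i0) mulrC ler_wpM2r.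
Qed.

Lemma Rintegral_itv_indic_cvg (t : R) (s : nat -> R) : s @ \oo --> t -> (forall n, 0 <= s n) -> 0 <= t ->
  \int[leb1]_r (itv_indic 0 (s n) r * f r) @[n --> \oo] --> \int[leb1]_r (itv_indic 0 t r * f r).
Proof.
move=> /cvgrPdist_le st s0 t0; have C0 : 0 <= C by exact: le_trans (fC 0).
apply/cvgrPdist_le => e e0; have C1 : 0 < C + 1 by rewrite ltr_wpDl.
apply: filterS (st _ (divr_gt0 e0 C1)) => n hn.
have : C * `|t - s n| <= e.
  apply: (@le_trans _ _ (C * (e / (C + 1)))); first by rewrite ler_wpM2l.
  rewrite (_ : C * _ = e * (C / (C + 1))); last by field; rewrite gt_eqF.
  by rewrite ler_piMr ?(ltW e0)// ler_pdivrMr// mul1r lerDl.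
apply: le_trans; have [h|h] := leP (s n) t.
  by rewrite [`|t - _|]ger0_norm ?subr_ge0//; exact: Rintegral_itv_indic_lipschitz.
rewrite distrC [`|t - _|]distrC [`|s n - t|]gtr0_norm ?subr_gt0//.
exact: Rintegral_itv_indic_lipschitz t0 (ltW h).
Qed.

End bounded_time_function.

(* A Riemann sum of indicators, written as a sum over a partition into
   [n.+1] half-open intervals, selects one term. *)
Lemma partition_select (tau r : R) (n : nat) (a : nat -> R) : 0 < tau ->
  \sum_(i < n.+1) itv_indic (i%:R * tau / n.+1%:R) (i.+1%:R * tau / n.+1%:R) r * a i =
  itv_indic 0 tau r * a (Num.truncn (r * n.+1%:R / tau)).
Proof.
move=> tau0; set m := Num.truncn _.
have n0 : 0 < n.+1%:R :> R by [].
have E i : itv_indic (i%:R * tau / n.+1%:R) (i.+1%:R * tau / n.+1%:R) r =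
   ((i%:R <= r * n.+1%:R / tau < i.+1%:R)%R : bool)%:R.
  by rewrite /itv_indic ler_pdivrMr// ltr_pdivlMr// ler_pdivlMr// ltr_pdivrMr.
have [r0|r0] := ltP r 0.
  rewrite [itv_indic 0 tau r](_ : _ = 0) ?mul0r; last by rewrite /itv_indic leNgt r0.
  rewrite big1// => i _; rewrite E (_ : (i%:R <= _) = false) ?mul0r//; apply/negbTE; rewrite -ltNge.
  by rewrite (lt_le_trans _ (ler0n _ _))// pmulr_llt0 ?invr_gt0// pmulr_llt0.
have x0 : 0 <= r * n.+1%:R / tau by rewrite !mulr_ge0// invr_ge0 ltW.
have E2 i : itv_indic (i%:R * tau / n.+1%:R) (i.+1%:R * tau / n.+1%:R) r = (m == i)%:R.
  by rewrite E; congr (_%:R); congr nat_of_bool; apply/idP/eqP => [/truncn_def//|<-]; exact: truncn_itv.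
have [rt|tr] := ltP r tau.
  have mn : (m < n.+1)%N.
    by rewrite -(ltr_nat R) (le_lt_trans (proj1 (andP (truncn_itv x0))))// ltr_pdivrMr// mulrC ltr_pM2l.
  rewrite (bigD1 (Ordinal mn))//= E2 eqxx mul1r big1 ?addr0.
    by rewrite /itv_indic r0 rt mul1r.
  by move=> i; rewrite -val_eqE/= eq_sym E2 => /negbTE ->; rewrite mul0r.
rewrite [itv_indic 0 tau r](_ : _ = 0) ?mul0r; last by rewrite /itv_indic r0 ltNge tr.
rewrite big1// => i _; rewrite E2; case: eqP => [mi|]; rewrite ?mul0r//.
have := truncn_itv x0; rewrite -/m mi => /andP[_].
rewrite ltr_pdivrMr// => h; have : i.+1%:R <= n.+1%:R :> R by rewrite ler_nat.
by move=> h2; exfalso; move: (n.+1%:R) (i.+1%:R) n0 h h2 => N I' N0 h h2; nra.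
Qed.

End time_lemmas.

Section mollify_symmetry.
Context {R : realType} {d : nat}.
Local Notation E := 'rV[R]_d.
Local Notation mu := (leb d : {sigma_finite_measure set E -> \bar R}).
Local Notation I f := (mu.-integrable setT (EFin \o f)).
Variables (r : R) (k : E -> R).
Hypothesis mk : mollifier r k.

(** Fubini and the evenness of [k]. Absolute integrability comes from bounding [|f(x) g(y)|] by
    [f(x)^2 + g(y)^2], whose [pair_average] is finite by the marginal identities. *)
Lemma cvl_symmetric (f g : E -> R) : sq_integrable f -> sq_integrable g ->
  \int[mu]_x (f x * cvl k g x) = \int[mu]_x (g x * cvl k f x).
Proof.
move=> sf sg; have [C _ kC] := mollifier_ball mk.
have mf2 : measurable_fun setT (fun x => f x ^+ 2) by apply: measurable_funX; exact: sf.1.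
have mg2 : measurable_fun setT (fun x => g x ^+ 2) by apply: measurable_funX; exact: sg.1.
have Ikf x : I (fun y => k (x - y) * f y) := integrable_cvl (mollifier_measurable mk) kC sf x.
have Ikg x : I (fun y => k (x - y) * g y) := integrable_cvl (mollifier_measurable mk) kC sg x.
pose F x y := f x * (k (x - y) * g y).
have mF : measurable_fun setT (fun z : E * E => F z.1 z.2).
  apply: measurable_funM; first exact: measurable_fst_fun sf.1.
  by apply: measurable_funM; [exact: measurable_kernel mk|exact: measurable_snd_fun sg.1].
have IF : (mu \x mu)%E.-integrable setT (fun z : E * E => (F z.1 z.2)%:E).
  apply: (@integrable_le _ _ _ _ _ (fun z : E * E => k (z.1 - z.2) * (f z.1 ^+ 2 + g z.2 ^+ 2))) => //.
    move=> z; rewrite /F mulrCA normrM (ger0_norm (mollifier_ge0 mk _)) ler_wpM2l ?(mollifier_ge0 mk)//.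
    rewrite normrM -(real_normK (num_real (f z.1))) -(real_normK (num_real (g z.2))).
    have := sqr_ge0 (`|f z.1| - `|g z.2|); have := mulr_ge0 (normr_ge0 (f z.1)) (normr_ge0 (g z.2)).
    by move: (`|f z.1|) (`|g z.2|) => a b; nra.
  apply: integrable_ge0.
  - apply: measurable_funM; first exact: measurable_kernel mk.
    by apply: measurable_funD; [exact: measurable_fst_fun mf2|exact: measurable_snd_fun mg2].
  - by move=> z; rewrite mulr_ge0 ?(mollifier_ge0 mk)// addr_ge0// sqr_ge0.
  rewrite -[X in (X < _)%E]/(pair_average k (fun x y => f x ^+ 2 + g y ^+ 2)).
  rewrite (pair_averageD mk); last 4 first.
  - exact: measurable_fst_fun mf2.
  - exact: measurable_snd_fun mg2.
  - by move=> x y; exact: sqr_ge0.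
  - by move=> x y; exact: sqr_ge0.
  rewrite (pair_average_fst mk mf2) ?(pair_average_snd mk mg2); try by move=> x; exact: sqr_ge0.
  by rewrite lte_add_pinfty//; [exact: integrable_lty sf.2|exact: integrable_lty sg.2].
have := @Rintegral_fubini _ _ _ _ _ mu mu F IF.
have IF1 x : I (F x) by exact: integrable_cstM (Ikg x).
have IF2 y : I (F ^~ y).
  have := integrable_cstM (g y) (Ikf y); apply: eq_integrable => // x _ /=.
  by rewrite /F (mollifier_sym mk); congr EFin; ring.
move=> /(_ IF1 IF2) => h.
transitivity (\int[mu]_x \int[mu]_y F x y).
  by apply: eq_Rintegral => x _; rewrite /F RintegralZl.
rewrite h; apply: eq_Rintegral => y _; rewrite /cvl -RintegralZl//.
by apply: eq_Rintegral => x _; rewrite /F (mollifier_sym mk); ring.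
Qed.

Lemma cvl_sq_integrable (f : E -> R) : 0 < r -> sq_integrable f -> sq_integrable (cvl k f).
Proof.
move=> r0 sf; have [D _ kD] := mollifier_ball mk.
apply: (@sq_integrable_le _ _ _ (ball_mass f r) D).
- exact: (measurable_cvl (mollifier_measurable mk) sf).
- exact: integrable_ball_mass_sq.
- exact: (cvl_le (mollifier_measurable mk) kD sf).
Qed.

Lemma mollify_mxdotE (u w : E -> E) : 0 < r ->
  (forall i, sq_integrable (fun x => u x 0 i)) -> (forall i, sq_integrable (fun x => w x 0 i)) ->
  \int[mu]_x mxdot (u x) (mollify w k x) =
  \sum_i \int[mu]_x (u x 0 i * cvl k (fun y => w y 0 i) x).
Proof.
move=> r0 su sw; rewrite -Rintegral_sumr.
  by apply: eq_Rintegral => x _; rewrite mxdot_row; apply: eq_bigr => i _; rewrite mxE.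
by move=> i; apply: sq_integrable_mul => //; exact: cvl_sq_integrable.
Qed.

Lemma mollify_symmetric (u w : E -> E) : 0 < r ->
  (forall i, sq_integrable (fun x => u x 0 i)) -> (forall i, sq_integrable (fun x => w x 0 i)) ->
  \int[mu]_x mxdot (u x) (mollify w k x) = \int[mu]_x mxdot (w x) (mollify u k x).
Proof.
move=> r0 su sw; rewrite (mollify_mxdotE r0 su sw) (mollify_mxdotE r0 sw su).
by apply: eq_bigr => i _; exact: (cvl_symmetric (su i) (sw i)).
Qed.

End mollify_symmetry.

(** * Evolution of the mollified energy for a fixed kernel *)

Section evolution.
Context {R : realType} {d : nat}.
Local Notation E := 'rV[R]_d.
Local Notation mu := (leb d : {sigma_finite_measure set E -> \bar R}).
Local Notation leb1 := (@lebesgue_measure R).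
Local Notation I f := (mu.-integrable setT (EFin \o f)).
Variables (T M : R) (V : R -> E -> E).
Hypothesis mV : forall i, measurable_fun setT
  (fun z : measurableTypeR R * E => V z.1 z.2 0 i).
Hypothesis sV : forall t i, sq_integrable (fun x => V t x 0 i).
Hypothesis VM : forall t i, \int[mu]_x (V t x 0 i ^+ 2) <= M.
Hypothesis wV : forall (t : R) (s : nat -> R) (g : E -> E), t \in `[0, T] ->
  (forall n, s n \in `[0, T]) -> s @ \oo --> t ->
  (forall i, sq_integrable (fun x => g x 0 i)) ->
  \int[mu]_x mxdot (V (s n) x) (g x) @[n --> \oo] --> \int[mu]_x mxdot (V t x) (g x).

Section one_kernel.
Variables (r : R) (k : E -> R).
Hypotheses (r0 : 0 < r) (mk : mollifier r k).
Hypothesis momentum : forall s t : R, s \in `[0, T] -> t \in `[0, T] ->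
  \int[leb1]_(q in `[0, t]) flux (V q) k (V s) =
  \int[mu]_x mxdot (V t x) (mollify (V s) k x) -
  \int[mu]_x mxdot (V 0 x) (mollify (V s) k x).

Lemma jacobian_uniform_bound : exists2 N : R, 0 <= N & forall s x i j,
  `|mollify_jacobian (V s) k x i j| <= N.
Proof.
have [C [rho [C0 rho0 _ ck]]] := test_function_kernel (mollifier_test0 mk).
exists (C * (@ball_volume R d rho * `|M| + 1)) => [|s x i j].
  by rewrite mulr_ge0// addr_ge0// mulr_ge0// ltW// ball_volume_gt0.
rewrite mxE; apply: le_trans (controlled_derive_le (cvl_controlled rho0 (sV s i) (ck j)) x) _.
rewrite ler_wpM2l// (le_trans (ball_mass_le (sV s i) rho0 x))// lerD2r.
apply: ler_wpM2l; first by apply/ltW; exact: ball_volume_gt0.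
exact: le_trans (VM s i) (ler_norm _).
Qed.

Lemma flux_uniform_bound : exists2 N : R, 0 <= N & forall s t, `|flux (V t) k (V s)| <= N.
Proof.
have [N N0 JN] := jacobian_uniform_bound.
pose B := N * (`|M| + `|M|); have B0 : 0 <= B by rewrite mulr_ge0// addr_ge0.
exists (\sum_(i < d) \sum_(j < d) B) => [|s t]; first by do 2![apply: sumr_ge0 => ? _].
apply: le_trans (ler_norm_sum _ _ _) _; apply: ler_sum => i _.
apply: le_trans (ler_norm_sum _ _ _) _; apply: ler_sum => j _.
have Iuu := sq_integrable_mul (sV t i) (sV t j).
have Iss := integrableDr (sV t i).2 (sV t j).2.
apply: (@le_trans _ _ (\int[mu]_x (N * (V t x 0 i ^+ 2 + V t x 0 j ^+ 2)))).
  apply: Rintegral_norm_le.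
  - apply: (integrable_bounded_mul Iuu _ (fun x => JN s x i j)).
    exact: (measurable_mollify_jacobian (sV s) mk).
  - exact: integrable_cstM.
  - move=> x; rewrite normrM mulrC ler_pM//.
    rewrite normrM -(real_normK (num_real (V t x 0 i))) -(real_normK (num_real (V t x 0 j))).
    have := sqr_ge0 (`|V t x 0 i| - `|V t x 0 j|).
    have := mulr_ge0 (normr_ge0 (V t x 0 i)) (normr_ge0 (V t x 0 j)).
    by move: (`|V t x 0 i|) (`|V t x 0 j|) => a b; nra.
rewrite RintegralZl// RintegralD//; last 2 first.
- exact: (sV t i).2.
- exact: (sV t j).2.
by rewrite ler_wpM2l// lerD// (le_trans (VM t _))// ler_norm.
Qed.

Lemma measurable_flux s : measurable_fun setT (fun t => flux (V t) k (V s)).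
Proof.
apply: measurable_sum => i; apply: measurable_sum => j.
apply: (@measurable_Rintegral_snd _ _ (measurableTypeR R) E R mu
  (fun t x => V t x 0 i * V t x 0 j * mollify_jacobian (V s) k x i j)).
apply: measurable_funM; first exact: measurable_funM.
exact: measurableT_comp (measurable_mollify_jacobian (sV s) mk i j) measurable_snd.
Qed.

(** At fixed [x], the entry [(i, j)] of the Jacobian of [k * V(s)] is the pairing of [V(s)] with a
    fixed field [g], whose [i]-th component is [y |-> partial j k (x - y)]. Weak continuity thus
    gives pointwise convergence, and the uniform bound on the Jacobian dominates. *)
Lemma flux_cvg t s (q : nat -> R) : s \in `[0, T] -> (forall n, q n \in `[0, T]) ->
  q @ \oo --> s -> flux (V t) k (V (q n)) @[n --> \oo] --> flux (V t) k (V s).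
Proof.
move=> sT qT qs; have [N N0 JN] := jacobian_uniform_bound.
apply: cvg_big => [|i _]; first exact: add_continuous.
apply: cvg_big => [|j _]; first exact: add_continuous.
have Iuu := sq_integrable_mul (sV t i) (sV t j).
have mF n : measurable_fun setT (fun x => V t x 0 i * V t x 0 j * mollify_jacobian (V (q n)) k x i j).
  apply: measurable_funM; first exact: integrable_measurable Iuu.
  exact: (measurable_mollify_jacobian (sV (q n)) mk).
have Ig : I (fun x => `|V t x 0 i * V t x 0 j| * N).
  by apply: integrable_bounded_mul (integrable_normr Iuu) _ _ => // x; rewrite ger0_norm.
have Fg n x : `|V t x 0 i * V t x 0 j * mollify_jacobian (V (q n)) k x i j| <= `|V t x 0 i * V t x 0 j| * N.
  by rewrite normrM ler_wpM2l.
have cF x : V t x 0 i * V t x 0 j * mollify_jacobian (V (q n)) k x i j @[n --> \oo] -->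
    V t x 0 i * V t x 0 j * mollify_jacobian (V s) k x i j.
  apply: cvgMr.
  have [C [rho [C0 rho0 _ ck]]] := test_function_kernel (mollifier_test0 mk).
  pose g (y : E) : E := \row_l (if l == i then partial j k (x - y) else 0).
  have sg l : sq_integrable (fun y => g y 0 l).
    under eq_fun do rewrite mxE; case: eqP => _.
      apply: (@sq_integrable_le _ _ _ (fun y => ball_indic rho (x - y)) C).
      + exact: measurableT_comp (controlled_measurable_derive (ck j)) (measurable_subl x).
      + split; first exact: measurableT_comp (measurable_ball_indic rho) (measurable_subl x).
        have := integrable_ball rho x; apply: eq_integrable => // y _ /=.
        by case: (ball_indic01 rho (x - y)) => ->; rewrite ?expr0n ?expr1n.
      + by move=> y; exact: controlled_derive_le (ck j) (x - y).
    by split => //; under eq_fun do rewrite expr0n; exact: integrable0.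
  have E1 w : mollify_jacobian w k x i j = \int[mu]_y mxdot (w y) (g y).
    rewrite mxE /cvl; apply: eq_Rintegral => y _.
    rewrite mxdot_row (bigD1 i)//= mxE eqxx big1 ?addr0; first exact: mulrC.
    by move=> l /negbTE li; rewrite mxE li mulr0.
  under eq_fun do rewrite E1; rewrite E1.
  exact: wV.
exact: (cvg_Rintegral_dominated mF cF Ig Fg).2.
Qed.

Definition mollified_energy (t : R) : R := \int[mu]_x mxdot (V t x) (mollify (V t) k x).

Lemma mollified_energy_increment a b : 0 <= a -> a <= b -> b <= T ->
  mollified_energy b - mollified_energy a =
  \int[leb1]_q (itv_indic a b q * (flux (V q) k (V b) + flux (V q) k (V a))).
Proof.
move=> a0 ab bT; have [N N0 FN] := flux_uniform_bound.
have aT : a \in `[0, T] by rewrite in_itv/= a0 (le_trans ab).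
have bT' : b \in `[0, T] by rewrite in_itv/= bT (le_trans a0).
have I1 s := integrable_itv_mul (measurable_flux s) (FN s).
have key s : s \in `[0, T] ->
    \int[mu]_x mxdot (V b x) (mollify (V s) k x) - \int[mu]_x mxdot (V a x) (mollify (V s) k x) =
    \int[leb1]_q (itv_indic a b q * flux (V q) k (V s)).
  move=> sT; have := momentum sT bT'; have := momentum sT aT.
  rewrite !(Rintegral_itv_indic (measurable_flux s) (FN s)) => ha hb.
  transitivity (\int[leb1]_q (itv_indic 0 b q * flux (V q) k (V s)) -
    \int[leb1]_q (itv_indic 0 a q * flux (V q) k (V s))).
    by rewrite ha hb; lra.
  rewrite -RintegralB//; apply: eq_Rintegral => q _.
  by rewrite -mulrBl -itv_indicB.
under eq_Rintegral => q _ do rewrite mulrDr.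
apply: etrans (esym (RintegralD measurableT (I1 b a b) (I1 a a b))).
apply: etrans (f_equal2 +%R (key b bT') (key a aT)).
(* [E4] inserts the two cross terms, [V b] against the mollified [V a] and conversely, which are
   equal by [hs]. *)
have E4 (x y z w : R) : y = z -> x - w = (x - y) + (z - w) by move=> ->; rewrite addrA subrK.
have hs := mollify_symmetric mk r0 (sV a) (sV b).
exact: (E4 _ _ _ _ hs).
Qed.

(** For each [q], [partition_select] keeps the cell containing [q], and both of its endpoints tend
    to [q]. Integrability is part of the conclusion because the measurability of the diagonal
    [q |-> flux (V q) k (V q)] is obtained here, as that of a limit. *)
Lemma mollified_energy_balance tau : 0 < tau -> tau <= T ->
  leb1.-integrable setT (EFin \o (fun q => itv_indic 0 tau q * (flux (V q) k (V q) + flux (V q) k (V q)))) /\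
  mollified_energy tau - mollified_energy 0 =
  \int[leb1]_q (itv_indic 0 tau q * (flux (V q) k (V q) + flux (V q) k (V q))).
Proof.
move=> tau0 tauT; have [N N0 FN] := flux_uniform_bound.
have cell (a x w : R) : a <= x < a + w -> `|x - a| <= w /\ `|x - (a + w)| <= w.
  by move=> /andP[h1 h2]; split; rewrite ler_norml; apply/andP; split; lra.
pose p n i : R := i%:R * tau / n.+1%:R.
have n0 n : 0 < n.+1%:R :> R by [].
have p0 n i : 0 <= p n i by rewrite /p !mulr_ge0 ?invr_ge0 ?(ltW tau0).
have pS n i : p n i.+1 = p n i + tau / n.+1%:R by rewrite /p -natr1 !mulrDl mul1r.
have ple n i : p n i <= p n i.+1 by rewrite pS lerDl divr_ge0// ltW.
have pT n i : (i <= n.+1)%N -> p n i <= tau.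
  by move=> i1; rewrite /p ler_pdivrMr// mulrC ler_wpM2l ?(ltW tau0)// ler_nat.
pose G n i q : R := flux (V q) k (V (p n i.+1)) + flux (V q) k (V (p n i)).
pose m n q := Num.truncn (q * n.+1%:R / tau).
pose F n q := itv_indic 0 tau q * G n (m n q) q.
have FE n q : F n q = \sum_(i < n.+1) itv_indic (p n i) (p n i.+1) q * G n i q.
  by rewrite /F -(@partition_select _ tau q n (fun i => G n i q)).
have mG n i : measurable_fun setT (G n i) by apply: measurable_funD; exact: measurable_flux.
have GN n i q : `|G n i q| <= N + N by rewrite (le_trans (ler_normD _ _))// lerD.
have IG n i := integrable_itv_mul (mG n i) (GN n i).
have mF n : measurable_fun setT (F n).
  have -> : F n = fun q => \sum_(i < n.+1) itv_indic (p n i) (p n i.+1) q * G n i q.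
    by apply/funext => q; exact: FE.
  by apply: measurable_sum => i; exact: integrable_measurable (IG n i (p n i) (p n i.+1)).
have EF n : \int[leb1]_q F n q = mollified_energy tau - mollified_energy 0.
  under eq_Rintegral => q _ do rewrite FE.
  rewrite Rintegral_sumr//.
  under eq_bigr => i _ do rewrite -mollified_energy_increment ?(le_trans (pT _ _ (ltn_ord i)))//.
  rewrite -(big_mkord xpredT (fun i => mollified_energy (p n i.+1) - mollified_energy (p n i))).
  have pn : p n n.+1 = tau by rewrite /p mulrAC mulfV ?mul1r ?gt_eqF.
  have pn0 : p n 0%N = 0 by rewrite /p !mul0r.
  apply: etrans (telescope_sumr (fun i => mollified_energy (p n i)) (leq0n _)) _.
  by rewrite pn pn0.
have IN : leb1.-integrable setT (EFin \o (fun q => itv_indic 0 tau q * (N + N))).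
  by under eq_fun do rewrite mulrC; apply: integrable_cstM; exact: integrable_itv_indic.
have FN' n q : `|F n q| <= itv_indic 0 tau q * (N + N).
  by have /andP[i0 _] := itv_indic_le 0 tau q; rewrite normrM (ger0_norm i0) ler_wpM2l.
have cF q : F n q @[n --> \oo] --> itv_indic 0 tau q * (flux (V q) k (V q) + flux (V q) k (V q)).
  rewrite /F; have [/andP[q0 qt]|nq] := boolP (0 <= q < tau); last first.
    have z : itv_indic 0 tau q = 0 by rewrite /itv_indic (negbTE nq).
    by under eq_fun do rewrite z mul0r; rewrite z mul0r; exact: cvg_cst.
  have x0 n : 0 <= q * n.+1%:R / tau by rewrite !mulr_ge0// invr_ge0 ltW.
  have mq n : p n (m n q) <= q < p n (m n q).+1.
    have := truncn_itv (x0 n); rewrite /p ler_pdivlMr// ltr_pdivrMr// => /andP[h1 h2].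
    by rewrite ler_pdivrMr// ltr_pdivlMr// h1.
  have mn n : ((m n q).+1 <= n.+1)%N.
    have /andP[h _] := mq n; have := le_lt_trans h qt; rewrite /p ltr_pdivrMr// mulrC ltr_pM2l//.
    by rewrite ltr_nat.
  have dist : (fun n => tau / n.+1%:R) @ \oo --> (0 : R).
    by rewrite -[X in _ --> X](mulr0 tau); apply: cvgMr; exact: cvg_harmonic.
  have qT : q \in `[0, T] by rewrite in_itv/= q0 (le_trans (ltW qt)).
  have close (w : nat -> nat) : (forall n, (w n <= n.+1)%N) ->
      (forall n, `|q - p n (w n)| <= tau / n.+1%:R) ->
      flux (V q) k (V (p n (w n))) @[n --> \oo] --> flux (V q) k (V q).
    move=> wn wq; apply: flux_cvg => //.
      by move=> n; rewrite in_itv/= p0 (le_trans (pT _ _ (wn n))).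
    apply/cvgrPdist_le => e e0; have /cvgr0Pnorm_le/(_ _ e0) := dist.
    by apply: filterS => n; apply: le_trans; rewrite (le_trans (wq n))// ler_norm.
  apply: cvgMr; apply: cvgD; apply: close => n.
  - exact: mn.
  - by have := mq n; rewrite pS => /cell[].
  - exact: ltnW.
  - by have := mq n; rewrite pS => /cell[].
have [If cI] := @cvg_Rintegral_dominated _ (measurableTypeR R) R leb1 F _ _ mF cF IN FN'.
split => //; have c0 : (fun n => \int[leb1]_q F n q) @ \oo --> (mollified_energy tau - mollified_energy 0).
  rewrite (_ : (fun n => _) = cst (mollified_energy tau - mollified_energy 0)); first exact: cvg_cst.
  by apply/funext => n; exact: EF.
exact: (etrans (esym (cvg_lim (@Rhausdorff R) c0)) (cvg_lim (@Rhausdorff R) cI)).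
Qed.

End one_kernel.
End evolution.

(** * Passage to the limit in the kernel *)

Section ae_domination.
Context d (X : measurableType d) (R : realType) (mu : {measure set X -> \bar R}).
Local Notation I f := (mu.-integrable setT (EFin \o f)).

(* The dominating function [N] need not be measurable: the supremum of the
   sequence is. *)
Lemma cvg_Rintegral_ae_dominated (F : nat -> X -> R) (N : X -> \bar R) (C : R) : 0 < C ->
  (forall n, I (F n)) -> {ae mu, forall x, F n x @[n --> \oo] --> 0} ->
  {ae mu, forall x, forall n, ((`|F n x| / C)%:E <= N x)%E} ->
  (forall x, (0 <= N x)%E) -> (\int[mu]_x N x < +oo)%E ->
  \int[mu]_x F n x @[n --> \oo] --> 0.
Proof.
move=> C0 IF F0 FN N0 Noo; have [Z [mZ Z0 FZ]] := FN.
have mF n : measurable_fun setT (F n) := integrable_measurable (IF n).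
(* The indicator removes the exceptional null set, so that [g n <= N] holds at every point and
   passes to the supremum [G]. *)
pose g n x := ((`|F n x| / C * \1_(~` Z) x)%:E)%E.
have g0 n x : (0 <= g n x)%E by rewrite lee_fin !mulr_ge0 ?invr_ge0 ?(ltW C0)// indicE ler0n.
have mg n : measurable_fun setT (g n).
  apply/measurable_EFinP; apply: measurable_funM.
    by apply: measurable_funM => //; exact: measurableT_comp.
  by apply: measurable_indic; exact: measurableC.
pose G x := esups (fun n => g n x) 0%N.
have mG : measurable_fun setT G by exact: measurable_fun_esups.
have gG n x : (g n x <= G x)%E by apply: ereal_sup_ubound; exists n.
have G0 x : (0 <= G x)%E by exact: le_trans (g0 0%N x) (gG 0%N x).
have GN x : (G x <= N x)%E.
  apply: ge_ereal_sup => _ [n _ <-]; rewrite /g indicE; case: (boolP (x \in ~` Z)) => xZ.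
    rewrite mulr1; apply: contrapT => h; move: xZ; rewrite inE/=; apply; apply: FZ => /= /(_ n).
    exact: h.
  by rewrite mulr0.
have IG : mu.-integrable setT G.
  apply/integrableP; split => //; under eq_integral => x _ do rewrite gee0_abs//.
  by apply: le_lt_trans Noo; exact: ge0_le_integral_any.
have [] := @dominated_convergence _ _ _ mu setT measurableT (fun n => EFin \o F n) (cst 0%E)
  (fun x => (C%:E * G x)%E).
- by move=> n; exact/measurable_EFinP.
- exact: measurable_cst.
- by apply: filterS F0 => x Fx _; apply/cvg_EFin => //; exact: nearW.
- exact: integrableZl.
- exists Z; split => // x; apply: contra_notP => xZ n _ /=.
  apply: (@le_trans _ _ (C%:E * g n x)%E); last by rewrite lee_pmul2l// lte_fin.
  by rewrite /g indicE mem_set// mulr1 -EFinM lee_fin mulrCA mulfV ?mulr1// gt_eqF.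
move=> _ _; rewrite integral0 => h; exact: fine_cvg h.
Qed.

End ae_domination.

Lemma ae_imply d (X : measurableType d) (R : realType) (mu : {measure set X -> \bar R})
    (P Q : X -> Prop) : (forall x, P x -> Q x) ->
  {ae mu, forall x, P x} -> {ae mu, forall x, Q x}.
Proof.
move=> PQ [Z [mZ Z0 PZ]]; exists Z; split => // x nQ.
by apply: PZ; exact: contra_not (PQ x) nQ.
Qed.

Lemma ae_and d (X : measurableType d) (R : realType) (mu : {measure set X -> \bar R})
    (P Q : X -> Prop) : {ae mu, forall x, P x} -> {ae mu, forall x, Q x} ->
  {ae mu, forall x, P x /\ Q x}.
Proof.
move=> aeP aeQ; have := negligibleU aeP aeQ; apply: negligibleS => x /= nPQ.
by have [p|p] := pselect (P x); [right => q; apply: nPQ|left].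
Qed.

Section energy_limit.
Context {R : realType} {d : nat}.
Local Notation E := 'rV[R]_d.
Local Notation mu := (leb d : {sigma_finite_measure set E -> \bar R}).
Local Notation I f := (mu.-integrable setT (EFin \o f)).
Variable K : nat -> E -> R.
Hypothesis mK : forall n, mollifier (n.+1%:R^-1) (K n).

Lemma powR2_sq (a : R) : `|a| `^ 2 = a ^+ 2.
Proof. by rewrite powR_mulrn// real_normK// num_real. Qed.

(** The difference is [f (f - v)], estimated by Young's inequality with a weight [t] that keeps the
    part in [f] below [e / 2] before [n] is taken large. *)
Lemma mollified_square_cvg (f : E -> R) : sq_integrable f ->
  \int[mu]_x (f x * cvl (K n) f x) @[n --> \oo] --> \int[mu]_x (f x ^+ 2).
Proof.
move=> sf; have r0 n : 0 < n.+1%:R^-1 :> R by rewrite invr_gt0.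
pose P := \int[mu]_x (f x ^+ 2).
have P0 : 0 <= P by apply: Rintegral_ge0 => x _; exact: sqr_ge0.
apply/cvgrPdist_le => e e0; pose t := e / (2 * (P + 1)).
have P1 : 0 < P + 1 by rewrite ltr_wpDl.
have t0 : 0 < t by rewrite divr_gt0// mulr_gt0.
have I2 : I (fun x => `|f x| `^ 2) by under eq_fun do rewrite powR2_sq; exact: sf.2.
have q1 : 1 <= 2 :> R by rewrite ler1n.
have e'0 : 0 < e * t / 2 by rewrite divr_gt0// mulr_gt0.
apply: filterS (mollify_powR_cvg mK q1 sf I2 e'0) => n; under eq_Rintegral do rewrite powR2_sq.
set v := cvl (K n) f; have sv : sq_integrable v := cvl_sq_integrable (mK n) (r0 n) sf.
have Ifv : I (fun x => f x * v x) by exact: sq_integrable_mul.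
have Iw : I (fun x => (f x - v x) ^+ 2).
  apply: (@integrable_le _ _ _ _ _ (fun x => 2 * (f x ^+ 2 + v x ^+ 2))).
  - by apply: measurable_funX; apply: measurable_funB; [exact: sf.1|exact: sv.1].
  - by move=> x; rewrite ger0_norm ?sqr_ge0//; have := sqr_ge0 (f x + v x); nra.
  - by apply: integrable_cstM; apply: integrableDr; [exact: sf.2|exact: sv.2].
move=> hw; rewrite -RintegralB//; last exact: sf.2.
have I3 := integrable_cstM t sf.2; have I4 := integrable_cstM t^-1 Iw.
apply: (@le_trans _ _ (\int[mu]_x (t * f x ^+ 2 + t^-1 * (f x - v x) ^+ 2))).
  apply: Rintegral_norm_le; [exact: integrableBr sf.2 Ifv|exact: integrableDr|].
  move=> x; have -> : f x ^+ 2 - f x * v x = f x * (f x - v x) by ring.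
  rewrite normrM -(real_normK (num_real (f x))) -(real_normK (num_real (f x - v x))).
  move: (`|f x|) (`|f x - v x|) (normr_ge0 (f x)) (normr_ge0 (f x - v x)) => a b a0 b0.
  rewrite -subr_ge0 -(pmulr_rge0 _ t0) mulrBr mulrDr (mulrA t t^-1) mulfV ?gt_eqF// mul1r.
  have := sqr_ge0 (t * a - b); have := mulr_ge0 a0 b0; nra.
rewrite (RintegralD measurableT I3 I4) (RintegralZl _ measurableT sf.2) (RintegralZl _ measurableT Iw).
rewrite [leRHS](splitr e); apply: lerD.
  rewrite -/P (_ : t * P = e / 2 * (P / (P + 1))); last by rewrite /t; field; rewrite gt_eqF.
  by rewrite ler_piMr ?divr_ge0 ?(ltW e0)// ler_pdivrMr// mul1r lerDl.
apply: (@le_trans _ _ (t^-1 * (e * t / 2))); first by rewrite ler_wpM2l// invr_ge0 ltW.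
by rewrite (_ : t^-1 * _ = e / 2)//; field; rewrite gt_eqF.
Qed.

Lemma mollified_energy_cvg (V : R -> E -> E) (t : R) :
  (forall i, sq_integrable (fun x => V t x 0 i)) ->
  mollified_energy V (K n) t @[n --> \oo] --> \sum_i \int[mu]_x (V t x 0 i ^+ 2).
Proof.
move=> sV; have r0 n : 0 < n.+1%:R^-1 :> R by rewrite invr_gt0.
rewrite /mollified_energy.
under eq_fun do rewrite (mollify_mxdotE (mK _) (r0 _) sV sV).
apply: cvg_big => [|i _]; first exact: add_continuous.
exact: mollified_square_cvg.
Qed.

End energy_limit.

Section energy_conservation.
Context {R : realType} {d : nat}.
Local Notation E := 'rV[R]_d.
Local Notation mu := (leb d : {sigma_finite_measure set E -> \bar R}).
Local Notation leb1 := (@lebesgue_measure R).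
Variables (T M : R) (V : R -> E -> E) (K : nat -> E -> R).
Hypothesis mV : forall i, measurable_fun setT
  (fun z : measurableTypeR R * E => V z.1 z.2 0 i).
Hypothesis sV : forall t i, sq_integrable (fun x => V t x 0 i).
Hypothesis VM : forall t i, \int[mu]_x (V t x 0 i ^+ 2) <= M.
Hypothesis wV : forall (t : R) (s : nat -> R) (g : E -> E), t \in `[0, T] ->
  (forall n, s n \in `[0, T]) -> s @ \oo --> t ->
  (forall i, sq_integrable (fun x => g x 0 i)) ->
  \int[mu]_x mxdot (V (s n) x) (g x) @[n --> \oo] --> \int[mu]_x mxdot (V t x) (g x).
Hypothesis mK : forall n, mollifier (n.+1%:R^-1) (K n).
Hypothesis momentum : forall n (s t : R), s \in `[0, T] -> t \in `[0, T] ->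
  \int[leb1]_(q in `[0, t]) flux (V q) (K n) (V s) =
  \int[mu]_x mxdot (V t x) (mollify (V s) (K n) x) -
  \int[mu]_x mxdot (V 0 x) (mollify (V s) (K n) x).
Variables (C : R) (N : R -> \bar R).
Hypothesis C0 : 0 < C.
Hypothesis N0 : forall q, (0 <= N q)%E.
Hypothesis Noo : (\int[leb1]_(q in `[0%R, T]) N q < +oo)%E.
Hypothesis flux_vanish : {ae leb1, forall q : R, q \in `[0, T] ->
  flux (V q) (K n) (V q) @[n --> \oo] --> 0}.
Hypothesis flux_dom : {ae leb1, forall q : R, q \in `[0, T] ->
  forall n, ((`|flux (V q) (K n) (V q)| / C)%:E <= N q)%E}.

Lemma energy_conserved tau : tau \in `[0, T] ->
  \sum_i \int[mu]_x (V tau x 0 i ^+ 2) = \sum_i \int[mu]_x (V 0 x 0 i ^+ 2).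
Proof.
rewrite in_itv/= => /andP[]; rewrite le_eqVlt => /predU1P[<-//|tau0] tauT.
have r0 n : 0 < n.+1%:R^-1 :> R by rewrite invr_gt0.
pose F n q := itv_indic 0 tau q * (flux (V q) (K n) (V q) + flux (V q) (K n) (V q)).
have bal n := mollified_energy_balance mV sV VM wV (r0 n) (mK n) (momentum n) tau0 tauT.
have itvT q : ~~ (q \in `[0, T]) -> itv_indic 0 tau q = 0.
  rewrite in_itv/= /itv_indic => h; case: (boolP (0 <= q < tau)) => // /andP[q0 qt].
  by move: h; rewrite q0 (le_trans (ltW qt) tauT).
have c0 : \int[leb1]_q F n q @[n --> \oo] --> 0.
  (* The constant is [C + C] because the integrand contains the flux twice; [N] is restricted to
     [[0, T]], outside of which [itv_indic 0 tau] vanishes. *)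
  apply: (@cvg_Rintegral_ae_dominated _ (measurableTypeR R) R leb1 F (N \_ `[0%R, T]) (C + C)).
  - by rewrite addr_gt0.
  - by move=> n; have [] := bal n.
  - apply: ae_imply flux_vanish => q hq; rewrite /F.
    have [qT|qT] := boolP (q \in `[0, T]); last first.
      by under eq_fun do rewrite itvT// mul0r; exact: cvg_cst.
    rewrite -[X in _ --> X](mulr0 (itv_indic 0 tau q)) -[X in _ * X]addr0.
    by apply: cvgMr; apply: cvgD; exact: hq.
  - apply: ae_imply flux_dom => q hq n; rewrite patchE /F.
    have [qT|qT] := boolP (q \in `[0, T]); last first.
      rewrite itvT// mul0r normr0 mul0r; case: ifP => // _.
    rewrite mem_set//; apply: le_trans (hq qT n); rewrite lee_fin.
    have /andP[i0 i1] := itv_indic_le 0 tau q.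
    rewrite normrM (ger0_norm i0) -mulr2n normrMn -mulr_natl -(mulr2n C) -[C *+ 2]mulr_natl.
    move: (`|flux _ _ _|) (normr_ge0 (flux (V q) (K n) (V q))) => f f0.
    rewrite (_ : _ / (2 * C) = itv_indic 0 tau q * (f / C)).
      by rewrite ler_piMl// divr_ge0// ltW.
    by field; rewrite gt_eqF.
  - by move=> q; rewrite patchE; case: ifP.
  - by rewrite -integral_mkcond.
have cE : mollified_energy V (K n) tau - mollified_energy V (K n) 0 @[n --> \oo] -->
    \sum_i \int[mu]_x (V tau x 0 i ^+ 2) - \sum_i \int[mu]_x (V 0 x 0 i ^+ 2).
  by apply: cvgB; exact: mollified_energy_cvg.
have cE0 : mollified_energy V (K n) tau - mollified_energy V (K n) 0 @[n --> \oo] --> 0.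
  rewrite (_ : (fun n => _) = fun n => \int[leb1]_q F n q) //.
  by apply/funext => n; exact: (bal n).2.
apply/eqP; rewrite -subr_eq0; apply/eqP.
exact: (etrans (esym (cvg_lim (@Rhausdorff R) cE)) (cvg_lim (@Rhausdorff R) cE0)).
Qed.

End energy_conservation.

(** * Weak solutions of the Euler equations *)

Section flux_domination.
Context {R : realType} {d : nat}.
Local Notation E := 'rV[R]_d.
Local Notation mu := (leb d : {sigma_finite_measure set E -> \bar R}).
Local Notation I f := (mu.-integrable setT (EFin \o f)).
Variables (u : E -> E) (S : E -> 'M[R]_d) (K : nat -> E -> R) (p M : R).
Hypothesis su : forall i, sq_integrable (fun x => u x 0 i).
Hypothesis div_u : forall q g, W12 q g -> \int[mu]_x mxdot (u x) (g x) = 0.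
Hypothesis uS : is_sym_gradient u S.
Hypothesis mK : forall n, mollifier (n.+1%:R^-1) (K n).
Hypothesis p1 : 1 <= p.
Hypothesis Iq : forall i, I (fun x => `|u x 0 i| `^ (2 * p)).
Hypothesis M0 : 0 <= M.
Hypothesis uM : forall i, \int[mu]_x (`|u x 0 i| `^ (2 * p)) <= M.

Let r0 n : 0 < n.+1%:R^-1 :> R. Proof. by rewrite invr_gt0. Qed.

(** The constant of [flux_le] at [s = 1], where [M] bounds the moments of order [2 p] of [u] and [B]
    the integral of [Psi]. The final [+ 1] keeps it positive, as it is divided by. *)
Definition flux_const (c B : R) : R := d%:R ^+ 2 * (c * (stress_const p * M) + B) + 1.

Lemma flux_const_gt0 c B : 0 <= c -> 0 <= B -> 0 < flux_const c B.
Proof.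
move=> c0 B0; rewrite ltr_wpDl// mulr_ge0 ?sqr_ge0// addr_ge0// mulr_ge0// mulr_ge0//.
exact: stress_const_ge0.
Qed.

Lemma flux_le_const (beta c B : R) (Psi : E -> R) n : 0 <= beta -> 0 <= c -> I Psi ->
  (forall x, 0 <= Psi x) -> \int[mu]_x Psi x <= B ->
  (forall x i j t s, 0 <= t -> 0 < s -> t * `|cvl (K n) (fun y => S y i j) x| <=
    beta * s * (c * (s `^ p)^-1 * t `^ p + cvl (K n) Psi x)) ->
  `|flux u (K n) u| <= flux_const c B * beta.
Proof.
move=> b0 c0 IPsi Psi0 PB gauge.
have stA i j := stress_powR_bound su p1 Iq (mK n) i j uM.
apply: le_trans (flux_le su p1 Iq (r0 n) (mK n) div_u uS b0 c0 IPsi Psi0 gauge ltr01 stA) _.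
rewrite /flux_const mulr1 powR1 invr1 mulr1 mulrDl mul1r -mulrA [X in _ <= X + _]mulrC.
apply: (@le_trans _ _ (d%:R ^+ 2 * (beta * (c * (stress_const p * M) + B)))).
  by rewrite ler_wpM2l ?sqr_ge0// ler_wpM2l// lerD2l.
by rewrite -subr_ge0 (_ : _ - _ = beta)//; ring.
Qed.

Lemma flux_bounded_gradient : p = 1 -> Lp +oo%E S ->
  flux u (K n) u @[n --> \oo] --> 0 /\
  forall n, ((`|flux u (K n) u| / flux_const 1 0)%:E <= Lp_norm +oo%E S)%E.
Proof.
move=> pE [mS Soo]; have aeS := Lp_infty_ae_le S.
have S0 : (0 <= Lp_norm +oo%E S)%E by exact: Lnorm_ge0.
have Sfin : Lp_norm +oo%E S \is a fin_num by rewrite ge0_fin_numE.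
pose beta := fine (Lp_norm +oo%E S); have b0 : 0 <= beta by exact: fine_ge0.
have aeb : {ae mu, forall x, enorm (S x) <= beta}.
  by apply: filterS aeS => x; rewrite -(fineK Sfin) lee_fin.
have gauge n := gauge_bounded (mK n) b0 mS aeb.
have I0 : I (fun _ : E => 0 : R) by exact: integrable0.
have c0 := flux_const_gt0 ler01 (lexx (0 : R)).
split.
  apply: (flux_cvg0 su p1 Iq mK div_u uS b0 ler01 I0) => // n; rewrite pE; exact: gauge.
move=> n; rewrite -(fineK Sfin) lee_fin ler_pdivrMr// mulrC.
apply: (@flux_le_const beta 1 0 (fun=> 0) n) => //; last by rewrite pE; exact: gauge.
by rewrite /Rintegral integral0.
Qed.

(** The limit needs only one [beta] of finite modular. For the bound every [beta] of modular at most
    1 is admissible, and their infimum is the Luxemburg norm; the constant 2 bounds the integral of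
    [Psi], which is twice the modular. *)
Lemma flux_exp_gradient (sigma : R) : 0 < sigma -> p = 1 + sigma / 2 -> Lexp S ->
  flux u (K n) u @[n --> \oo] --> 0 /\
  forall n, ((`|flux u (K n) u| / flux_const (4 / sigma) 2)%:E <= Lexp_norm S)%E.
Proof.
move=> sg0 pE [mS [beta0 b00 Soo]].
have c0 : 0 <= 4 / sigma by rewrite divr_ge0// ltW.
have C0 := flux_const_gt0 c0 (ler0n R 2).
split.
  have [IPsi Psi0 _] := gauge_exp (mK 0%N) sg0 b00 mS Soo.
  apply: (flux_cvg0 su p1 Iq mK div_u uS (ltW b00) c0 IPsi Psi0) => n.
  by have [_ _] := gauge_exp (mK n) sg0 b00 mS Soo; rewrite -pE.
move=> n; apply: le_ereal_inf_tmp => _ [beta [b0 S1] <-].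
rewrite lee_fin ler_pdivrMr// mulrC.
have [IPsi Psi0 gauge] := gauge_exp (mK n) sg0 b0 mS (le_lt_trans S1 (ltry 1)).
apply: (flux_le_const (ltW b0) c0 IPsi Psi0); last by rewrite pE.
rewrite -lee_fin EFin_Rintegral//.
under eq_integral => x _ do rewrite EFinM.
have psi0 x : 0 <= Orlicz_psi (enorm (S x) / beta).
  by rewrite subr_ge0 -expR0 ler_expR divr_ge0 ?enorm_ge0// ltW.
rewrite ge0_integralZl_EFin//.
- by rewrite -[leRHS]mule1 lee_wpmul2l// lee_fin.
- by move=> x _; rewrite lee_fin.
- apply/measurable_EFinP; apply: measurable_funB => //; apply: measurableT_comp => //.
  apply: measurable_funM => //; apply: measurable_enorm => i j.
  exact: measurableT_comp (measurable_entry i j) mS.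
Qed.

End flux_domination.

(** * From almost every time to every time *)

Section time_norms.
Context {R : realType} {d m n : nat}.
Local Notation E := 'rV[R]_d.
Local Notation leb1 := (@lebesgue_measure R).
Variables (T : R) (Y : set (E -> 'M[R]_(m, n))) (normY : (E -> 'M[R]_(m, n)) -> \bar R).
Variable f : R -> E -> 'M[R]_(m, n).

Lemma lebesgue_setT_gt0 : (0 < leb1 setT)%E.
Proof.
apply: (@lt_le_trans _ _ (leb1 `[0, 1]%classic)); last by apply: le_measure; rewrite ?inE.
by rewrite lebesgue_measure_itv/= lte_fin ltr01 -EFinB subr0 lte_fin.
Qed.

Lemma Lp_time_infty_bound : Lp_time +oo%E T Y normY f ->
  exists2 N : R, 0 <= N & {ae leb1, forall t : R, t \in `[0, T] -> (normY (f t) <= N%:E)%E}.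
Proof.
move=> [_ _ foo]; set g := (X in Lnorm _ _ X) in foo.
have g0 : (0 <= Lnorm leb1 +oo%E g)%E by exact: Lnorm_ge0.
have gfin : Lnorm leb1 +oo%E g \is a fin_num by rewrite ge0_fin_numE.
exists (fine (Lnorm leb1 +oo%E g)); first exact: fine_ge0.
rewrite (fineK gfin) Lnorm.unlock lebesgue_setT_gt0.
apply: ae_imply (ess_sup_ge leb1 (abse \o g)) => t gt tT; apply: le_trans gt.
by rewrite /= /g patchE mem_set// lee_abs.
Qed.

Lemma Lp_time1_integral : Lp_time 1%:E T Y normY f ->
  (\int[leb1]_(t in `[0%R, T]) `|normY (f t)| < +oo)%E.
Proof.
move=> [_ _]; rewrite Lnorm1 => /(le_lt_trans _); apply.
rewrite [leLHS]integral_mkcond le_eqVlt; apply/orP; left; apply/eqP.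
by apply: eq_integral => t _; rewrite !patchE; case: ifP => // _; rewrite abse0.
Qed.

End time_norms.

Section weak_solutions.
Context {R : realType} {d : nat}.
Local Notation E := 'rV[R]_d.
Local Notation mu := (leb d : {sigma_finite_measure set E -> \bar R}).
Local Notation leb1 := (@lebesgue_measure R).
Local Notation I f := (mu.-integrable setT (EFin \o f)).
Variables (T : R) (U : R -> E -> E) (u0 : E -> E).
Hypothesis T0 : 0 < T.
Hypothesis weakU : weak_solution_with_datum T u0 U.
Hypothesis contU : weakly_continuous_from T u0 U.
Hypothesis L2u0 : Lp 2%:E u0.

(* Nothing is assumed on [U] outside [0, T]; the cutoff makes the estimates hold at all times. *)
Let V (t : R) (x : E) : E := if t \in `[0, T] then U t x else 0.

Let VE t : t \in `[0, T] -> V t = U t.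
Proof. by move=> tT; apply/funext => x; rewrite /V tT. Qed.

Let V_out t : t \notin `[0, T] -> V t = fun=> 0.
Proof. by move=> /negbTE tT; apply/funext => x; rewrite /V tT. Qed.

Lemma cutoff_sq_integrable t i : sq_integrable (fun x => V t x 0 i).
Proof.
have [tT|tT] := boolP (t \in `[0, T]).
  by rewrite VE//; have [L2U _ _] := contU; exact: (Lp2_sq_integrable (L2U t tT) 0 i).
rewrite V_out//; under eq_fun do rewrite mxE.
by split => //; under eq_fun do rewrite expr0n; exact: integrable0.
Qed.

Lemma cutoff_measurable i : measurable_fun setT (fun z : measurableTypeR R * E => V z.1 z.2 0 i).
Proof.
have [[mU _ _] _] := weakU.
have mD : measurable (`[0, T]%classic `*` [set: E] : set (measurableTypeR R * E)).
  by apply: measurableX => //; exact: measurable_itv.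
have := measurableT_comp (measurable_entry (0 : 'I_1) i) mU.
move=> /(measurable_restrictT _ mD); congr measurable_fun; apply/funext => -[t x].
rewrite patchE/= /V; have [tT|tT] := boolP (t \in `[0, T]).
  by rewrite mem_set.
by rewrite memNset ?mxE// => -[]/= h _; move: tT; rewrite h.
Qed.

Lemma mxdot_integrable (u v : E -> E) : (forall i, sq_integrable (fun x => u x 0 i)) ->
  (forall i, sq_integrable (fun x => v x 0 i)) -> I (fun x => mxdot (u x) (v x)).
Proof.
move=> su sv; under eq_fun do rewrite mxdot_row.
by apply: integrable_sumr => i; exact: sq_integrable_mul.
Qed.

Lemma cutoff_weak_continuity t (s : nat -> R) (g : E -> E) : t \in `[0, T] ->
  (forall n, s n \in `[0, T]) -> s @ \oo --> t ->
  (forall i, sq_integrable (fun x => g x 0 i)) ->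
  \int[mu]_x mxdot (V (s n) x) (g x) @[n --> \oo] --> \int[mu]_x mxdot (V t x) (g x).
Proof.
move=> tT sT st sg; have [_ wc _] := contU.
have L2g : Lp 2%:E g by apply: sq_integrable_Lp2 => a i; rewrite ord1.
have := within_cvg_sequence (wc g L2g) tT sT st.
by under eq_fun do rewrite -(VE (sT _)); rewrite -(VE tT).
Qed.

(** The norm bound holds at almost every time; weak lower semicontinuity extends it. Pairing
    [V (s n)] with the [i]-th component of [V t] itself, the limit [P] satisfies
    [P <= (N^2 + P) / 2]. *)
Lemma cutoff_energy_bound : exists2 M : R, 0 <= M & forall t i, \int[mu]_x (V t x 0 i ^+ 2) <= M.
Proof.
have [LT _] := weakU; have [N N0 aeN] := Lp_time_infty_bound LT.
exists (N ^+ 2) => [|t i]; first exact: sqr_ge0.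
have [tT|tT] := boolP (t \in `[0, T]); last first.
  rewrite V_out//; under eq_Rintegral do rewrite mxE expr0n/=.
  by rewrite /Rintegral integral0 sqr_ge0.
have aeN' : {ae leb1, forall s : R, s \in `]0, T[ -> \int[mu]_x (V s x 0 i ^+ 2) <= N ^+ 2}.
  apply: ae_imply aeN => s hs sT; have sT' : s \in `[0, T].
    by move: sT; rewrite !in_itv/= => /andP[s0 s1]; rewrite !ltW.
  have [L2U _ _] := contU; have [mUs _] := L2U s sT'.
  have := Lp_entry_le (0 : 'I_1) i (ltr0n R 2) N0 mUs (hs sT').
  rewrite powR_mulrn// (VE sT'); under eq_Rintegral do rewrite powR2_sq; exact.
have [s [hs st]] := ae_sequence T0 tT aeN'.
have sT n : s n \in `[0, T].
  by have [+ _] := hs n; rewrite !in_itv/= => /andP[h0 h1]; rewrite !ltW.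
pose g (x : E) : E := \row_l (if l == i then V t x 0 i else 0).
have sg l : sq_integrable (fun x => g x 0 l).
  under eq_fun do rewrite mxE; case: eqP => _; first exact: cutoff_sq_integrable.
  by split => //; under eq_fun do rewrite expr0n; exact: integrable0.
have gE w x : mxdot (w : E) (g x) = w 0 i * V t x 0 i.
  rewrite mxdot_row (bigD1 i)//= mxE eqxx big1 ?addr0// => l /negbTE li.
  by rewrite mxE li mulr0.
have := cutoff_weak_continuity tT sT st sg.
under eq_fun do under eq_Rintegral do rewrite gE.
under [X in _ --> X -> _]eq_Rintegral do rewrite gE -expr2.
set P := \int[mu]_x (V t x 0 i ^+ 2) => cP.
have sVt := cutoff_sq_integrable t i.
have h n : \int[mu]_x (V (s n) x 0 i * V t x 0 i) <= 2^-1 * (N ^+ 2 + P).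
  have sVs := cutoff_sq_integrable (s n) i.
  apply: (@le_trans _ _ (\int[mu]_x (2^-1 * (V (s n) x 0 i ^+ 2 + V t x 0 i ^+ 2)))).
    apply: le_Rintegral => //; first exact: sq_integrable_mul.
      by apply: integrable_cstM; apply: integrableDr; [exact: sVs.2|exact: sVt.2].
    by move=> x _; have := sqr_ge0 (V (s n) x 0 i - V t x 0 i); nra.
  rewrite (RintegralZl _ measurableT (integrableDr sVs.2 sVt.2)) (RintegralD measurableT sVs.2 sVt.2).
  by rewrite ler_wpM2l ?invr_ge0// lerD2r; exact: (hs n).2.
have : P <= 2^-1 * (N ^+ 2 + P).
  rewrite -[leLHS](cvg_lim (@Rhausdorff R) cP); apply: limr_le; first by apply/cvg_ex; exists P.
  by apply: nearW => n; exact: h.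
by clearbody P; lra.
Qed.

(** The pairing vanishes at almost every time and is continuous in time, hence vanishes at every
    time, both endpoints included. *)
Lemma cutoff_div_free t q g : t \in `[0, T] -> W12 q g -> \int[mu]_x mxdot (V t x) (g x) = 0.
Proof.
move=> tT Wq; have [_ L2g _] := Wq; have [_ ae0] := weakU.
have [s [hs st]] := ae_sequence T0 tT ae0.
have sT n : s n \in `[0, T].
  by have [+ _] := hs n; rewrite !in_itv/= => /andP[h0 h1]; rewrite !ltW.
have c0 := cutoff_weak_continuity tT sT st (Lp2_sq_integrable L2g 0).
rewrite -(cvg_lim (@Rhausdorff R) c0); apply: (cvg_lim (@Rhausdorff R)).
rewrite (_ : (fun n => _) = cst (0 : R)); first exact: cvg_cst.
by apply/funext => n; rewrite (VE (sT n)); have [_ [_ h]] := hs n; exact: h Wq.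
Qed.

Section momentum.
Variables (r : R) (k : E -> R).
Hypotheses (r0 : 0 < r) (mk : mollifier r k).

Lemma weak_form_flux (u w : E -> E) (t : R) : (forall i, sq_integrable (fun x => u x 0 i)) ->
  (forall i, sq_integrable (fun x => w x 0 i)) ->
  \int[mu]_x (mxdot (u x) (derive1 ((fun=> mollify w k) ^~ x) t) +
    mxdot (tensor (u x) (u x)) (mollify_jacobian w k x)) = flux u k w.
Proof.
move=> su sw; have [N JN] := mollify_jacobian_bounded sw mk.
have E1 x : mxdot (u x) (derive1 ((fun=> mollify w k) ^~ x) t) +
    mxdot (tensor (u x) (u x)) (mollify_jacobian w k x) =
    \sum_i \sum_j u x 0 i * u x 0 j * mollify_jacobian w k x i j.
  rewrite (_ : derive1 _ _ = 0); last exact: derive1_cst.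
  rewrite mxdot_row big1 ?add0r => [|i _]; last by rewrite mxE mulr0.
  apply: eq_bigr => i _; apply: eq_bigr => j _; congr (_ * _).
  by rewrite /tensor mxE big_ord1 mxE.
under eq_Rintegral => x _ do rewrite E1.
have IJ i j : I (fun x => u x 0 i * u x 0 j * mollify_jacobian w k x i j).
  apply: (integrable_bounded_mul (sq_integrable_mul (su i) (su j)) _ (fun x => JN x i j)).
  exact: (measurable_mollify_jacobian sw mk).
rewrite Rintegral_sumr => [|i]; last exact: integrable_sumr.
by apply: eq_bigr => i _; rewrite Rintegral_sumr.
Qed.

(** A stationary test field leaves only the convective term. The weak form gives the identity at
    almost every [t]; both sides are continuous in [t], the left one because the flux is bounded,
    the right one by weak continuity. *)
Lemma cutoff_momentum s t : s \in `[0, T] -> t \in `[0, T] ->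
  \int[leb1]_(q in `[0, t]) flux (V q) k (V s) =
  \int[mu]_x mxdot (V t x) (mollify (V s) k x) -
  \int[mu]_x mxdot (V 0 x) (mollify (V s) k x).
Proof.
move=> sT tT; have sV := cutoff_sq_integrable.
have [M M0 VM] := cutoff_energy_bound.
have sm i : sq_integrable (fun x => mollify (V s) k x 0 i) := mollify_sq_integrable (sV s) r0 mk i.
have tf := mollify_test_field (sV s) (fun q g => @cutoff_div_free s q g sT) r0 mk T.
have [_ aew] := weakU; have [s' [hs st]] := ae_sequence T0 tT aew.
have sT' n : s' n \in `[0, T].
  by have [+ _] := hs n; rewrite !in_itv/= => /andP[h0 h1]; rewrite !ltW.
have T00 : (0 : R) \in `[0, T] by rewrite in_itv/= lexx ltW.
have [N N0 FN] := flux_uniform_bound sV VM mk.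
have mF := measurable_flux cutoff_measurable sV mk s.
(* The weak form involves [u0], which agrees with [V 0] almost everywhere only. *)
have datum : \int[mu]_x mxdot (u0 x) (mollify (V s) k x) = \int[mu]_x mxdot (V 0 x) (mollify (V s) k x).
  have [_ _ ae0] := contU.
  rewrite /Rintegral; congr fine; apply: ae_eq_integral => //.
  - exact: measurable_int (mxdot_integrable (Lp2_sq_integrable L2u0 0) sm).
  - exact: measurable_int (mxdot_integrable (sV 0) sm).
  - by apply: ae_imply ae0 => x hx _; rewrite (VE T00) hx.
have step n : \int[leb1]_q (itv_indic 0 (s' n) q * flux (V q) k (V s)) =
    \int[mu]_x mxdot (V (s' n) x) (mollify (V s) k x) - \int[mu]_x mxdot (V 0 x) (mollify (V s) k x).
  have [_ [/(_ _ _ tf) + _]] := hs n; rewrite /euler_weak_form -datum -(VE (sT' n)) => <-.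
  rewrite -(Rintegral_itv_indic mF (FN s)); apply: eq_Rintegral => q; rewrite inE/= => qs.
  have qT : q \in `[0, T].
    by have := sT' n; move: qs; rewrite !in_itv/= => /andP[-> q1] /andP[_ q2]; rewrite (le_trans q1).
  by rewrite -(VE qT) weak_form_flux.
have c1 := Rintegral_itv_indic_cvg mF (FN s) st.
have s0 n : 0 <= s' n by have := sT' n; rewrite in_itv/= => /andP[].
have t0 : 0 <= t by move: tT; rewrite in_itv/= => /andP[].
have c2 : \int[mu]_x mxdot (V (s' n) x) (mollify (V s) k x) -
      \int[mu]_x mxdot (V 0 x) (mollify (V s) k x) @[n --> \oo] -->
    \int[mu]_x mxdot (V t x) (mollify (V s) k x) - \int[mu]_x mxdot (V 0 x) (mollify (V s) k x).
  by apply: cvgB; [exact: cutoff_weak_continuity|exact: cvg_cst].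
rewrite (Rintegral_itv_indic mF (FN s)).
have {}c1 := c1 s0 t0.
apply: (etrans (esym (cvg_lim (@Rhausdorff R) c1))); apply: (cvg_lim (@Rhausdorff R)).
rewrite (_ : (fun n => _) = fun n =>
    \int[mu]_x mxdot (V (s' n) x) (mollify (V s) k x) - \int[mu]_x mxdot (V 0 x) (mollify (V s) k x))//.
by apply/funext => n; exact: step.
Qed.

End momentum.

Lemma energyE t : t \in `[0, T] -> energy U t = (\sum_i \int[mu]_x (V t x 0 i ^+ 2))%:E.
Proof.
move=> tT; have sV := cutoff_sq_integrable t.
have E1 x : enorm (U t x) ^+ 2 = \sum_i V t x 0 i ^+ 2.
  rewrite (VE tT) sqr_enorm mxdot_row; apply: eq_bigr => i _; exact: (esym (expr2 _)).
rewrite /energy; under eq_integral do rewrite E1.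
rewrite -EFin_Rintegral; last by apply: integrable_sumr => i; exact: (sV i).2.
by rewrite Rintegral_sumr => [//|i]; exact: (sV i).2.
Qed.

(** The regularity of [U] and of its gradient enters only through the flux, so both cases of the
    theorem reduce to this statement. *)
Lemma weak_solution_energy (K : nat -> E -> R) (C : R) (N : R -> \bar R) :
  (forall n, mollifier (n.+1%:R^-1) (K n)) -> 0 < C ->
  (forall q, (0 <= N q)%E) -> (\int[leb1]_(q in `[0%R, T]) N q < +oo)%E ->
  {ae leb1, forall q : R, q \in `[0, T] -> flux (U q) (K n) (U q) @[n --> \oo] --> 0 /\
    forall n, ((`|flux (U q) (K n) (U q)| / C)%:E <= N q)%E} ->
  forall tau, tau \in `[0, T] -> energy U tau = energy U 0.
Proof.
move=> mK C0 N0 Noo hflux tau tT; have [M M0 VM] := cutoff_energy_bound.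
have T00 : (0 : R) \in `[0, T] by rewrite in_itv/= lexx ltW.
have r0 n : 0 < n.+1%:R^-1 :> R by rewrite invr_gt0.
rewrite (energyE tT) (energyE T00); congr (_%:E).
have momentum n s t := @cutoff_momentum _ _ (r0 n) (mK n) s t.
apply: (energy_conserved cutoff_measurable cutoff_sq_integrable VM _ mK momentum C0 N0 Noo _ _ tT).
- exact: cutoff_weak_continuity.
- by apply: ae_imply hflux => q hq qT; rewrite (VE qT); exact: (hq qT).1.
- by apply: ae_imply hflux => q hq qT; rewrite (VE qT); exact: (hq qT).2.
Qed.

End weak_solutions.

Lemma mollifier_sequence (R : realType) (d : nat) :
  exists K : nat -> 'rV[R]_d -> R, forall n, mollifier (n.+1%:R^-1) (K n).
Proof.
have ex (n : nat) : exists k : 'rV[R]_d -> R, mollifier (n.+1%:R^-1) k.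
  by apply: mollifier_exists; rewrite invr_gt0.
by have [K mK] := boolp.choice ex; exists K.
Qed.

Theorem proposition1p7 (R : realType) (d : nat) (hd : (0 < d)%N)
    (T : R) (hT : 0 < T) (U : R -> 'rV[R]_d -> 'rV[R]_d)
    (hU : weak_solution T U)
    (hreg :
      ((exists2 sigma : R, 0 < sigma &
          Lp_time +oo%E T (Lp (2 + sigma)%:E) (Lp_norm (2 + sigma)%:E) U) /\
       sym_gradient_in_L1 T Lexp Lexp_norm U)
      \/
      (Lp_time +oo%E T (Lp 2%:E) (Lp_norm 2%:E) U /\
       sym_gradient_in_L1 T (Lp +oo%E) (Lp_norm +oo%E) U)) :
  forall tau : R, tau \in `[0, T] -> energy U tau = energy U 0.
Proof.
have [u0 [L2u0 _ weakU contU]] := hU.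
have [K mK] := mollifier_sequence R d.
have sU t i : t \in `[0, T] -> sq_integrable (fun x => U t x 0 i).
  by move=> tT; have [L2U _ _] := contU; exact: (Lp2_sq_integrable (L2U t tT) 0 i).
have divU t q g : t \in `[0, T] -> W12 q g -> \int[leb d]_x mxdot (U t x) (g x) = 0.
  by move=> tT; have := @cutoff_div_free _ _ T U u0 hT weakU contU t q g tT; rewrite tT.
have [_ aeU] := weakU.
case: hreg => [[[sigma sg0 LT] [S [LS gradS]]]|[LT [S [LS gradS]]]].
- have [N1 N10 aeN1] := Lp_time_infty_bound LT.
  have [_ aeL _] := LT; have [_ aeS _] := LS.
  (* The majorant is the norm of [S(q)], in absolute value: this is nonnegative at every [q] and is
     the quantity that [Lp_time1_integral] bounds. *)
  apply: (@weak_solution_energy R d T U u0 hT weakU contU L2u0 K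
    (flux_const (d := d) (1 + sigma / 2) (N1 `^ (2 + sigma)) (4 / sigma) 2)
    (fun q => `|Lexp_norm (S q)|%E) mK).
  + by apply: flux_const_gt0; rewrite ?powR_ge0// divr_ge0// ltW.
  + by move=> q; exact: abse_ge0.
  + exact: Lp_time1_integral LS.
  have aeA := ae_and (ae_and aeN1 aeL) (ae_and aeS gradS).
  apply: ae_imply aeA => q [[hN hL] [hS hG]] qT.
  have pE : 2 * (1 + sigma / 2) = 2 + sigma by field.
  have [mU _] := hL qT.
  have sg2 : 0 < 2 + sigma by rewrite addr_gt0.
  have p1 : 1 <= 1 + sigma / 2 by rewrite lerDl divr_ge0// ltW.
  have Iq i := Lp_entry_integrable (0 : 'I_1) i sg2 (hL qT).
  have Mq i := Lp_entry_le (0 : 'I_1) i sg2 N10 mU (hN qT).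
  rewrite -pE in Iq Mq.
  have [h1 h2] := flux_exp_gradient (fun i => sU q i qT) (fun f g => divU q f g qT) (hG qT) mK
    p1 Iq (powR_ge0 _ _) Mq sg0 erefl (hS qT).
  split => // n; apply: le_trans (lee_abs _); rewrite -pE; exact: h2.
- have [N1 N10 aeN1] := Lp_time_infty_bound LT.
  have [_ aeL _] := LT; have [_ aeS _] := LS.
  apply: (@weak_solution_energy R d T U u0 hT weakU contU L2u0 K
    (flux_const (d := d) 1 (N1 `^ 2) 1 0)
    (fun q => `|Lp_norm +oo%E (S q)|%E) mK).
  + by apply: flux_const_gt0; rewrite ?powR_ge0.
  + by move=> q; exact: abse_ge0.
  + exact: Lp_time1_integral LS.
  have aeA := ae_and (ae_and aeN1 aeL) (ae_and aeS gradS).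
  apply: ae_imply aeA => q [[hN hL] [hS hG]] qT.
  (* Here [p = 1], so the moments of order [2 p] are those given by the [L^2] bound. *)
  have pE : 2 * 1 = 2 :> R by rewrite mulr1.
  have [mU _] := hL qT.
  have Iq i := Lp_entry_integrable (0 : 'I_1) i (ltr0n R 2) (hL qT).
  have Mq i := Lp_entry_le (0 : 'I_1) i (ltr0n R 2) N10 mU (hN qT).
  rewrite -pE in Iq Mq.
  have [h1 h2] := flux_bounded_gradient (fun i => sU q i qT) (fun f g => divU q f g qT) (hG qT) mK
    (lexx 1) Iq (powR_ge0 _ _) Mq erefl (hS qT).
  split => // n; apply: le_trans (lee_abs _); rewrite -pE; exact: h2.
Qed.
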